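(* Let $(Ku)(x)=\int_{-1}^{1}k(x-y)u(y)\,dy$ and let $L_1u=(bu')'+cu$, $b(\pm1)=0$, be a second order differential operator with complex coefficients, $L_2=-L_1$, where $b,c,k$ are smooth complex-valued functions on $[-2,2]$. Assume that $k(-z)=\overline{k(z)}$ for $z\in[-2,2]$ and that $k$ is analytic at $0$ but not identically zero near $0$. If $\overline KL_1=L_2K$ (that is, $\overline KL_1=-L_1K$), then $k$ is trivial.
   Context: $K$ acts on functions on $[-1,1]$; $\overline K$ is the convolution operator with kernel $\overline{k}$. The relation $\overline KL_1=L_2K$ means $\overline KL_1u=L_2Ku$ for all smooth $u$ on $[-1,1]$. ''Second order'' means that $b$ is not identically zero. A kernel $k$ is called trivial if it is a finite linear combination of exponentials $e^{\alpha z}$ ($\alpha\in\mathbb{C}$), or has the form $e^{\alpha z}p(z)$ with $\alpha\in\mathbb C$ and $p$ a polynomial.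
   Formalization: As stated it fails if b vanishes near both ±1 (c=0, k constant near 0 with a bump near ±2). Proved: k is trivial on all z=x-y, x,y in [-1,1], with b(x) or b(y) nonzero, and on [-2,2] if b is not identically zero near 1 or near -1; b is taken not identically zero on [-1,1]. *)

(* Defs.v *)
(* Stdlib reals with Coquelicot; C is a normed module over R throughout. *)
From Stdlib Require Import Reals Lra.
From Coquelicot Require Import Coquelicot.
Open Scope R_scope.

Definition Cexp (w : C) : C :=
  (exp (Re w) * cos (Im w), exp (Re w) * sin (Im w)).

(* Derivative at x of the restriction of f to [lo, hi]: one-sided at the
   endpoints, and independent of the values of f off [lo, hi]. *)
Definition is_derive_on (lo hi : R) (f : R -> C) (x : R) (l : C) : Prop :=
  @filterdiff R_AbsRing R_NormedModule C_R_NormedModule f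
    (within (fun y => lo <= y <= hi) (locally x))
    (fun h => @scal R_AbsRing C_R_NormedModule h l).

(* Meaningful only when lo < hi, lo <= x <= hi and the derivative exists. *)
Definition Derive_on (lo hi : R) (f : R -> C) (x : R) : C :=
  @iota C_R_CompleteNormedModule (is_derive_on lo hi f x).

(* C^infinity on the closed interval: d n is the n-th derivative of f. *)
Definition smooth_on (lo hi : R) (f : R -> C) : Prop :=
  exists d : nat -> R -> C,
    (forall x, lo <= x <= hi -> d 0%nat x = f x) /\
    (forall n x, lo <= x <= hi -> is_derive_on lo hi (d n) x (d (S n) x)).

Definition analytic_at_0 (k : R -> C) : Prop :=
  exists (a : nat -> C) (r : R), 0 < r /\
    forall z : R, Rabs z < r ->
      @is_pseries R_AbsRing C_R_NormedModule a z (k z).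

Definition conv_op (k u : R -> C) (x : R) : C :=
  @RInt C_R_CompleteNormedModule
    (fun y => Cmult (k (x - y)) (u y)) (-1) 1.

Definition conj_kernel (k : R -> C) (z : R) : C := Cconj (k z).

Definition diff_op (b c u : R -> C) (x : R) : C :=
  Cplus
    (Derive_on (-1) 1 (fun y => Cmult (b y) (Derive_on (-1) 1 u y)) x)
    (Cmult (c x) (u x)).

(* Repeated exponents and zero coefficients are harmless, so indexing the
   terms by 0..n covers every finite linear combination, 0 included. *)
Definition exp_combination (n : nat) (a alpha : nat -> C) (z : R) : C :=
  sum_n (fun j => Cmult (a j) (Cexp (Cmult (alpha j) (RtoC z)))) n.

Definition exp_polynomial (alpha : C) (n : nat) (p : nat -> C) (z : R) : C :=
  Cmult (Cexp (Cmult alpha (RtoC z)))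
        (sum_n (fun j => Cmult (p j) (RtoC (z ^ j))) n).

Definition trivial_on (D : R -> Prop) (k : R -> C) : Prop :=
  (exists (n : nat) (a alpha : nat -> C),
     forall z, D z -> k z = exp_combination n a alpha z) \/
  (exists (alpha : C) (n : nat) (p : nat -> C),
     forall z, D z -> k z = exp_polynomial alpha n p z).

(* The z = x - y at which the relation involves second derivatives of k at
   all: the union of the intervals |z| <= 1 + |y| over y in [-1, 1] with
   b y <> 0.  If b is not identically zero it contains [-1, 1].  The values
   of k off this set need not be constrained: if b vanishes for |y| > 1/4 and
   c = 0, then every k that is constant on [-5/4, 5/4] satisfies
   K L1 u = 0 = L1 K u for all u. *)
Definition second_order_zone (b : R -> C) (z : R) : Prop :=
  exists x y : R, -1 <= x <= 1 /\ -1 <= y <= 1 /\ z = x - y /\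
    (b x <> RtoC 0 \/ b y <> RtoC 0).

(* -1 or 1 is a limit of points of [-1, 1] at which b does not vanish. *)
Definition nonzero_near_endpoint (b : R -> C) : Prop :=
  forall eps : R, 0 < eps ->
    exists y : R, 1 - eps < Rabs y <= 1 /\ b y <> RtoC 0.

(* Main.v *)
(* Testing against polynomials turns the operator identity into
   b(y) k''(-z) + b'(y) k'(-z) + c(y) k(-z) + b(x) k''(z) + b'(x) k'(z) + c(x) k(z) = 0, z = x - y.
   Together with its conjugate this is a linear system for k'' whose determinant
   |b(x)|^2 - |b(y)|^2 vanishes to first order at z = 0.  The resulting singular
   equation has no solution with k(0) = 0 other than k = 0 near 0.  So k(0) <> 0, and
   multiplying k by an imaginary exponential makes k'(0) = 0; then c = lam b.
   If k''(0) = 0, then c = 0, the singular equation gives k' = 0 near 0, and a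
   uniqueness argument for flat solutions propagates this over the whole zone.
   If k''(0) <> 0, the second z-derivative at 0 is a constant-coefficient equation
   for b, so b = A e^{al x} + A' e^{be x} with e^{2(al - be)} = 1.  Separating the two
   exponentials gives e^{-al z/2} k(-z) + e^{al z/2} k(z) = 2 k(0) cosh(mu z), and the
   same for be and nu.  Hence k is a quotient with denominator e^{al z} - e^{be z}, and
   smoothness of k at a zero of the denominator makes the quotient a finite sum of
   exponentials. *)
Require Import Defs.
From Stdlib Require Import Reals Lra Lia ZArith Classical.
From Coquelicot Require Import Coquelicot.
Open Scope R_scope.

(** * Calculus of complex-valued functions of a real variable *)

(** Away from 0 the kernel is only smooth, so what is known near 0 does not continue outward by
    analyticity, and the linear system for k'' degenerates wherever |b(x)| = |b(y)|. What helps is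
    that k depends on z = x - y alone: for each z one may choose the row y. For every z > 0 in the
    zone there is a row on which the determinant is nonzero or vanishes only to first order; were
    there none, b would vanish at both ends of every pair at distance z, by continuation from b(1) =
    0. The boundary values of b enter three more times. They kill the boundary terms of the
    integration by parts; they exclude b' = w b, which is what k(0) = 0 and k'(0) <> 0 would give;
    and they exclude a double characteristic root and produce e^{2(al - be)} = 1. The normalisation
    k'(0) = 0 costs nothing because e^{2ax} e^{-a(x - y)} = e^{a(x + y)} is symmetric in x and y,
    and a = k'(0)/k(0) is imaginary because k(0) is real and k'(0) imaginary. At the ends of [-2, 2]
    only one-sided derivatives exist, so all calculus takes place on the open interval and endpoint
    values are recovered by continuity. *)

Definition is_Cderive (f : R -> C) (x : R) (l : C) : Prop :=
  is_derive (fun t => Re (f t)) x (Re l) /\ is_derive (fun t => Im (f t)) x (Im l).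

Lemma Cderive_eq (f : R -> C) (x : R) (l l' : C) : is_Cderive f x l -> l = l' -> is_Cderive f x l'.
Proof. now intros H <-. Qed.

Lemma Cderive_const (w : C) (x : R) : is_Cderive (fun _ => w) x (RtoC 0).
Proof. split; apply (is_derive_const (V := R_NormedModule)). Qed.

Lemma Cderive_plus (f g : R -> C) (x : R) (l m : C) :
  is_Cderive f x l -> is_Cderive g x m -> is_Cderive (fun t => Cplus (f t) (g t)) x (Cplus l m).
Proof.
  intros [H1 H2] [H3 H4]; split; simpl; apply (is_derive_plus (V := R_NormedModule)); assumption.
Qed.

Lemma Cderive_opp (f : R -> C) (x : R) (l : C) :
  is_Cderive f x l -> is_Cderive (fun t => Copp (f t)) x (Copp l).
Proof.
  intros [H1 H2]; split; simpl; apply (is_derive_opp (V := R_NormedModule)); assumption.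
Qed.

Lemma Cderive_mult (f g : R -> C) (x : R) (l m : C) :
  is_Cderive f x l -> is_Cderive g x m ->
  is_Cderive (fun t => Cmult (f t) (g t)) x (Cplus (Cmult l (g x)) (Cmult (f x) m)).
Proof.
  intros [H1 H2] [H3 H4].
  pose proof (is_derive_mult _ _ _ _ _ H1 H3 Rmult_comm) as P1.
  pose proof (is_derive_mult _ _ _ _ _ H2 H4 Rmult_comm) as P2.
  pose proof (is_derive_mult _ _ _ _ _ H1 H4 Rmult_comm) as P3.
  pose proof (is_derive_mult _ _ _ _ _ H2 H3 Rmult_comm) as P4.
  pose proof (is_derive_minus _ _ _ _ _ P1 P2) as Q1.
  pose proof (is_derive_plus _ _ _ _ _ P3 P4) as Q2.
  split.
  - eapply is_derive_ext; [|eapply (eq_ind _ (is_derive _ x) Q1)].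
    + intros t; unfold minus, plus, opp, mult, Re, Im; simpl; unfold Re, Im; ring.
    + unfold minus, plus, opp, mult, Re, Im; simpl; unfold Re, Im; ring.
  - eapply is_derive_ext; [|eapply (eq_ind _ (is_derive _ x) Q2)].
    + intros t; unfold minus, plus, opp, mult, Re, Im; simpl; unfold Re, Im; ring.
    + unfold minus, plus, opp, mult, Re, Im; simpl; unfold Re, Im; ring.
Qed.

Lemma Cderive_scal (w : C) (f : R -> C) (x : R) (l : C) :
  is_Cderive f x l -> is_Cderive (fun t => Cmult w (f t)) x (Cmult w l).
Proof.
  intros H; eapply Cderive_eq; [apply (Cderive_mult _ _ _ _ _ (Cderive_const w x) H)|]; ring.
Qed.

Lemma Cderive_conj (f : R -> C) (x : R) (l : C) :
  is_Cderive f x l -> is_Cderive (fun t => Cconj (f t)) x (Cconj l).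
Proof.
  intros [H1 H2]; split; simpl; [exact H1|].
  apply (is_derive_opp (V := R_NormedModule)); assumption.
Qed.

Lemma Cderive_RtoC (f : R -> R) (x l : R) : is_derive f x l -> is_Cderive (fun t => RtoC (f t)) x (RtoC l).
Proof. intros H; split; simpl; [exact H|apply (is_derive_const (V := R_NormedModule))]. Qed.

Lemma Cderive_ext_loc (f g : R -> C) (x : R) (l : C) :
  locally x (fun t => f t = g t) -> is_Cderive f x l -> is_Cderive g x l.
Proof.
  intros E [H1 H2]; split.
  - refine (is_derive_ext_loc _ _ _ _ _ H1); revert E; apply filter_imp; now intros t ->.
  - refine (is_derive_ext_loc _ _ _ _ _ H2); revert E; apply filter_imp; now intros t ->.
Qed.

Lemma Cderive_comp (f : R -> C) (g : R -> R) (x m : R) (l : C) :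
  is_Cderive f (g x) l -> is_derive g x m -> is_Cderive (fun t => f (g t)) x (Cmult (RtoC m) l).
Proof.
  intros [H1 H2] Hg; split.
  - replace (Re (RtoC m * l)%C) with (scal m (Re l)) by (unfold scal, Re; simpl; unfold mult; simpl; ring).
    apply (is_derive_comp (V := R_NormedModule) (fun t => Re (f t)) g x _ _ H1 Hg).
  - replace (Im (RtoC m * l)%C) with (scal m (Im l)) by (unfold scal, Im, Re; simpl; unfold mult; simpl; ring).
    apply (is_derive_comp (V := R_NormedModule) (fun t => Im (f t)) g x _ _ H2 Hg).
Qed.

Lemma Cderive_shift (f : R -> C) (y x : R) (l : C) :
  is_Cderive f (y + x) l -> is_Cderive (fun t => f (y + t)) x l.
Proof.
  intros H. eapply Cderive_eq; [apply (Cderive_comp f (fun t => y + t) x 1 l H)|ring].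
  auto_derive; auto; ring.
Qed.

Lemma Cderive_neg (f : R -> C) (x : R) (l : C) :
  is_Cderive f (- x) l -> is_Cderive (fun t => f (- t)) x (Copp l).
Proof.
  intros H. eapply Cderive_eq; [apply (Cderive_comp f (fun t => - t) x (-1) l H)|].
  - auto_derive; auto; ring.
  - change (IZR (-1)) with (- (1)); rewrite RtoC_opp; ring.
Qed.

Lemma Cderive_reflect (f : R -> C) (y x : R) (l : C) :
  is_Cderive f (y - x) l -> is_Cderive (fun t => f (y - t)) x (Copp l).
Proof.
  intros H. eapply Cderive_eq; [apply (Cderive_comp f (fun t => y - t) x (-1) l H)|].
  - auto_derive; auto; ring.
  - change (IZR (-1)) with (- (1)); rewrite RtoC_opp; ring.
Qed.

Lemma Cderive_unique (f : R -> C) (x : R) (l m : C) : is_Cderive f x l -> is_Cderive f x m -> l = m.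
Proof.
  intros [H1 H2] [H3 H4].
  apply injective_projections.
  - exact (eq_trans (eq_sym (is_derive_unique _ _ _ H1)) (is_derive_unique _ _ _ H3)).
  - exact (eq_trans (eq_sym (is_derive_unique _ _ _ H2)) (is_derive_unique _ _ _ H4)).
Qed.

(** * The complex exponential *)

Lemma Cexp_plus (u v : C) : Cexp (Cplus u v) = Cmult (Cexp u) (Cexp v).
Proof.
  unfold Cexp, Cmult, Re, Im; simpl; rewrite exp_plus, cos_plus, sin_plus; f_equal; ring.
Qed.

Lemma Cexp_0 : Cexp (RtoC 0) = RtoC 1.
Proof. unfold Cexp; simpl; rewrite exp_0, cos_0, sin_0; unfold RtoC; f_equal; ring. Qed.

Lemma Cexp_opp_l (u : C) : Cmult (Cexp (Copp u)) (Cexp u) = RtoC 1.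
Proof. rewrite <- Cexp_plus, <- Cexp_0; f_equal; ring. Qed.

Lemma Cexp_neq_0 (u : C) : Cexp u <> RtoC 0.
Proof.
  intros E; generalize (Cexp_opp_l u); rewrite E, Cmult_0_r; intros H.
  injection H; intros; lra.
Qed.

Lemma Cderive_Cexp (w : C) (x : R) :
  is_Cderive (fun t => Cexp (Cmult w (RtoC t))) x (Cmult w (Cexp (Cmult w (RtoC x)))).
Proof.
  destruct w as [p q]; split; unfold Cexp, Cmult, RtoC, Re, Im; simpl; auto_derive; auto; unfold Rminus; ring.
Qed.

Definition Ccontinuous (f : R -> C) (x : R) : Prop :=
  continuous (fun t => Re (f t)) x /\ continuous (fun t => Im (f t)) x.

Lemma Cderive_cont (f : R -> C) (x : R) (l : C) : is_Cderive f x l -> Ccontinuous f x.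
Proof.
  intros [H1 H2]; split; apply (ex_derive_continuous (V := R_NormedModule)); eexists; eassumption.
Qed.

(** * One-sided derivatives and Landau kernels *)

Lemma locally_open_interval (a b x : R) : a < x < b -> locally x (fun t => a < t < b).
Proof.
  intros H. apply (open_and _ _ (open_gt a) (open_lt b)). exact H.
Qed.

(** The bridge between the derivative of the statement, taken in the normed module of pairs, and the
    componentwise one, to which the real mean value theorem and the real integral apply. *)
Lemma is_derive_pair_Cderive (f : R -> C) (x : R) (l : C) :
  @filterdiff R_AbsRing R_NormedModule C_R_NormedModule f (locally x)
    (fun h => @scal R_AbsRing C_R_NormedModule h l) <-> is_Cderive f x l.
Proof.
  split.
  - intros H; split.
    + apply (filterdiff_comp (U := R_NormedModule) (V := C_R_NormedModule) (W := R_NormedModule)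
        f (fun z : C_R_NormedModule => fst z) _ (fun z : C_R_NormedModule => fst z) H).
      apply filterdiff_linear, (is_linear_fst (U := R_NormedModule) (V := R_NormedModule)).
    + apply (filterdiff_comp (U := R_NormedModule) (V := C_R_NormedModule) (W := R_NormedModule)
        f (fun z : C_R_NormedModule => snd z) _ (fun z : C_R_NormedModule => snd z) H).
      apply filterdiff_linear, (is_linear_snd (U := R_NormedModule) (V := R_NormedModule)).
  - intros [H1 H2].
    apply (filterdiff_ext (U := R_NormedModule) (V := C_R_NormedModule)
      (fun t => (Re (f t), Im (f t)))).
    { intros t; destruct (f t); reflexivity. }
    apply (filterdiff_comp_2 (T := R_NormedModule) (U := R_NormedModule) (V := R_NormedModule)
      (W := C_R_NormedModule) (fun t => Re (f t)) (fun t => Im (f t)) (fun u v => (u, v))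
      _ _ (fun u v => (u, v)) H1 H2).
    apply filterdiff_linear.
    apply (is_linear_prod (fun t : R * R => fst t) (fun t : R * R => snd t)
     (is_linear_fst (U := R_NormedModule) (V := R_NormedModule))
     (is_linear_snd (U := R_NormedModule) (V := R_NormedModule))).
Qed.

Lemma Cderive_is_derive_on (lo hi : R) (f : R -> C) (x : R) (l : C) :
  lo <= x <= hi -> is_Cderive f x l -> is_derive_on lo hi f x l.
Proof.
  intros Hx H; unfold is_derive_on.
  assert (PF : ProperFilter (within (fun y => lo <= y <= hi) (locally x))).
  { split.
    - intros P [eps HP]; exists x; apply HP; [apply ball_center|exact Hx].
    - apply within_filter, locally_filter. }
  apply filterdiff_locally with (x := x).
  - intros P HP; apply filter_le_within; exact HP.
  - apply is_derive_pair_Cderive, H.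
Qed.

(** Near an interior point the constraint of the relative filter holds automatically. *)
Lemma is_derive_on_Cderive (lo hi : R) (f : R -> C) (x : R) (l : C) :
  lo < x < hi -> is_derive_on lo hi f x l -> is_Cderive f x l.
Proof.
  intros Hx [H1 H2]; apply is_derive_pair_Cderive; split; [exact H1|].
  intros y Hy.
  apply (is_filter_lim_locally_unique (V := R_NormedModule)) in Hy; subst y.
  assert (Hlim : is_filter_lim (within (fun y => lo <= y <= hi) (locally x)) x).
  { intros P HP; apply filter_le_within; exact HP. }
  intros eps.
  pose proof (H2 x Hlim eps) as H3; unfold within in H3.
  generalize (filter_and (F := locally x) _ _ H3 (locally_open_interval lo hi x Hx)).
  apply filter_imp. intros t [H4 H5]. apply H4; lra.
Qed.

(** [Derive_on] is a description by [iota], so its value must be pinned by uniqueness, which comes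
    from the two-sided derivative. Interior points suffice: the operator is evaluated there only,
    and integrals ignore the endpoints. *)
Lemma Derive_on_eq (lo hi : R) (f g : R -> C) (x : R) (l : C) :
  lo < x < hi -> (forall t, lo < t < hi -> f t = g t) -> is_Cderive g x l -> Derive_on lo hi f x = l.
Proof.
  intros Hx E H.
  assert (Hf : is_Cderive f x l).
  { refine (Cderive_ext_loc _ _ _ _ _ H).
    generalize (locally_open_interval lo hi x Hx); apply filter_imp.
    intros t Ht; symmetry; auto. }
  apply (iota_unique (V := C_R_CompleteNormedModule)).
  - intros y Hy. apply (Cderive_unique f x); [eapply is_derive_on_Cderive; eassumption|exact Hf].
  - apply Cderive_is_derive_on; [lra|exact Hf].
Qed.

(** Syntax trees make the test functions closed under differentiation and powers at no cost:
    iterating [pderiv] is the derivative sequence that [smooth_on] asks for, and no degree or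
    coefficient is ever needed. *)
Inductive pexpr := pvar | pcst (r : R) | padd (p q : pexpr) | pmul (p q : pexpr).

Fixpoint peval (p : pexpr) (y : R) : R :=
  match p with
  | pvar => y | pcst r => r
  | padd p q => peval p y + peval q y
  | pmul p q => peval p y * peval q y
  end.

Fixpoint pderiv (p : pexpr) : pexpr :=
  match p with
  | pvar => pcst 1 | pcst r => pcst 0
  | padd p q => padd (pderiv p) (pderiv q)
  | pmul p q => padd (pmul (pderiv p) q) (pmul p (pderiv q))
  end.

Lemma is_derive_peval (p : pexpr) (y : R) : is_derive (peval p) y (peval (pderiv p) y).
Proof.
  induction p as [| |p IHp q IHq|p IHp q IHq]; simpl.
  - apply (is_derive_id (K := R_AbsRing)).
  - apply (is_derive_const (V := R_NormedModule)).
  - apply (is_derive_plus (V := R_NormedModule)); assumption.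
  - exact (is_derive_mult _ _ _ _ _ IHp IHq Rmult_comm).
Qed.

Lemma smooth_on_peval (lo hi : R) (p : pexpr) : smooth_on lo hi (fun y => RtoC (peval p y)).
Proof.
  exists (fun n y => RtoC (peval (Nat.iter n pderiv p) y)); split; [reflexivity|].
  intros n x Hx; apply Cderive_is_derive_on; [exact Hx|].
  apply Cderive_RtoC, is_derive_peval.
Qed.

Fixpoint ppow (p : pexpr) (n : nat) : pexpr :=
  match n with O => pcst 1 | S n => pmul p (ppow p n) end.

Lemma peval_ppow (p : pexpr) (n : nat) (y : R) : peval (ppow p n) y = peval p y ^ n.
Proof. induction n as [|n IH]; simpl; [reflexivity|now rewrite IH]. Qed.

Lemma continuous_peval (p : pexpr) (y : R) : continuous (peval p) y.
Proof.
  apply (ex_derive_continuous (V := R_NormedModule)); eexists; apply is_derive_peval.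
Qed.

Lemma pow_unbounded (q C : R) : 1 < q -> exists n, C < q ^ n.
Proof.
  intros Hq.
  destruct (Pow_x_infinity q) with (b := C + 1) as [n Hn].
  { rewrite Rabs_pos_eq; lra. }
  exists n. specialize (Hn n (le_n n)). rewrite Rabs_pos_eq in Hn; [lra|].
  apply pow_le; lra.
Qed.

Lemma continuous_bounded (g : R -> R) (a b : R) : a <= b ->
  (forall y, a <= y <= b -> continuous g y) -> exists M, forall y, a <= y <= b -> Rabs (g y) <= M.
Proof.
  intros Hab Hg.
  destruct (continuity_ab_maj (fun y => Rabs (g y)) a b Hab) as [m [Hm _]].
  { intros c Hc. apply continuity_pt_filterlim.
    apply (continuous_comp g Rabs c (Hg c Hc)), continuous_Rabs. }
  exists (Rabs (g m)). exact Hm.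
Qed.

(* The weights (1 + (d^2 - (y - y0)^2) / 4)^n blow up near y0 and stay in
   [0, 1] on the rest of [-1, 1] (Landau kernels). *)
Lemma orthogonal_to_polynomials_le0 (g : R -> R) (y0 : R) : -1 < y0 < 1 ->
  (forall y, -1 <= y <= 1 -> continuous g y) ->
  (forall p, RInt (fun y => g y * peval p y) (-1) 1 = 0) -> g y0 <= 0.
Proof.
  intros Hy0 Hg Hp. apply Rnot_lt_le; intros Hpos.
  destruct (continuous_bounded g (-1) 1) as [M HM]; [lra|exact Hg|].
  assert (HM0 : 0 <= M) by (eapply Rle_trans; [apply Rabs_pos|apply (HM y0); lra]).
  destruct (Hg y0) with (P := fun v => g y0 / 2 < v) as [e He]; [lra| |].
  { apply (open_gt (g y0 / 2)); lra. }
  (* Half the radius of continuity, so that the closed interval |y - y0| <= d lies in the ball, and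
     half the distances to -1 and 1, so that it lies in [-1, 1]. *)
  set (d := Rmin (e / 2) (Rmin ((1 + y0) / 2) ((1 - y0) / 2))).
  assert (Hd0 : 0 < d).
  { unfold d; repeat apply Rmin_glb_lt; try lra. apply is_pos_div_2. }
  assert (Hd1 : d <= e / 2) by apply Rmin_l.
  assert (Hd2 : d <= (1 + y0) / 2) by (eapply Rle_trans; [apply Rmin_r|apply Rmin_l]).
  assert (Hd3 : d <= (1 - y0) / 2) by (eapply Rle_trans; [apply Rmin_r|apply Rmin_r]).
  assert (Hnear : forall y, Rabs (y - y0) <= d -> g y0 / 2 < g y).
  { intros y Hy. apply He. change (Rabs (y - y0) < e). destruct e as [e He0]; simpl in *; lra. }
  (* The factor 1/4 keeps the weight nonnegative: (y - y0)^2 <= 4 on [-1, 1]. *)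
  set (w := padd (pcst (1 + d * d / 4)) (pmul (pcst (- / 4)) (pmul (padd pvar (pcst (- y0))) (padd pvar (pcst (- y0)))))).
  assert (Hw : forall y, peval w y = 1 + (d * d - (y - y0) * (y - y0)) / 4).
  { intros y; simpl; field. }
  (* The minimum of [w] over |y - y0| <= d / 2. *)
  set (q := 1 + 3 * d * d / 16).
  assert (Hq : 1 < q) by (unfold q; nra).
  (* The middle interval, of length d, contributes at least d (g y0 / 2) q^n, which is then above 2
     M; the rest contributes at least -(2 - d) M. *)
  destruct (pow_unbounded q (4 * M / (g y0 * d)) Hq) as [n Hn].
  set (h := fun y => g y * peval (ppow w n) y).
  assert (Hh : forall y, -1 <= y <= 1 -> continuous h y).
  { intros y Hy; apply (continuous_mult (K := R_AbsRing)); [auto|apply continuous_peval]. }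
  assert (Hw0 : forall y, -1 <= y <= 1 -> 0 <= peval w y).
  { intros y Hy; rewrite Hw; nra. }
  assert (Hlow : forall y, -1 <= y <= 1 -> - M <= h y).
  { intros y Hy. unfold h; rewrite peval_ppow. specialize (Hw0 y Hy).
    destruct (Rle_dec (Rabs (y - y0)) d) as [H|H].
    - specialize (Hnear y H). assert (0 <= peval w y ^ n) by now apply pow_le. nra.
    - assert (peval w y <= 1).
      { rewrite Hw. apply Rnot_le_lt in H.
        assert (d * d <= (y - y0) * (y - y0)); [|lra].
        assert (Rabs (y - y0) * Rabs (y - y0) = (y - y0) * (y - y0)).
        { rewrite <- Rabs_mult; apply Rabs_pos_eq, Rle_0_sqr. }
        nra. }
      assert (0 <= peval w y ^ n) by now apply pow_le.
      assert (peval w y ^ n <= 1) by (rewrite <- (pow1 n); apply pow_incr; lra).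
      specialize (HM y Hy). apply Rabs_le_between in HM. nra. }
  assert (Hhigh : forall y, y0 - d / 2 <= y <= y0 + d / 2 -> g y0 / 2 * q ^ n <= h y).
  { intros y Hy. unfold h; rewrite peval_ppow.
    assert (Ha : Rabs (y - y0) <= d) by (apply Rabs_le; lra).
    specialize (Hnear y Ha).
    assert (q ^ n <= peval w y ^ n).
    { apply pow_incr; split; [lra|]. rewrite Hw; unfold q.
      assert (0 <= (d / 2 - (y - y0)) * (d / 2 + (y - y0))) by (apply Rmult_le_pos; lra). nra. }
    assert (0 <= q ^ n) by (apply pow_le; lra). nra. }
  assert (Hex : forall a b, -1 <= a <= 1 -> -1 <= b <= 1 -> a <= b -> ex_RInt h a b).
  { intros a b Ha Hb Hab. apply (ex_RInt_continuous (V := R_CompleteNormedModule)).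
    rewrite Rmin_left, Rmax_right by lra. intros z Hz; apply Hh; lra. }
  assert (Hc : forall r a b, a <= b -> RInt (fun _ => r) a b = (b - a) * r).
  { intros; rewrite (RInt_const (V := R_CompleteNormedModule)); reflexivity. }
  pose proof (Hp (ppow w n)) as H0. fold h in H0.
  rewrite <- (RInt_Chasles (V := R_CompleteNormedModule) h (-1) (y0 - d / 2) 1) in H0 by (apply Hex; lra).
  rewrite <- (RInt_Chasles (V := R_CompleteNormedModule) h (y0 - d / 2) (y0 + d / 2) 1) in H0 by (apply Hex; lra).
  unfold plus in H0; simpl in H0.
  assert (I1 : RInt (fun _ => - M) (-1) (y0 - d / 2) <= RInt h (-1) (y0 - d / 2)).
  { apply RInt_le; [lra|apply ex_RInt_const|apply Hex; lra|intros; apply Hlow; lra]. }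
  assert (I2 : RInt (fun _ => g y0 / 2 * q ^ n) (y0 - d / 2) (y0 + d / 2) <= RInt h (y0 - d / 2) (y0 + d / 2)).
  { apply RInt_le; [lra|apply ex_RInt_const|apply Hex; lra|intros; apply Hhigh; lra]. }
  assert (I3 : RInt (fun _ => - M) (y0 + d / 2) 1 <= RInt h (y0 + d / 2) 1).
  { apply RInt_le; [lra|apply ex_RInt_const|apply Hex; lra|intros; apply Hlow; lra]. }
  rewrite Hc in I1, I2, I3 by lra.
  assert (Hn' : 4 * M < q ^ n * (g y0 * d)).
  { apply Rlt_div_l in Hn; [exact Hn|nra]. }
  nra.
Qed.

Lemma orthogonal_to_polynomials (g : R -> R) (y0 : R) : -1 < y0 < 1 ->
  (forall y, -1 <= y <= 1 -> continuous g y) ->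
  (forall p, RInt (fun y => g y * peval p y) (-1) 1 = 0) -> g y0 = 0.
Proof.
  intros Hy0 Hg Hp. apply Rle_antisym.
  - now apply orthogonal_to_polynomials_le0.
  - cut (- g y0 <= 0); [lra|].
    apply (orthogonal_to_polynomials_le0 (fun y => - g y)); [exact Hy0| |].
    + intros y Hy; apply (continuous_opp (V := R_NormedModule)); auto.
    + intros p. rewrite (RInt_ext _ (fun y => opp (g y * peval p y))).
      * rewrite (RInt_opp (V := R_CompleteNormedModule)), Hp; [apply Ropp_0|].
        apply (ex_RInt_continuous (V := R_CompleteNormedModule)).
        rewrite Rmin_left, Rmax_right by lra. intros z Hz.
        apply (continuous_mult (K := R_AbsRing)); [auto|apply continuous_peval].
      * intros y _; unfold opp; simpl; ring.
Qed.

(** * From the operator relation to a pointwise relation *)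

Lemma Ccontinuous_mult (f g : R -> C) (x : R) : Ccontinuous f x -> Ccontinuous g x ->
  Ccontinuous (fun t => Cmult (f t) (g t)) x.
Proof.
  intros [H1 H2] [H3 H4]; split.
  - apply (continuous_minus (V := R_NormedModule)
      (fun t => Re (f t) * Re (g t)) (fun t => Im (f t) * Im (g t)));
      apply (continuous_mult (K := R_AbsRing)); assumption.
  - apply (continuous_plus (V := R_NormedModule)
      (fun t => Re (f t) * Im (g t)) (fun t => Im (f t) * Re (g t)));
      apply (continuous_mult (K := R_AbsRing)); assumption.
Qed.

Lemma Ccontinuous_plus (f g : R -> C) (x : R) : Ccontinuous f x -> Ccontinuous g x ->
  Ccontinuous (fun t => Cplus (f t) (g t)) x.
Proof.
  intros [H1 H2] [H3 H4]; split; apply (continuous_plus (V := R_NormedModule)); assumption.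
Qed.

Lemma Ccontinuous_opp (f : R -> C) (x : R) : Ccontinuous f x -> Ccontinuous (fun t => Copp (f t)) x.
Proof.
  intros [H1 H2]; split; apply (continuous_opp (V := R_NormedModule)); assumption.
Qed.

Lemma Ccontinuous_conj (f : R -> C) (x : R) : Ccontinuous f x -> Ccontinuous (fun t => Cconj (f t)) x.
Proof.
  intros [H1 H2]; split; [exact H1|]; apply (continuous_opp (V := R_NormedModule)); assumption.
Qed.

Lemma Ccontinuous_const (w : C) (x : R) : Ccontinuous (fun _ => w) x.
Proof. split; apply continuous_const. Qed.

Lemma Ccontinuous_reflect (f : R -> C) (y x : R) : Ccontinuous f (y - x) -> Ccontinuous (fun t => f (y - t)) x.
Proof.
  assert (H : continuous (fun t => y - t) x).
  { apply (continuous_minus (V := R_NormedModule)); [apply continuous_const|apply continuous_id]. }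
  intros [H1 H2]; split.
  - apply (continuous_comp (fun t => y - t) (fun t => Re (f t)) x H H1).
  - apply (continuous_comp (fun t => y - t) (fun t => Im (f t)) x H H2).
Qed.

Lemma Ccontinuous_peval (p : pexpr) (x : R) : Ccontinuous (fun t => RtoC (peval p t)) x.
Proof. split; [apply continuous_peval|apply continuous_const]. Qed.

Ltac ccont := repeat lazymatch goal with
  | |- Ccontinuous (fun t => Cplus _ _) _ => apply Ccontinuous_plus
  | |- Ccontinuous (fun t => Cmult _ _) _ => apply Ccontinuous_mult
  | |- Ccontinuous (fun t => Copp _) _ => apply Ccontinuous_opp
  | |- Ccontinuous (fun t => Cconj _) _ => apply Ccontinuous_conj
  | |- Ccontinuous (fun t => ?w) _ => apply Ccontinuous_const
  end.

(** * Complex integrals over [-1, 1] and differentiation under the integral sign *)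

Definition is_CRInt (f : R -> C) (l : C) : Prop :=
  is_RInt (fun t => Re (f t)) (-1) 1 (Re l) /\ is_RInt (fun t => Im (f t)) (-1) 1 (Im l).

Lemma CRInt_RInt (f : R -> C) (l : C) : is_CRInt f l -> @RInt C_R_CompleteNormedModule f (-1) 1 = l.
Proof.
  intros [H1 H2]. apply (is_RInt_unique (V := C_R_CompleteNormedModule)).
  destruct l as [l1 l2].
  apply (is_RInt_fct_extend_pair (U := R_NormedModule) (V := R_NormedModule)); assumption.
Qed.

Lemma CRInt_cont (f : R -> C) : (forall y, -1 <= y <= 1 -> Ccontinuous f y) ->
  is_CRInt f (@RInt C_R_CompleteNormedModule f (-1) 1).
Proof.
  intros H.
  assert (H' : is_CRInt f (RInt (fun t => Re (f t)) (-1) 1, RInt (fun t => Im (f t)) (-1) 1)).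
  { assert (E : forall g : R -> R, (forall y, -1 <= y <= 1 -> continuous g y) ->
      is_RInt g (-1) 1 (RInt g (-1) 1)).
    { intros g Hg; apply (RInt_correct (V := R_CompleteNormedModule)).
      apply (ex_RInt_continuous (V := R_CompleteNormedModule)).
      rewrite Rmin_left, Rmax_right by lra; exact Hg. }
    split; apply E; intros y Hy; apply (H y Hy). }
  rewrite (CRInt_RInt _ _ H'); exact H'.
Qed.

Lemma CRInt_ext (f g : R -> C) (l : C) : (forall y, -1 < y < 1 -> f y = g y) -> is_CRInt f l -> is_CRInt g l.
Proof.
  intros E [H1 H2]; split.
  - eapply is_RInt_ext; [|exact H1]. rewrite Rmin_left, Rmax_right by lra.
    intros y Hy; simpl; now rewrite E.
  - eapply is_RInt_ext; [|exact H2]. rewrite Rmin_left, Rmax_right by lra.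
    intros y Hy; simpl; now rewrite E.
Qed.

Lemma CRInt_plus (f g : R -> C) (l m : C) : is_CRInt f l -> is_CRInt g m ->
  is_CRInt (fun t => Cplus (f t) (g t)) (Cplus l m).
Proof.
  intros [H1 H2] [H3 H4]; split; apply (is_RInt_plus (V := R_NormedModule)); assumption.
Qed.

Lemma CRInt_scal (w : C) (f : R -> C) (l : C) : is_CRInt f l ->
  is_CRInt (fun t => Cmult w (f t)) (Cmult w l).
Proof.
  intros [H1 H2]; split.
  - apply (is_RInt_minus (V := R_NormedModule) (fun t => Re w * Re (f t)) (fun t => Im w * Im (f t)));
      apply (is_RInt_scal (V := R_NormedModule)); assumption.
  - apply (is_RInt_plus (V := R_NormedModule) (fun t => Re w * Im (f t)) (fun t => Im w * Re (f t)));
      apply (is_RInt_scal (V := R_NormedModule)); assumption.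
Qed.

Lemma CRInt_derive (f df : R -> C) : (forall y, -1 <= y <= 1 -> is_Cderive f y (df y)) ->
  (forall y, -1 <= y <= 1 -> Ccontinuous df y) -> is_CRInt df (Cminus (f 1) (f (-1))).
Proof.
  intros H1 H2; split.
  - apply (is_RInt_derive (V := R_CompleteNormedModule) (fun t => Re (f t)) (fun t => Re (df t)));
      rewrite Rmin_left, Rmax_right by lra; intros y Hy; [apply (H1 y Hy)|apply (H2 y Hy)].
  - apply (is_RInt_derive (V := R_CompleteNormedModule) (fun t => Im (f t)) (fun t => Im (df t)));
      rewrite Rmin_left, Rmax_right by lra; intros y Hy; [apply (H1 y Hy)|apply (H2 y Hy)].
Qed.

Lemma is_derive_shift_scal (F : R -> R) (s t w l : R) : is_derive F (s - t) l ->
  is_derive (fun u => F (u - t) * w) s (l * w).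
Proof.
  intros H.
  assert (Hc : is_derive (fun u => F (u - t)) s (1 * l)).
  { apply (is_derive_comp (V := R_NormedModule) F (fun u => u - t)); [exact H|].
    auto_derive; auto; ring. }
  replace (l * w) with (w * (1 * l)) by ring.
  eapply is_derive_ext; [|exact (is_derive_scal _ _ w _ Hc)].
  intros u; simpl; ring.
Qed.

(** The derivative falls on the kernel alone. Taking x in the open interval keeps x - y inside (-2,
    2) even for y = -1 and y = 1, so two-sided derivatives of the kernel are enough. *)
Lemma is_derive_convolution (F F' U : R -> R) (x : R) : -1 < x < 1 ->
  (forall z, -2 < z < 2 -> is_derive F z (F' z)) ->
  (forall z, -2 < z < 2 -> continuous F' z) ->
  (forall y, continuous U y) ->
  is_derive (fun s => RInt (fun y => F (s - y) * U y) (-1) 1) x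
    (RInt (fun y => F' (x - y) * U y) (-1) 1).
Proof.
  intros Hx HF HF' HU.
  assert (D : forall s t, -1 < s < 1 -> -1 <= t <= 1 ->
     is_derive (fun u => F (u - t) * U t) s (F' (s - t) * U t)).
  { intros s t Hs Ht. apply is_derive_shift_scal, HF; lra. }
  assert (E : RInt (fun y => F' (x - y) * U y) (-1) 1 =
    RInt (fun y => Derive (fun u => F (u - y) * U y) x) (-1) 1).
  { apply RInt_ext; rewrite Rmin_left, Rmax_right by lra.
    intros y Hy; symmetry; apply is_derive_unique, D; lra. }
  rewrite E.
  apply (is_derive_RInt_param (fun s y => F (s - y) * U y)).
  - rewrite Rmin_left, Rmax_right by lra.
    generalize (locally_open_interval (-1) 1 x Hx); apply filter_imp.
    intros s Hs t Ht; eexists; apply D; assumption.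
  - rewrite Rmin_left, Rmax_right by lra. intros t Ht.
    apply continuity_2d_pt_ext_loc with (f := fun u v => F' (u - v) * U v).
    + destruct (locally_open_interval (-1) 1 x Hx) as [e He].
      destruct (locally_open_interval (-2) 2 (x - t)) as [e2 He2]; [lra|].
      (* Halved, because u - v moves by at most the sum of the displacements of u and v. *)
      assert (Hmin : 0 < Rmin e (e2 / 2)) by (apply Rmin_glb_lt; [apply cond_pos|apply is_pos_div_2]).
      exists (mkposreal _ Hmin); intros u v Hu Hv; simpl in Hu, Hv.
      pose proof (Rmin_l e (e2 / 2)); pose proof (Rmin_r e (e2 / 2)).
      symmetry; apply is_derive_unique, is_derive_shift_scal, HF, He2.
      change (Rabs (u - v - (x - t)) < e2).
      replace (u - v - (x - t)) with ((u - x) + - (v - t)) by ring.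
      eapply Rle_lt_trans; [apply Rabs_triang|]. rewrite Rabs_Ropp; lra.
    + apply continuity_2d_pt_mult.
      * apply (continuity_1d_2d_pt_comp F' (fun u v => u - v)).
        -- apply continuity_pt_filterlim, HF'; lra.
        -- apply continuity_2d_pt_minus; [apply continuity_2d_pt_id1|apply continuity_2d_pt_id2].
      * apply (continuity_1d_2d_pt_comp U (fun u v => v)).
        -- apply continuity_pt_filterlim, HU.
        -- apply continuity_2d_pt_id2.
  - generalize (locally_open_interval (-1) 1 x Hx); apply filter_imp.
    intros s Hs. apply (ex_RInt_continuous (V := R_CompleteNormedModule)).
    rewrite Rmin_left, Rmax_right by lra. intros t Ht.
    apply (continuous_mult (K := R_AbsRing)); [|apply HU].
    apply (continuous_comp (fun t => s - t) F).
    + apply (continuous_minus (V := R_NormedModule)); [apply continuous_const|apply continuous_id].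
    + apply (ex_derive_continuous (V := R_NormedModule)); eexists; apply HF; lra.
Qed.

Lemma conv_op_is_CRInt (F : R -> C) (u : R -> C) (x : R) : -1 < x < 1 ->
  (forall z, -2 < z < 2 -> Ccontinuous F z) -> (forall y, -1 <= y <= 1 -> Ccontinuous u y) ->
  is_CRInt (fun y => Cmult (F (x - y)) (u y)) (conv_op F u x).
Proof.
  intros Hx HF Hu. apply CRInt_cont. intros y Hy.
  apply Ccontinuous_mult; [|auto]. apply Ccontinuous_reflect, HF; lra.
Qed.

(** A real test function splits the complex convolution into two real ones. *)
Lemma Cderive_conv_op (F F' : R -> C) (p : pexpr) (x : R) : -1 < x < 1 ->
  (forall z, -2 < z < 2 -> is_Cderive F z (F' z)) ->
  (forall z, -2 < z < 2 -> Ccontinuous F' z) ->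
  is_Cderive (conv_op F (fun y => RtoC (peval p y))) x (conv_op F' (fun y => RtoC (peval p y)) x).
Proof.
  intros Hx HF HF'.
  assert (E : forall G s, -1 < s < 1 -> (forall z, -2 < z < 2 -> Ccontinuous G z) ->
    conv_op G (fun y => RtoC (peval p y)) s =
      (RInt (fun y => Re (G (s - y)) * peval p y) (-1) 1, RInt (fun y => Im (G (s - y)) * peval p y) (-1) 1)).
  { intros G s Hs HG.
    destruct (conv_op_is_CRInt G (fun y => RtoC (peval p y)) s Hs HG) as [H1 H2].
    { intros; apply Ccontinuous_peval. }
    apply injective_projections; simpl; symmetry; apply is_RInt_unique.
    - eapply is_RInt_ext; [|exact H1]. intros y _; unfold Re; simpl; ring.
    - eapply is_RInt_ext; [|exact H2]. intros y _; unfold Im; simpl; ring. }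
  assert (HFc : forall z, -2 < z < 2 -> Ccontinuous F z).
  { intros z Hz; exact (Cderive_cont _ _ _ (HF z Hz)). }
  rewrite (E F' x Hx HF').
  apply Cderive_ext_loc with (f := fun s =>
    (RInt (fun y => Re (F (s - y)) * peval p y) (-1) 1, RInt (fun y => Im (F (s - y)) * peval p y) (-1) 1)).
  { generalize (locally_open_interval (-1) 1 x Hx); apply filter_imp.
    intros s Hs; symmetry; auto. }
  split; simpl.
  - apply (is_derive_convolution (fun z => Re (F z)) (fun z => Re (F' z))); try assumption.
    + intros z Hz; apply (HF z Hz).
    + intros z Hz; apply (HF' z Hz).
    + apply continuous_peval.
  - apply (is_derive_convolution (fun z => Im (F z)) (fun z => Im (F' z))); try assumption.
    + intros z Hz; apply (HF z Hz).
    + intros z Hz; apply (HF' z Hz).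
    + apply continuous_peval.
Qed.

(** The interval is open because [smooth_on] gives only one-sided derivatives at -2 and 2. *)
Definition derivs (D : nat -> R -> C) : Prop :=
  forall n x, -2 < x < 2 -> is_Cderive (D n) x (D (S n) x).

Lemma derivs_cont (D : nat -> R -> C) (n : nat) (x : R) :
  derivs D -> -2 < x < 2 -> Ccontinuous (D n) x.
Proof. intros H Hx; exact (Cderive_cont _ _ _ (H n x Hx)). Qed.

Lemma smooth_on_derivs (f : R -> C) : smooth_on (-2) 2 f ->
  exists D, derivs D /\ forall x, -2 <= x <= 2 -> D 0%nat x = f x.
Proof.
  intros [D [H1 H2]]; exists D; split; [|exact H1].
  intros n x Hx; apply (is_derive_on_Cderive (-2) 2); [exact Hx|apply H2; lra].
Qed.

(** For polynomial u, Lagrange's identity moves the operator from u onto the conjugate kernel, and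
    on the other side the derivatives fall on k. The relation then says that the left-hand side, as
    a function of y, is orthogonal to all polynomials. The minus sign before b' comes from d/dy k(x
    - y) = -k'(x - y). *)
Lemma kernel_relation (b c k : R -> C) (B Cf K : nat -> R -> C) :
  derivs B -> derivs Cf -> derivs K ->
  (forall x, -2 <= x <= 2 -> B 0%nat x = b x) ->
  (forall x, -2 <= x <= 2 -> Cf 0%nat x = c x) ->
  (forall x, -2 <= x <= 2 -> K 0%nat x = k x) ->
  b (-1) = RtoC 0 -> b 1 = RtoC 0 ->
  (forall u, smooth_on (-1) 1 u -> forall x, -1 <= x <= 1 ->
    conv_op (conj_kernel k) (diff_op b c u) x = Copp (diff_op b c (conv_op k u) x)) ->
  forall x y, -1 < x < 1 -> -1 < y < 1 ->
  (B 0%nat y * Cconj (K 2%nat (x - y)%R) - B 1%nat y * Cconj (K 1%nat (x - y)%R)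
   + c y * Cconj (K 0%nat (x - y)%R)
   + (B 0%nat x * K 2%nat (x - y)%R + B 1%nat x * K 1%nat (x - y)%R + c x * K 0%nat (x - y)%R))%C = RtoC 0.
Proof.
  intros HB HC HK Eb Ec Ek b1 b2 Hrel x y Hx Hy.
  (* Written with [Cf], which carries a derivative sequence, and with opposites instead of
     differences, so that [ccont] can decompose it. *)
  set (G := fun y => (B 0%nat y * Cconj (K 2%nat (x - y)%R) + - (B 1%nat y * Cconj (K 1%nat (x - y)%R))
   + Cf 0%nat y * Cconj (K 0%nat (x - y)%R)
   + (B 0%nat x * K 2%nat (x - y)%R + B 1%nat x * K 1%nat (x - y)%R + Cf 0%nat x * K 0%nat (x - y)%R))%C).
  assert (HG : forall t, -1 <= t <= 1 -> Ccontinuous G t).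
  { intros t Ht.
    assert (forall n, Ccontinuous (B n) t) by (intros; apply derivs_cont; [assumption|lra]).
    assert (forall n, Ccontinuous (Cf n) t) by (intros; apply derivs_cont; [assumption|lra]).
    assert (forall n, Ccontinuous (fun s => K n (x - s)%R) t).
    { intros; apply Ccontinuous_reflect, derivs_cont; [assumption|lra]. }
    unfold G; ccont; auto. }
  assert (Hint : forall p, is_CRInt (fun t => Cmult (G t) (RtoC (peval p t))) (RtoC 0)).
  { intros p.
    set (U := fun (n : nat) t => RtoC (peval (Nat.iter n pderiv p) t)).
    assert (HU : forall n t, is_Cderive (U n) t (U (S n) t)).
    { intros n t; apply Cderive_RtoC, is_derive_peval. }
    assert (HUc : forall n t, Ccontinuous (U n) t) by (intros; apply Ccontinuous_peval).
    assert (EL : forall t, -1 < t < 1 ->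
      diff_op b c (U 0%nat) t = (B 1%nat t * U 1%nat t + B 0%nat t * U 2%nat t + Cf 0%nat t * U 0%nat t)%C).
    { intros t Ht; unfold diff_op; rewrite <- Ec by lra; f_equal.
      apply (Derive_on_eq _ _ _ (fun s => (B 0%nat s * U 1%nat s)%C)); [exact Ht| |].
      - intros s Hs; rewrite Eb by lra; f_equal.
        apply (Derive_on_eq _ _ _ (U 0%nat)); auto.
      - apply Cderive_mult; [apply HB; lra|apply HU]. }
    set (V := fun n => conv_op (K n) (U 0%nat)).
    assert (HV : forall n t, -1 < t < 1 -> is_Cderive (V n) t (V (S n) t)).
    { intros n t Ht.
      exact (Cderive_conv_op (K n) (K (S n)) p t Ht (HK n) (fun z => derivs_cont K (S n) z HK)). }
    assert (EV : forall t, -1 < t < 1 -> conv_op k (U 0%nat) t = V 0%nat t).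
    { intros t Ht; apply (RInt_ext (V := C_R_CompleteNormedModule)).
      rewrite Rmin_left, Rmax_right by lra. intros s Hs. rewrite Ek by lra; reflexivity. }
    assert (ER : diff_op b c (conv_op k (U 0%nat)) x =
      (B 1%nat x * V 1%nat x + B 0%nat x * V 2%nat x + Cf 0%nat x * V 0%nat x)%C).
    { unfold diff_op; rewrite <- Ec by lra; rewrite EV by lra; f_equal.
      apply (Derive_on_eq _ _ _ (fun s => (B 0%nat s * V 1%nat s)%C)); [exact Hx| |].
      - intros s Hs; rewrite Eb by lra; f_equal.
        apply (Derive_on_eq _ _ _ (V 0%nat)); auto.
      - apply Cderive_mult; [apply HB; lra|apply HV; lra]. }
    pose proof (Hrel (U 0%nat) (smooth_on_peval _ _ p) x ltac:(lra)) as H.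
    rewrite ER in H.
    assert (HKc : forall n t, -1 <= t <= 1 -> Ccontinuous (fun s => K n (x - s)%R) t).
    { intros; apply Ccontinuous_reflect, derivs_cont; [assumption|lra]. }
    assert (HBc : forall n t, -1 <= t <= 1 -> Ccontinuous (B n) t).
    { intros; apply derivs_cont; [assumption|lra]. }
    assert (HCc : forall n t, -1 <= t <= 1 -> Ccontinuous (Cf n) t).
    { intros; apply derivs_cont; [assumption|lra]. }
    assert (HL : is_CRInt (fun t => (Cconj (K 0%nat (x - t)%R) * (B 1%nat t * U 1%nat t + B 0%nat t * U 2%nat t + Cf 0%nat t * U 0%nat t))%C)
       (conv_op (conj_kernel k) (diff_op b c (U 0%nat)) x)).
    { assert (E : conv_op (conj_kernel k) (diff_op b c (U 0%nat)) x =
        @RInt C_R_CompleteNormedModule (fun t => (Cconj (K 0%nat (x - t)%R) * (B 1%nat t * U 1%nat t + B 0%nat t * U 2%nat t + Cf 0%nat t * U 0%nat t))%C) (-1) 1).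
      { apply (RInt_ext (V := C_R_CompleteNormedModule)).
        rewrite Rmin_left, Rmax_right by lra. intros s Hs.
        unfold conj_kernel; rewrite EL by lra. rewrite Ek by lra; reflexivity. }
      rewrite E; apply CRInt_cont. intros t Ht; ccont; auto. }
    rewrite H in HL.
    (* The bilinear concomitant of Lagrange's identity: its derivative is the conjugate kernel times
       (b u')' minus u times the operator's principal part applied to the kernel. Both terms of [W]
       carry a factor b, hence vanish at -1 and 1. *)
    set (W := fun t => (Cconj (K 0%nat (x - t)%R) * (B 0%nat t * U 1%nat t)
                        + Cconj (K 1%nat (x - t)%R) * (B 0%nat t * U 0%nat t))%C).
    set (W' := fun t => (Cconj (K 0%nat (x - t)%R) * (B 1%nat t * U 1%nat t + B 0%nat t * U 2%nat t)
                        + (Cconj (K 1%nat (x - t)%R) * B 1%nat t + - (Cconj (K 2%nat (x - t)%R) * B 0%nat t)) * U 0%nat t)%C).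
    assert (HW : is_CRInt W' (Cminus (W 1) (W (-1)))).
    { apply CRInt_derive.
      - intros t Ht.
        assert (HBd : forall n, is_Cderive (B n) t (B (S n) t)) by (intros; apply HB; lra).
        assert (HKd : forall n, is_Cderive (fun s => Cconj (K n (x - s)%R)) t (Cconj (Copp (K (S n) (x - t)%R)))).
        { intros n; apply Cderive_conj, Cderive_reflect, HK; lra. }
        eapply Cderive_eq.
        + exact (Cderive_plus _ _ _ _ _ (Cderive_mult _ _ _ _ _ (HKd 0%nat) (Cderive_mult _ _ _ _ _ (HBd 0%nat) (HU 1%nat t)))
            (Cderive_mult _ _ _ _ _ (HKd 1%nat) (Cderive_mult _ _ _ _ _ (HBd 0%nat) (HU 0%nat t)))).
        + unfold W'; rewrite !Copp_conj; ring.
      - intros t Ht; unfold W'; ccont; auto. }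
    replace (Cminus (W 1) (W (-1))) with (RtoC 0) in HW
      by (unfold W; rewrite !Eb, b1, b2 by lra; ring).
    assert (HVI : forall n, is_CRInt (fun t => (K n (x - t)%R * U 0%nat t)%C) (V n x)).
    { intros n. exact (conv_op_is_CRInt (K n) (U 0%nat) x Hx (fun z => derivs_cont K n z HK) (fun y _ => HUc 0%nat y)). }
    (* The left side of the operator relation minus the integral of [W'] plus the right-hand
       operator moved over; the derivatives of the test function cancel and the total is 0. *)
    pose proof (CRInt_plus _ _ _ _ (CRInt_plus _ _ _ _ HL (CRInt_scal (Copp (RtoC 1)) _ _ HW))
      (CRInt_plus _ _ _ _ (CRInt_plus _ _ _ _ (CRInt_scal (B 1%nat x) _ _ (HVI 1%nat))
        (CRInt_scal (B 0%nat x) _ _ (HVI 2%nat))) (CRInt_scal (Cf 0%nat x) _ _ (HVI 0%nat)))) as HF.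
    match type of HF with is_CRInt _ ?l => replace l with (RtoC 0) in HF by ring end.
    eapply CRInt_ext; [|exact HF].
    intros t Ht; unfold G, W'. change (RtoC (peval p t)) with (U 0%nat t). ring. }
  assert (E : G y = RtoC 0).
  { clearbody G. apply injective_projections.
    - change (fst (G y)) with ((fun t => Re (G t)) y); change (fst (RtoC 0)) with 0.
      apply (orthogonal_to_polynomials (fun t => Re (G t)) y Hy); [intros t Ht; apply (HG t Ht)|].
      intros p; apply is_RInt_unique. eapply is_RInt_ext; [|exact (proj1 (Hint p))].
      intros t _; unfold Re; simpl; ring.
    - change (snd (G y)) with ((fun t => Im (G t)) y); change (snd (RtoC 0)) with 0.
      apply (orthogonal_to_polynomials (fun t => Im (G t)) y Hy); [intros t Ht; apply (HG t Ht)|].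
      intros p; apply is_RInt_unique. eapply is_RInt_ext; [|exact (proj2 (Hint p))].
      intros t _; unfold Im; simpl; ring. }
  rewrite <- !Ec by lra. rewrite <- E; unfold G; ring.
Qed.

(** * Uniqueness lemmas *)

Lemma Cmod_le_sum (w : C) : Cmod w <= Rabs (Re w) + Rabs (Im w).
Proof.
  replace w with (Cplus (RtoC (Re w)) (Cmult Ci (RtoC (Im w)))) at 1.
  - eapply Rle_trans; [apply Cmod_triangle|].
    rewrite Cmod_mult, Cmod_Ci, !Cmod_R; lra.
  - destruct w; apply injective_projections; unfold Re, Im; simpl; ring.
Qed.

Lemma im_le_Cmod (w : C) : Rabs (Im w) <= Cmod w.
Proof. eapply Rle_trans; [apply Rmax_r|apply (Rmax_Cmod w)]. Qed.

Lemma C_ext (u v : C) : Re u = Re v -> Im u = Im v -> u = v.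
Proof. intros; now apply injective_projections. Qed.

Lemma Ccontinuous_ball (f : R -> C) (x e : R) : Ccontinuous f x -> 0 < e ->
  exists d, 0 < d /\ forall t, Rabs (t - x) < d -> Cmod (Cminus (f t) (f x)) < e.
Proof.
  intros [H1 H2] He.
  assert (He2 : 0 < e / 2) by lra.
  destruct (H1 (fun v => Rabs (v - Re (f x)) < e / 2)) as [d1 Hd1].
  { exists (mkposreal _ He2); intros v Hv; exact Hv. }
  destruct (H2 (fun v => Rabs (v - Im (f x)) < e / 2)) as [d2 Hd2].
  { exists (mkposreal _ He2); intros v Hv; exact Hv. }
  exists (Rmin d1 d2); split; [apply Rmin_glb_lt; apply cond_pos|].
  intros t Ht.
  assert (Rabs (t - x) < d1) by (eapply Rlt_le_trans; [exact Ht|apply Rmin_l]).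
  assert (Rabs (t - x) < d2) by (eapply Rlt_le_trans; [exact Ht|apply Rmin_r]).
  eapply Rle_lt_trans; [apply Cmod_le_sum|].
  specialize (Hd1 t H); specialize (Hd2 t H0).
  unfold Re, Im in *; simpl. unfold Rminus in *. lra.
Qed.

Lemma Ccontinuous_adherent_zero (f : R -> C) (x : R) : Ccontinuous f x ->
  (forall e, 0 < e -> exists t, Rabs (t - x) < e /\ f t = RtoC 0) -> f x = RtoC 0.
Proof.
  intros Hf H. apply NNPP; intros Hx. apply Cmod_gt_0 in Hx.
  destruct (Ccontinuous_ball f x (Cmod (f x)) Hf Hx) as [d [Hd Hb]].
  destruct (H d Hd) as [t [Ht E]]. specialize (Hb t Ht).
  rewrite E in Hb.
  replace (Cminus (RtoC 0) (f x)) with (Copp (f x)) in Hb by ring.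
  rewrite Cmod_opp in Hb; lra.
Qed.

Lemma Ccontinuous_zero_endpoint (f : R -> C) (a b x : R) : a < b -> a <= x <= b -> Ccontinuous f x ->
  (forall t, a < t < b -> f t = RtoC 0) -> f x = RtoC 0.
Proof.
  intros Hab Hx Hf H. apply (Ccontinuous_adherent_zero f x Hf). intros e He.
  destruct (Rle_dec x ((a + b) / 2)) as [Hm|Hm].
  - exists (x + Rmin (e / 2) ((b - a) / 4)).
    assert (0 < Rmin (e / 2) ((b - a) / 4)) by (apply Rmin_glb_lt; lra).
    pose proof (Rmin_l (e / 2) ((b - a) / 4)); pose proof (Rmin_r (e / 2) ((b - a) / 4)).
    split; [apply Rabs_lt_between; lra|apply H; lra].
  - exists (x - Rmin (e / 2) ((b - a) / 4)).
    assert (0 < Rmin (e / 2) ((b - a) / 4)) by (apply Rmin_glb_lt; lra).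
    pose proof (Rmin_l (e / 2) ((b - a) / 4)); pose proof (Rmin_r (e / 2) ((b - a) / 4)).
    split; [apply Rabs_lt_between; lra|apply H; lra].
Qed.

Lemma Cderive_zero_const (f : R -> C) (a b : R) : (forall x, a < x < b -> is_Cderive f x (RtoC 0)) ->
  forall x y, a < x < b -> a < y < b -> f x = f y.
Proof.
  intros H.
  assert (Hlt : forall x y, a < x < b -> a < y < b -> x < y -> f x = f y).
  { intros x y Hx Hy Hxy. apply C_ext.
    - apply (eq_is_derive (V := R_NormedModule) (fun t => Re (f t)) x y); [|exact Hxy].
      intros t Ht; apply (H t); lra.
    - apply (eq_is_derive (V := R_NormedModule) (fun t => Im (f t)) x y); [|exact Hxy].
      intros t Ht; apply (H t); lra. }
  intros x y Hx Hy. destruct (Rtotal_order x y) as [L|[->|L]]; auto.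
  symmetry; auto.
Qed.

Lemma Cderive_locally_zero (f : R -> C) (a b x : R) (l : C) : a < x < b ->
  (forall t, a < t < b -> f t = RtoC 0) -> is_Cderive f x l -> l = RtoC 0.
Proof.
  intros Hx Hf H. apply (Cderive_unique f x l (RtoC 0) H).
  apply Cderive_ext_loc with (f := fun _ => RtoC 0); [|apply Cderive_const].
  generalize (locally_open_interval a b x Hx); apply filter_imp.
  intros t Ht; symmetry; auto.
Qed.

(** The function e^{-wx} f has derivative 0; [A] is its value at the midpoint. *)
Lemma exponential_solution (f : R -> C) (a b : R) (w : C) : a < b ->
  (forall x, a < x < b -> is_Cderive f x (Cmult w (f x))) ->
  exists A, forall x, a < x < b -> f x = Cmult A (Cexp (Cmult w (RtoC x))).
Proof.
  intros Hab H.
  exists (Cmult (Cexp (Cmult (Copp w) (RtoC ((a + b) / 2)))) (f ((a + b) / 2))).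
  intros x Hx.
  assert (E := Cderive_zero_const (fun t => Cmult (Cexp (Cmult (Copp w) (RtoC t))) (f t)) a b).
  simpl in E. rewrite <- (E) with (x := x); [|..|lra]; [| |exact Hx].
  - replace (Copp w * RtoC x)%C with (Copp (w * RtoC x))%C by ring.
    transitivity (Cmult (Cmult (Cexp (Copp (w * RtoC x))) (Cexp (w * RtoC x))) (f x)).
    + rewrite Cexp_opp_l; ring.
    + ring.
  - intros t Ht. eapply Cderive_eq; [exact (Cderive_mult _ _ _ _ _ (Cderive_Cexp (Copp w) t) (H t Ht))|cbv beta; ring].
Qed.

Lemma exponential_solution_zero (f : R -> C) (a b x0 : R) (w : C) : a < x0 < b ->
  (forall x, a < x < b -> is_Cderive f x (Cmult w (f x))) -> f x0 = RtoC 0 ->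
  forall x, a < x < b -> f x = RtoC 0.
Proof.
  intros Hx0 H E0 x Hx.
  destruct (exponential_solution f a b w) as [A HA]; [lra|exact H|].
  assert (A = RtoC 0).
  { apply NNPP; intros HA0. specialize (HA x0 Hx0). rewrite E0 in HA.
    apply (Cmult_neq_0 A (Cexp (w * RtoC x0)) HA0 (Cexp_neq_0 _)); congruence. }
  rewrite (HA x Hx), H0; ring.
Qed.

(** By the mean value theorem, sg g(s + u) - M u^{N+1} / (N + 1) is nonincreasing for both signs sg.
    No integral of [dg], and so no continuity of it, is involved. *)
Lemma derive_bound_pow (g dg : R -> R) (s T M : R) (N : nat) :
  (forall t, 0 <= t <= T -> is_derive g (s + t) (dg (s + t))) ->
  (forall t, 0 <= t <= T -> Rabs (dg (s + t)) <= M * t ^ N) ->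
  forall t, 0 <= t <= T -> Rabs (g (s + t) - g s) <= M * t ^ S N / INR (S N).
Proof.
  intros Hg HM.
  assert (HN : INR (S N) <> 0) by (apply not_0_INR; lia).
  assert (Hup : forall sg, Rabs sg = 1 -> forall t, 0 <= t <= T ->
    sg * (g (s + t) - g s) <= M * t ^ S N / INR (S N)).
  { intros sg Hsg t Ht.
    set (h := fun u => sg * g (s + u) - M * u ^ S N / INR (S N)).
    set (dh := fun u => sg * dg (s + u) - M * u ^ N).
    assert (Hh : forall u, 0 <= u <= T -> is_derive h u (dh u)).
    { intros u Hu. apply (is_derive_minus (V := R_NormedModule) (fun u => sg * g (s + u)) (fun u => M * u ^ S N / INR (S N))).
      - apply is_derive_scal.
        replace (dg (s + u)) with (scal 1 (dg (s + u))) by (unfold scal; simpl; unfold mult; simpl; ring).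
        apply (is_derive_comp (V := R_NormedModule) g (fun u => s + u)); [apply Hg, Hu|].
        auto_derive; auto; ring.
      - auto_derive; auto. simpl pred. change (match N with 0%nat => 1 | S _ => INR N + 1 end) with (INR (S N)).
        field. exact HN. }
    destruct (MVT_gen h 0 t dh) as [u [Hu E]].
    - rewrite Rmin_left, Rmax_right by lra. intros u Hu; apply Hh; lra.
    - rewrite Rmin_left, Rmax_right by lra. intros u Hu.
      apply continuity_pt_filterlim, (ex_derive_continuous (V := R_NormedModule)).
      eexists; apply Hh; lra.
    - rewrite Rmin_left, Rmax_right in Hu by lra.
      assert (dh u <= 0).
      { unfold dh. specialize (HM u ltac:(lra)).
        assert (sg * dg (s + u) <= Rabs (dg (s + u))); [|lra].
        eapply Rle_trans; [apply Rle_abs|]. rewrite Rabs_mult, Hsg; lra. }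
      assert (h t - h 0 <= 0) by (rewrite E; nra).
      unfold h in H0. rewrite Rplus_0_r in H0.
      replace (M * 0 ^ S N / INR (S N)) with 0 in H0 by (simpl; field; exact HN).
      lra. }
  intros t Ht. apply Rabs_le. split.
  - specialize (Hup (-1) ltac:(rewrite Rabs_left; lra) t Ht). lra.
  - specialize (Hup 1 ltac:(apply Rabs_R1) t Ht). lra.
Qed.

(** The factor 2 is the price of treating the real and imaginary parts separately. *)
Lemma Cderive_bound_pow (F dF : R -> C) (s T M : R) (N : nat) :
  (forall t, 0 <= t <= T -> is_Cderive F (s + t) (dF (s + t))) ->
  (forall t, 0 <= t <= T -> Cmod (dF (s + t)) <= M * t ^ N) ->
  forall t, 0 <= t <= T -> Cmod (Cminus (F (s + t)) (F s)) <= 2 * (M * t ^ S N / INR (S N)).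
Proof.
  intros HF HM t Ht.
  eapply Rle_trans; [apply Cmod_le_sum|].
  assert (H1 := derive_bound_pow (fun t => Re (F t)) (fun t => Re (dF t)) s T M N).
  assert (H2 := derive_bound_pow (fun t => Im (F t)) (fun t => Im (dF t)) s T M N).
  simpl in H1, H2.
  assert (A1 : Rabs (Re (F (s + t)) - Re (F s)) <= M * t ^ S N / INR (S N)).
  { apply H1; [| |exact Ht].
    - intros u Hu; apply (HF u Hu).
    - intros u Hu; eapply Rle_trans; [apply re_le_Cmod|apply HM, Hu]. }
  assert (A2 : Rabs (Im (F (s + t)) - Im (F s)) <= M * t ^ S N / INR (S N)).
  { apply H2; [| |exact Ht].
    - intros u Hu; apply (HF u Hu).
    - intros u Hu; eapply Rle_trans; [apply im_le_Cmod|apply HM, Hu]. }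
  unfold Re, Im, Rminus in *. simpl. simpl in A1, A2. lra.
Qed.

Lemma Cderive_lipschitz (g : R -> C) (x : R) (l : C) : is_Cderive g x l ->
  exists L d, 0 < L /\ 0 < d /\ forall t, 0 <= t < d -> Cmod (Cminus (g (x + t)) (g x)) <= L * t.
Proof.
  intros [[_ H1] [_ H2]].
  specialize (H1 x (fun P HP => HP) (mkposreal 1 Rlt_0_1)).
  specialize (H2 x (fun P HP => HP) (mkposreal 1 Rlt_0_1)).
  destruct (filter_and _ _ H1 H2) as [d Hd].
  exists (Rabs (Re l) + 1 + (Rabs (Im l) + 1)), d.
  pose proof (Rabs_pos (Re l)); pose proof (Rabs_pos (Im l)).
  split; [lra|]. split; [apply cond_pos|].
  intros t Ht. destruct (Hd (x + t)) as [A1 A2].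
  { change (Rabs (x + t - x) < d). replace (x + t - x) with t by ring. rewrite Rabs_pos_eq; lra. }
  unfold norm, minus, plus, opp, scal in A1, A2; simpl in A1, A2.
  unfold mult, abs in A1, A2; simpl in A1, A2.
  replace (x + t + - x) with t in A1 by ring. replace (x + t + - x) with t in A2 by ring.
  rewrite (Rabs_pos_eq t) in A1, A2 by lra.
  eapply Rle_trans; [apply Cmod_le_sum|].
  assert (B1 : Rabs (Re (g (x + t)) + - Re (g x)) <= (Rabs (Re l) + 1) * t).
  { replace (Re (g (x + t)) + - Re (g x)) with ((Re (g (x + t)) + - Re (g x) + - (t * Re l)) + t * Re l) by ring.
    eapply Rle_trans; [apply Rabs_triang|]. rewrite (Rabs_mult t), (Rabs_pos_eq t) by lra. lra. }
  assert (B2 : Rabs (Im (g (x + t)) + - Im (g x)) <= (Rabs (Im l) + 1) * t).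
  { replace (Im (g (x + t)) + - Im (g x)) with ((Im (g (x + t)) + - Im (g x) + - (t * Im l)) + t * Im l) by ring.
    eapply Rle_trans; [apply Rabs_triang|]. rewrite (Rabs_mult t), (Rabs_pos_eq t) by lra. lra. }
  unfold Re, Im in *; simpl; simpl in B1, B2; lra.
Qed.

(** Multiplying by l treats both signs of the derivative at once; half of l^2 is lost to the
    linearisation error, taken as |l| / 2. *)
Lemma derive_lower_bound (g : R -> R) (x l : R) : is_derive g x l -> l <> 0 ->
  exists d, 0 < d /\ forall t, 0 <= t < d -> l * l / 2 * t <= l * (g (x + t) - g x).
Proof.
  intros [_ H] Hl.
  assert (Hl0 : 0 < Rabs l / 2) by (apply Rabs_pos_lt in Hl; lra).
  specialize (H x (fun P HP => HP) (mkposreal _ Hl0)).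
  destruct H as [d Hd]. exists d; split; [apply cond_pos|].
  intros t Ht. specialize (Hd (x + t)).
  assert (A := Hd ltac:(change (Rabs (x + t - x) < d); replace (x + t - x) with t by ring; rewrite Rabs_pos_eq; lra)).
  unfold norm, minus, plus, opp, scal in A; simpl in A.
  unfold mult, abs in A; simpl in A.
  replace (x + t + - x) with t in A by ring.
  rewrite (Rabs_pos_eq t) in A by lra.
  set (r := g (x + t) + - g x + - (t * l)) in A.
  assert (E : g (x + t) - g x = r + t * l) by (unfold r; ring).
  rewrite E.
  assert (Hr : - (l * r) <= Rabs l * Rabs r).
  { rewrite <- Rabs_mult, <- Rabs_Ropp; apply Rle_abs. }
  assert (Hll : Rabs l * Rabs l = l * l) by (rewrite <- Rabs_mult; apply Rabs_pos_eq, Rle_0_sqr).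
  assert (Rabs l * Rabs r <= Rabs l * (Rabs l / 2 * t)) by (apply Rmult_le_compat_l; [apply Rabs_pos|exact A]).
  nra.
Qed.

(** The induction on N must cover all n together: order N + 1 for [F n] comes from order N for its
    derivative [F (S n)]. *)
Lemma flat_bound (F : nat -> R -> C) (s T : R) : 0 <= T ->
  (forall n t, 0 <= t <= T -> is_Cderive (F n) (s + t) (F (S n) (s + t))) ->
  (forall n, F n s = RtoC 0) ->
  forall N n, exists M, 0 <= M /\ forall t, 0 <= t <= T -> Cmod (F n (s + t)) <= M * t ^ N.
Proof.
  intros HT HF H0 N; induction N as [|N IH]; intros n.
  - assert (HC : forall t, s <= t <= s + T -> Ccontinuous (F n) t).
    { intros t Ht; replace t with (s + (t - s)) by ring; apply (Cderive_cont _ _ _ (HF n (t - s) ltac:(lra))). }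
    destruct (continuous_bounded (fun t => Re (F n t)) s (s + T)) as [M1 HM1]; [lra|intros t Ht; apply (HC t Ht)|].
    destruct (continuous_bounded (fun t => Im (F n t)) s (s + T)) as [M2 HM2]; [lra|intros t Ht; apply (HC t Ht)|].
    exists (M1 + M2); split.
    + pose proof (HM1 s ltac:(lra)); pose proof (HM2 s ltac:(lra)).
      pose proof (Rabs_pos (Re (F n s))); pose proof (Rabs_pos (Im (F n s))); lra.
    + intros t Ht; simpl; rewrite Rmult_1_r. eapply Rle_trans; [apply Cmod_le_sum|].
      pose proof (HM1 (s + t) ltac:(lra)); pose proof (HM2 (s + t) ltac:(lra)); lra.
  - destruct (IH (S n)) as [M [HM0 HM]].
    exists (2 * M); split; [lra|]. intros t Ht.
    pose proof (Cderive_bound_pow (F n) (F (S n)) s T M N (HF n) HM t Ht) as H.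
    rewrite H0 in H. replace (Cminus (F n (s + t)) (RtoC 0)) with (F n (s + t)) in H by ring.
    eapply Rle_trans; [exact H|].
    assert (HN : 1 <= INR (S N)) by (rewrite S_INR; pose proof (pos_INR N); lra).
    assert (0 <= M * t ^ S N) by (apply Rmult_le_pos; [lra|apply pow_le; lra]).
    assert (M * t ^ S N / INR (S N) <= M * t ^ S N).
    { apply Rle_div_l; [lra|]. nra. }
    lra.
Qed.

(* Uniqueness for the singular equation |t F'| <= L |F|: flatness beats every
   power of t, whatever the size of L. *)
Lemma flat_singular_zero (F : nat -> R -> C) (s T L : R) : 0 <= T -> 0 <= L ->
  (forall n t, 0 <= t <= T -> is_Cderive (F n) (s + t) (F (S n) (s + t))) ->
  (forall n, F n s = RtoC 0) ->
  (forall t, 0 <= t <= T -> t * Cmod (F 1%nat (s + t)) <= L * Cmod (F 0%nat (s + t))) ->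
  forall t, 0 <= t <= T -> F 0%nat (s + t) = RtoC 0.
Proof.
  intros HT HL HF H0 Hsing.
  (* If |F| <= A t^{N+1}, the equation gives |F'| <= L A t^N, and integrating returns the first
     bound with A replaced by 2 L A / (N + 1). Beyond 4 L this at least halves A, so iteration
     leaves only 0. *)
  destruct (INR_unbounded (4 * L)) as [N HN].
  destruct (flat_bound F s T HT HF H0 (S N) 0) as [M [HM0 HM]].
  assert (HN0 : 0 < INR (S N)) by (apply lt_0_INR; lia).
  assert (Hhalf : forall A, 0 <= A ->
    (forall t, 0 <= t <= T -> Cmod (F 0%nat (s + t)) <= A * t ^ S N) ->
    forall t, 0 <= t <= T -> Cmod (F 0%nat (s + t)) <= A / 2 * t ^ S N).
  { intros A HA HAt t Ht.
    assert (H1 : forall u, 0 <= u <= T -> Cmod (F 1%nat (s + u)) <= L * A * u ^ N).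
    { intros u Hu. destruct (Req_dec u 0) as [->|Hu0].
      - rewrite Rplus_0_r, H0, Cmod_0. apply Rmult_le_pos; [nra|apply pow_le; lra].
      - apply Rmult_le_reg_l with u; [lra|].
        eapply Rle_trans; [apply Hsing, Hu|].
        eapply Rle_trans; [apply Rmult_le_compat_l; [exact HL|apply HAt, Hu]|].
        simpl; right; ring. }
    pose proof (Cderive_bound_pow (F 0%nat) (F 1%nat) s T (L * A) N (HF 0%nat) H1 t Ht) as H.
    rewrite H0 in H. replace (Cminus (F 0%nat (s + t)) (RtoC 0)) with (F 0%nat (s + t)) in H by ring.
    eapply Rle_trans; [exact H|].
    assert (0 <= A * t ^ S N) by (apply Rmult_le_pos; [lra|apply pow_le; lra]).
    replace (2 * (L * A * t ^ S N / INR (S N))) with (2 * L * (A * t ^ S N) / INR (S N)) by (field; lra).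
    apply Rle_div_l; [lra|].
    assert (4 * L <= INR (S N)) by (rewrite S_INR; lra). nra. }
  assert (Hj : forall j t, 0 <= t <= T -> Cmod (F 0%nat (s + t)) <= M * (/ 2) ^ j * t ^ S N).
  { intros j; induction j as [|j IH].
    - intros t Ht; rewrite pow_O, Rmult_1_r; auto.
    - assert (Hp : 0 <= M * (/ 2) ^ j) by (apply Rmult_le_pos; [lra|apply pow_le; lra]).
      intros t Ht; pose proof (Hhalf _ Hp IH t Ht) as H.
      replace (M * (/ 2) ^ S j) with (M * (/ 2) ^ j / 2) by (simpl; field). exact H. }
  intros t Ht. apply Cmod_eq_0. apply Rle_antisym; [|apply Cmod_ge_0].
  apply Rnot_lt_le; intros Hpos.
  set (v := Cmod (F 0%nat (s + t))) in *.
  destruct (pow_unbounded 2 (M * t ^ S N / v)) as [j Hj']; [lra|].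
  specialize (Hj j t Ht). fold v in Hj.
  apply Rlt_div_l in Hj'; [|exact Hpos].
  rewrite pow_inv in Hj.
  assert (0 < 2 ^ j) by (apply pow_lt; lra).
  apply Rmult_le_compat_r with (r := 2 ^ j) in Hj; [|lra].
  replace (M * / 2 ^ j * t ^ S N * 2 ^ j) with (M * t ^ S N) in Hj by (field; lra). lra.
Qed.

(** * Vanishing of k' near 0 *)

Definition kterm (B K : nat -> R -> C) (c : R -> C) (x z : R) : C :=
  (B 0%nat x * K 2%nat z + B 1%nat x * K 1%nat z + c x * K 0%nat z)%C.

(** The symmetry of k turns the conjugates in the relation into values at y - x, so its two halves
    become the same expression with x and y exchanged. This form is preserved by the later gauge
    change. [c] stays a bare function because it is never differentiated. *)
Record sesqui (B K : nat -> R -> C) (c : R -> C) : Prop := {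
  sesqui_B : derivs B;
  sesqui_K : derivs K;
  sesqui_left : B 0%nat (-1) = RtoC 0;
  sesqui_right : B 0%nat 1 = RtoC 0;
  sesqui_nonzero : exists y, -1 < y < 1 /\ B 0%nat y <> RtoC 0;
  sesqui_sym : forall z, -2 < z < 2 -> K 0%nat (- z) = Cconj (K 0%nat z);
  sesqui_rel : forall x y, -1 < x < 1 -> -1 < y < 1 ->
    Cplus (kterm B K c x (x - y)) (kterm B K c y (y - x)) = RtoC 0 }.

(** Differentiating the symmetry flips the sign of w: even derivatives of k inherit the symmetry of
    k, odd ones the opposite. *)
Lemma derive_parity (F F' : R -> C) (w : C) :
  (forall z, -2 < z < 2 -> is_Cderive F z (F' z)) ->
  (forall z, -2 < z < 2 -> F (- z) = Cmult w (Cconj (F z))) ->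
  forall z, -2 < z < 2 -> F' (- z) = Cmult (Copp w) (Cconj (F' z)).
Proof.
  intros HF Hs z Hz.
  assert (H1 : is_Cderive (fun t => F (- t)) z (Copp (F' (- z)))) by (apply Cderive_neg, HF; lra).
  assert (H2 : is_Cderive (fun t => F (- t)) z (Cmult w (Cconj (F' z)))).
  { apply Cderive_ext_loc with (f := fun t => Cmult w (Cconj (F t))).
    - generalize (locally_open_interval (-2) 2 z Hz); apply filter_imp.
      intros t Ht; symmetry; auto.
    - apply Cderive_scal, Cderive_conj, HF, Hz. }
  pose proof (Cderive_unique _ _ _ _ H1 H2) as E.
  replace (F' (- z)) with (Copp (Copp (F' (- z)))) by ring. rewrite E; ring.
Qed.

Section Sesqui.
Context {B K : nat -> R -> C} {c : R -> C} (HS : sesqui B K c).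

Lemma sesqui_sym1 z : -2 < z < 2 -> K 1%nat (- z) = Copp (Cconj (K 1%nat z)).
Proof.
  intros Hz. rewrite (derive_parity (K 0%nat) (K 1%nat) (RtoC 1)); [ring|apply (sesqui_K _ _ _ HS 0%nat)| |exact Hz].
  intros t Ht; rewrite (sesqui_sym _ _ _ HS t Ht); ring.
Qed.

Lemma sesqui_sym2 z : -2 < z < 2 -> K 2%nat (- z) = Cconj (K 2%nat z).
Proof.
  intros Hz. rewrite (derive_parity (K 1%nat) (K 2%nat) (Copp (RtoC 1))); [ring|apply (sesqui_K _ _ _ HS 1%nat)| |exact Hz].
  intros t Ht; rewrite (sesqui_sym1 t Ht); ring.
Qed.

Lemma sesqui_diag x : -1 < x < 1 -> kterm B K c x 0 = RtoC 0.
Proof.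
  intros Hx. pose proof (sesqui_rel _ _ _ HS x x Hx Hx) as H.
  replace (x - x) with 0 in H by ring.
  assert (E : Cmult (RtoC 2) (kterm B K c x 0) = RtoC 0) by (rewrite <- H; ring).
  apply NNPP; intros Hn. apply (Cmult_neq_0 (RtoC 2) (kterm B K c x 0)); [|exact Hn|exact E].
  intros E2; injection E2; lra.
Qed.

Lemma sesqui_Bcont n y : -1 <= y <= 1 -> Ccontinuous (B n) y.
Proof. intros Hy; apply derivs_cont; [apply (sesqui_B _ _ _ HS)|lra]. Qed.

Lemma sesqui_Kcont n y : -2 < y < 2 -> Ccontinuous (K n) y.
Proof. intros Hy; apply derivs_cont; [apply (sesqui_K _ _ _ HS)|exact Hy]. Qed.

(** The determinant of the system for k'' is a difference of two values of this function; being
    real, it has a sign and obeys the mean value theorem. *)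
Definition bsq (y : R) : R := Re (B 0%nat y) * Re (B 0%nat y) + Im (B 0%nat y) * Im (B 0%nat y).
Definition dbsq (y : R) : R :=
  2 * (Re (B 0%nat y) * Re (B 1%nat y) + Im (B 0%nat y) * Im (B 1%nat y)).

Lemma is_derive_sq (f : R -> C) (x : R) (l : C) : is_Cderive f x l ->
  is_derive (fun y => Re (f y) * Re (f y) + Im (f y) * Im (f y)) x
    (2 * (Re (f x) * Re l + Im (f x) * Im l)).
Proof.
  intros [H1 H2].
  pose proof (is_derive_mult _ _ _ _ _ H1 H1 Rmult_comm) as P1.
  pose proof (is_derive_mult _ _ _ _ _ H2 H2 Rmult_comm) as P2.
  pose proof (is_derive_plus _ _ _ _ _ P1 P2) as P.
  eapply (eq_ind _ (is_derive _ x) P).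
  unfold plus, mult; simpl; ring.
Qed.

Lemma is_derive_bsq y : -1 <= y <= 1 -> is_derive bsq y (dbsq y).
Proof. intros Hy; apply is_derive_sq, (sesqui_B _ _ _ HS); lra. Qed.

Lemma bsq_zero y : bsq y = 0 -> B 0%nat y = RtoC 0.
Proof.
  unfold bsq; intros H; apply C_ext; change (Re (RtoC 0)) with 0; change (Im (RtoC 0)) with 0; nra.
Qed.

(** |b|^2 is constant on the interval, and b(1) = 0 decides which constant. *)
Lemma bsq_const_zero a : -1 <= a < 1 ->
  (forall y, a < y < 1 -> dbsq y = 0) -> forall y, a < y <= 1 -> bsq y = 0.
Proof.
  intros Ha H y Hy.
  assert (E1 : bsq 1 = 0) by (unfold bsq; rewrite (sesqui_right _ _ _ HS); unfold Re, Im; simpl; ring).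
  destruct (Req_dec y 1) as [->|Hy1]; [exact E1|].
  destruct (MVT_gen bsq y 1 dbsq) as [u [Hu E]].
  - rewrite Rmin_left, Rmax_right by lra. intros; apply is_derive_bsq; lra.
  - rewrite Rmin_left, Rmax_right by lra. intros t Ht.
    apply continuity_pt_filterlim, (ex_derive_continuous (V := R_NormedModule)).
    eexists; apply is_derive_bsq; lra.
  - rewrite Rmin_left, Rmax_right in Hu by lra.
    (* [MVT_gen] places [u] in the closed interval; at u = 1 the derivative vanishes because b(1) =
       0. *)
    assert (Ez : dbsq u = 0).
    { destruct (Req_dec u 1) as [->|Hu1]; [|apply H; lra].
      unfold dbsq; rewrite (sesqui_right _ _ _ HS); unfold Re, Im; simpl; ring. }
    rewrite Ez, E1 in E; lra.
Qed.

(* The relation and its conjugate form a 2x2 linear system for k'' and its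
   conjugate, with determinant |b(x)|^2 - |b(y)|^2; this is Cramer's rule. *)
Lemma sesqui_cramer y t : -1 < y -> 0 <= t -> y + t < 1 ->
  let x := y + t in
  let r := Copp (c x * K 0%nat t + c y * Cconj (K 0%nat t))%C in
  (RtoC (bsq x - bsq y) * K 2%nat t)%C =
  (Cconj (K 1%nat t) * (Cconj (B 0%nat x) * B 1%nat y + B 0%nat y * Cconj (B 1%nat x))
   - K 1%nat t * (Cconj (B 0%nat x) * B 1%nat x + B 0%nat y * Cconj (B 1%nat y))
   + (Cconj (B 0%nat x) * r - B 0%nat y * Cconj r))%C.
Proof.
  intros Hy Ht Hyt x r.
  pose proof (sesqui_rel _ _ _ HS x y ltac:(unfold x; lra) ltac:(lra)) as H.
  replace (x - y) with t in H by (unfold x; ring).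
  replace (y - x) with (- t) in H by (unfold x; ring).
  unfold kterm in H.
  rewrite (sesqui_sym _ _ _ HS t), (sesqui_sym1 t), (sesqui_sym2 t) in H by lra.
  pose proof (f_equal Cconj H) as H'.
  rewrite !Cplus_conj, !Cmult_conj, Copp_conj, !Cconj_conj in H'.
  replace (Cconj (RtoC 0)) with (RtoC 0) in H' by (apply C_ext; unfold Re, Im; simpl; ring).
  assert (E : RtoC (bsq x - bsq y) = (B 0%nat x * Cconj (B 0%nat x) - B 0%nat y * Cconj (B 0%nat y))%C).
  { apply C_ext; unfold bsq, Re, Im; simpl; ring. }
  rewrite E. unfold r. rewrite Copp_conj, Cplus_conj, !Cmult_conj, Cconj_conj.
  match type of H with ?l = _ => set (h := l) in * end.
  match type of H' with ?l = _ => set (h' := l) in * end.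
  transitivity (Cconj (B 0%nat x) * h - B 0%nat y * h' +
   (Cconj (K 1%nat t) * (Cconj (B 0%nat x) * B 1%nat y + B 0%nat y * Cconj (B 1%nat x))
   - K 1%nat t * (Cconj (B 0%nat x) * B 1%nat x + B 0%nat y * Cconj (B 1%nat y))
   + (Cconj (B 0%nat x) * - (c x * K 0%nat t + c y * Cconj (K 0%nat t))
     - B 0%nat y * - (Cconj (c x) * Cconj (K 0%nat t) + Cconj (c y) * K 0%nat t))))%C.
  - unfold h, h'; ring.
  - rewrite H, H'; ring.
Qed.

Lemma Cmod_sq (w : C) : Cmod w * Cmod w = Re w * Re w + Im w * Im w.
Proof. generalize (Cmod2_alt w); simpl; lra. Qed.

Lemma dbsq_neq_0 : exists y, -1 < y < 1 /\ dbsq y <> 0.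
Proof.
  apply NNPP; intros H. destruct (sesqui_nonzero _ _ _ HS) as [y [Hy Hn]].
  apply Hn, bsq_zero, (bsq_const_zero (-1)); [lra| |lra].
  intros t Ht; apply NNPP; intros Hd; apply H; exists t; auto.
Qed.

Lemma gram_diag y : (Cconj (B 0%nat y) * B 1%nat y + B 0%nat y * Cconj (B 1%nat y))%C = RtoC (dbsq y).
Proof. apply C_ext; unfold dbsq, Re, Im; simpl; ring. Qed.

(** Covers the two situations in which the start at 0 is analysed: c = 0, and k(0) = 0 with c
    bounded. Either way the zeroth-order term is controlled by t times the supremum of |k'|. *)
Definition potential_small : Prop := forall y, -1 < y < 1 -> exists C0 d, 0 <= C0 /\ 0 < d /\
  forall x z, Rabs (x - y) < d -> -1 < x < 1 -> -2 < z < 2 ->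
  Cmod (Cmult (c x) (K 0%nat z)) <= C0 * Cmod (Cminus (K 0%nat z) (K 0%nat 0)).

(* To leading order t k'' = -2i Im k', so |k'| cannot grow off its zero at 0. *)
Lemma start_estimate : potential_small ->
  exists Lam tau, 0 <= Lam /\ 0 < tau < 2 /\ forall M t, 0 < t < tau ->
    (forall u, 0 <= u <= t -> Cmod (K 1%nat u) <= M) ->
    2 * (Re (K 1%nat t) * Re (K 2%nat t) + Im (K 1%nat t) * Im (K 2%nat t)) <= Lam * (M * M).
Proof.
  intros Hc. destruct dbsq_neq_0 as [y [Hy Hp]]. set (p := dbsq y) in *.
  assert (HB : forall n, is_Cderive (B n) y (B (S n) y)) by (intros n; apply (sesqui_B _ _ _ HS); lra).
  (* The two coefficient functions of Cramer's formula, as functions of x for fixed y. At x = y both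
     equal p, so they differ from p by O(t); this is where -2i p Im k' emerges as the leading
     term. *)
  destruct (Cderive_lipschitz _ _ _ (Cderive_plus _ _ _ _ _
     (Cderive_mult _ _ _ _ _ (Cderive_conj _ _ _ (HB 0%nat)) (Cderive_const (B 1%nat y) y))
     (Cderive_scal (B 0%nat y) _ _ _ (Cderive_conj _ _ _ (HB 1%nat))))) as [L1 [d1 [HL1 [Hd1 H1]]]].
  destruct (Cderive_lipschitz _ _ _ (Cderive_plus _ _ _ _ _
     (Cderive_mult _ _ _ _ _ (Cderive_conj _ _ _ (HB 0%nat)) (HB 1%nat))
     (Cderive_const (Cmult (B 0%nat y) (Cconj (B 1%nat y))) y))) as [L2 [d2 [HL2 [Hd2 H2]]]].
  destruct (derive_lower_bound bsq y p (is_derive_bsq y ltac:(lra)) Hp) as [d3 [Hd3 H3]].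
  destruct (Ccontinuous_ball (B 0%nat) y 1 (sesqui_Bcont 0%nat y ltac:(lra)) Rlt_0_1) as [d4 [Hd4 H4]].
  destruct (Hc y Hy) as [C0 [d5 [HC0 [Hd5 H5]]]].
  cbv beta in H1, H2. rewrite gram_diag in H1, H2. fold p in H1, H2.
  set (b0 := Cmod (B 0%nat y) + 1).
  assert (Hb0 : 0 <= Cmod (B 0%nat y)) by apply Cmod_ge_0.
  (* 8 = 2 * 4: [r] is at most 4 C0 M t and enters twice, each time with a factor of modulus at most
     [b0]. *)
  set (L := L1 + L2 + 8 * b0 * C0).
  assert (HL : 0 <= L) by (unfold L, b0; nra).
  assert (Hpp : 0 < Rabs p) by now apply Rabs_pos_lt.
  exists (4 * L / Rabs p), (Rmin (Rmin d1 (Rmin d2 d3)) (Rmin (Rmin d4 d5) ((1 - y) / 2))).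
  split; [apply Rmult_le_pos; [lra|left; apply Rinv_0_lt_compat, Hpp]|].
  set (tau := Rmin _ _).
  assert (T1 : tau <= d1) by (unfold tau; eapply Rle_trans; [apply Rmin_l|apply Rmin_l]).
  assert (T2 : tau <= d2) by (unfold tau; eapply Rle_trans; [apply Rmin_l|]; eapply Rle_trans; [apply Rmin_r|apply Rmin_l]).
  assert (T3 : tau <= d3) by (unfold tau; eapply Rle_trans; [apply Rmin_l|]; eapply Rle_trans; [apply Rmin_r|apply Rmin_r]).
  assert (T4 : tau <= d4) by (unfold tau; eapply Rle_trans; [apply Rmin_r|]; eapply Rle_trans; [apply Rmin_l|apply Rmin_l]).
  assert (T5 : tau <= d5) by (unfold tau; eapply Rle_trans; [apply Rmin_r|]; eapply Rle_trans; [apply Rmin_l|apply Rmin_r]).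
  assert (T6 : tau <= (1 - y) / 2) by (unfold tau; eapply Rle_trans; [apply Rmin_r|apply Rmin_r]).
  split.
  { split; [unfold tau; repeat apply Rmin_glb_lt; lra|lra]. }
  clearbody tau. intros M t Ht HM.
  set (f := K 1%nat t). set (g := K 2%nat t).
  assert (HM0 : 0 <= M) by (eapply Rle_trans; [apply Cmod_ge_0|apply (HM t); lra]).
  assert (Hf : Cmod f <= M) by (apply HM; lra).
  assert (HK : Cmod (Cminus (K 0%nat t) (K 0%nat 0)) <= 2 * M * t).
  { pose proof (Cderive_bound_pow (K 0%nat) (K 1%nat) 0 t M 0) as H.
    rewrite <- (Rplus_0_l t) at 1.
    eapply Rle_trans; [apply H|].
    - intros u Hu; apply (sesqui_K _ _ _ HS 0%nat); lra.
    - intros u Hu; rewrite Rplus_0_l, pow_O, Rmult_1_r; auto.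
    - lra.
    - simpl; lra. }
  assert (Hxy : Rabs (y + t - y) < d5) by (replace (y + t - y) with t by ring; rewrite Rabs_pos_eq; lra).
  assert (Hyy : Rabs (y - y) < d5) by (replace (y - y) with 0 by ring; rewrite Rabs_R0; lra).
  pose proof (H5 (y + t) t Hxy ltac:(lra) ltac:(lra)) as Hcx.
  pose proof (H5 y t Hyy ltac:(lra) ltac:(lra)) as Hcy.
  specialize (H4 (y + t)). replace (y + t - y) with t in H4 by ring. rewrite Rabs_pos_eq in H4 by lra.
  specialize (H4 ltac:(lra)).
  assert (Hbx : Cmod (B 0%nat (y + t)) <= b0).
  { replace (B 0%nat (y + t)) with ((B 0%nat (y + t) - B 0%nat y) + B 0%nat y)%C by ring.
    eapply Rle_trans; [apply Cmod_triangle|]. unfold b0; lra. }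
  specialize (H1 t ltac:(lra)). specialize (H2 t ltac:(lra)). specialize (H3 t ltac:(lra)).
  pose proof (sesqui_cramer y t ltac:(lra) ltac:(lra) ltac:(lra)) as E.
  cbv zeta in E.
  set (r := Copp (c (y + t) * K 0%nat t + c y * Cconj (K 0%nat t))%C) in E.
  assert (Hr : Cmod r <= 4 * C0 * M * t).
  { unfold r; rewrite Cmod_opp. eapply Rle_trans; [apply Cmod_triangle|].
    rewrite (Cmod_mult (c y)), Cmod_conj, <- Cmod_mult.
    assert (C0 * Cmod (K 0%nat t - K 0%nat 0) <= C0 * (2 * M * t)) by (apply Rmult_le_compat_l; assumption).
    lra. }
  fold f g in E.
  set (al := (Cconj (B 0%nat (y + t)) * B 1%nat y + B 0%nat y * Cconj (B 1%nat (y + t)))%C) in *.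
  set (be := (Cconj (B 0%nat (y + t)) * B 1%nat (y + t) + B 0%nat y * Cconj (B 1%nat y))%C) in *.
  set (e := (Cconj f * (al - RtoC p) - f * (be - RtoC p) + (Cconj (B 0%nat (y + t)) * r - B 0%nat y * Cconj r))%C).
  assert (E' : (RtoC (bsq (y + t) - bsq y) * g = RtoC p * (Cconj f - f) + e)%C) by (rewrite E; unfold e; ring).
  assert (He : Cmod e <= L * t * M).
  { unfold e. eapply Rle_trans; [apply Cmod_triangle|].
    assert (A1 : Cmod (Cconj f * (al - RtoC p)) <= M * (L1 * t)).
    { rewrite Cmod_mult, Cmod_conj. apply Rmult_le_compat; auto using Cmod_ge_0. }
    assert (A2 : Cmod (- (f * (be - RtoC p))) <= M * (L2 * t)).
    { rewrite Cmod_opp, Cmod_mult. apply Rmult_le_compat; auto using Cmod_ge_0. }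
    assert (A3 : Cmod (Cconj (B 0%nat (y + t)) * r) <= b0 * (4 * C0 * M * t)).
    { rewrite Cmod_mult, Cmod_conj. apply Rmult_le_compat; auto using Cmod_ge_0. }
    assert (A4 : Cmod (- (B 0%nat y * Cconj r)) <= b0 * (4 * C0 * M * t)).
    { rewrite Cmod_opp, Cmod_mult, Cmod_conj. apply Rmult_le_compat; auto using Cmod_ge_0. unfold b0; lra. }
    pose proof (Cmod_triangle (Cconj f * (al - RtoC p)) (- (f * (be - RtoC p)))) as A5.
    pose proof (Cmod_triangle (Cconj (B 0%nat (y + t)) * r) (- (B 0%nat y * Cconj r))) as A6.
    unfold Cminus at 1 3. unfold L. eapply Rle_trans; [apply Rplus_le_compat; [exact A5|exact A6]|].
    lra. }
  set (D := bsq (y + t) - bsq y) in *.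
  set (phi := Re f * Re g + Im f * Im g).
  (* Real part of the conjugate of f times the equation. Since p D >= p^2 t / 2, the leading term -2
     p (Im f)^2 only lowers |f|^2; the error is O(t M^2), and division by t leaves a bound free of
     t. *)
  assert (Ephi : D * phi = - 2 * p * (Im f * Im f) + Re (Cconj f * e)%C).
  { transitivity (Re (Cconj f * (RtoC D * g))%C); [unfold phi, Re, Im; simpl; ring|].
    rewrite E'; unfold Re, Im; simpl; ring. }
  assert (Hfe : Rabs (Re (Cconj f * e)%C) <= M * (L * t * M)).
  { eapply Rle_trans; [apply re_le_Cmod|]. rewrite Cmod_mult, Cmod_conj.
    apply Rmult_le_compat; auto using Cmod_ge_0. }
  assert (Hpe : p * Re (Cconj f * e)%C <= Rabs p * (M * (L * t * M))).
  { eapply Rle_trans; [apply Rle_abs|]. rewrite Rabs_mult.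
    apply Rmult_le_compat_l; [apply Rabs_pos|exact Hfe]. }
  assert (Hpp2 : Rabs p * Rabs p = p * p) by (rewrite <- Rabs_mult; apply Rabs_pos_eq, Rle_0_sqr).
  assert (HMM : 0 <= 4 * L / Rabs p * (M * M)).
  { apply Rmult_le_pos; [|exact (Rle_0_sqr M)]. apply Rmult_le_pos; [lra|left; now apply Rinv_0_lt_compat]. }
  destruct (Rle_dec phi 0) as [Hneg|Hpos]; [lra|]. apply Rnot_le_lt in Hpos.
  assert (Hkey : Rabs p * t * (Rabs p * (2 * phi)) <= Rabs p * t * (4 * L * (M * M))).
  { assert (p * p / 2 * t * phi <= p * D * phi) by (apply Rmult_le_compat_r; lra).
    assert (p * D * phi = - 2 * (p * p) * (Im f * Im f) + p * Re (Cconj f * e)%C).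
    { rewrite Rmult_assoc, Ephi; ring. }
    assert (0 <= (p * p) * (Im f * Im f)) by (apply Rmult_le_pos; apply Rle_0_sqr).
    replace (Rabs p * t * (Rabs p * (2 * phi))) with (4 * (p * p / 2 * t * phi))
      by (rewrite <- Hpp2; field).
    replace (Rabs p * t * (4 * L * (M * M))) with (4 * (Rabs p * (M * (L * t * M)))) by ring.
    lra. }
  apply Rmult_le_reg_l in Hkey; [|apply Rmult_lt_0_compat; lra].
  apply (Rmult_le_reg_l (Rabs p)); [exact Hpp|].
  replace (Rabs p * (4 * L / Rabs p * (M * M))) with (4 * L * (M * M)) by (field; lra).
  exact Hkey.
Qed.

(** A Gronwall argument at the point m where |k'| is largest on [0, tau]: by the mean value theorem
    |k'(m)|^2 <= tau Lam |k'(m)|^2, and tau is chosen so that tau Lam <= 1/2. *)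
Lemma start_zero : potential_small -> K 1%nat 0 = RtoC 0 ->
  exists tau, 0 < tau < 2 /\ forall t, 0 <= t <= tau -> K 1%nat t = RtoC 0.
Proof.
  intros Hc HK0. destruct (start_estimate Hc) as [Lam [tau0 [HLam [Ht0 Hest]]]].
  set (tau := Rmin (tau0 / 2) (/ (2 * (Lam + 1)))).
  assert (Htau : 0 < tau) by (apply Rmin_glb_lt; [lra|apply Rinv_0_lt_compat; lra]).
  assert (Htau1 : tau <= tau0 / 2) by apply Rmin_l.
  assert (Htau2 : tau * (2 * (Lam + 1)) <= 1).
  { apply Rle_trans with (/ (2 * (Lam + 1)) * (2 * (Lam + 1))).
    - apply Rmult_le_compat_r; [lra|apply Rmin_r].
    - right; field; lra. }
  exists tau; split; [lra|].
  set (phi := fun t => Re (K 1%nat t) * Re (K 1%nat t) + Im (K 1%nat t) * Im (K 1%nat t)).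
  set (dphi := fun t => 2 * (Re (K 1%nat t) * Re (K 2%nat t) + Im (K 1%nat t) * Im (K 2%nat t))).
  assert (Hphi : forall t, -2 < t < 2 -> is_derive phi t (dphi t)).
  { intros t Ht; apply is_derive_sq, (sesqui_K _ _ _ HS 1%nat), Ht. }
  assert (Hcont : forall t, -2 < t < 2 -> continuity_pt phi t).
  { intros t Ht; apply continuity_pt_filterlim, (ex_derive_continuous (V := R_NormedModule)).
    eexists; apply Hphi, Ht. }
  destruct (continuity_ab_maj phi 0 tau) as [m [Hm Hm0]]; [lra|intros; apply Hcont; lra|].
  assert (Hle : forall t, 0 <= t <= tau -> Cmod (K 1%nat t) <= Cmod (K 1%nat m)).
  { intros t Ht. apply Rsqr_incr_0_var; [|apply Cmod_ge_0].
    unfold Rsqr; rewrite !Cmod_sq. exact (Hm t Ht). }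
  assert (Hphi0 : phi 0 = 0) by (unfold phi; rewrite HK0; unfold Re, Im; simpl; ring).
  assert (Hz : phi m <= 0).
  { destruct (MVT_gen phi 0 m dphi) as [u [Hu E]].
    - rewrite Rmin_left, Rmax_right by lra. intros; apply Hphi; lra.
    - rewrite Rmin_left, Rmax_right by lra. intros; apply Hcont; lra.
    - rewrite Rmin_left, Rmax_right in Hu by lra.
      assert (Hphim : 0 <= phi m) by (unfold phi; nra).
      assert (Hd : dphi u <= Lam * phi m).
      { destruct (Req_dec u 0) as [->|Hu0].
        - unfold dphi; rewrite HK0; unfold Re, Im; simpl. nra.
        - unfold phi at 1; rewrite <- Cmod_sq. apply (Hest (Cmod (K 1%nat m)) u); [lra|].
          intros v Hv; apply Hle; lra. }
      rewrite Hphi0 in E.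
      assert (phi m <= tau * (Lam * phi m)).
      { assert (dphi u * (m - 0) <= Lam * phi m * m) by (rewrite Rminus_0_r; apply Rmult_le_compat_r; lra).
        assert (Lam * phi m * m <= Lam * phi m * tau) by (apply Rmult_le_compat_l; [nra|lra]). lra. }
      nra. }
  intros t Ht. apply Cmod_eq_0. apply Rle_antisym; [|apply Cmod_ge_0].
  eapply Rle_trans; [apply Hle, Ht|].
  assert (Cmod (K 1%nat m) * Cmod (K 1%nat m) <= 0) by (rewrite Cmod_sq; exact Hz).
  pose proof (Cmod_ge_0 (K 1%nat m)). nra.
Qed.

End Sesqui.

(** * Propagation across the zone *)

Lemma Ccontinuous_bounded (f : R -> C) (a b : R) : a <= b ->
  (forall y, a <= y <= b -> Ccontinuous f y) ->
  exists M, 0 <= M /\ forall y, a <= y <= b -> Cmod (f y) <= M.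
Proof.
  intros Hab Hf.
  destruct (continuous_bounded (fun t => Re (f t)) a b Hab) as [M1 H1]; [intros y Hy; apply (Hf y Hy)|].
  destruct (continuous_bounded (fun t => Im (f t)) a b Hab) as [M2 H2]; [intros y Hy; apply (Hf y Hy)|].
  assert (H : forall y, a <= y <= b -> Cmod (f y) <= M1 + M2).
  { intros y Hy; eapply Rle_trans; [apply Cmod_le_sum|].
    specialize (H1 y Hy); specialize (H2 y Hy); lra. }
  exists (M1 + M2); split; [|exact H].
  eapply Rle_trans; [apply Cmod_ge_0|apply (H a); lra].
Qed.

Section Propagation.
Context {B K : nat -> R -> C} {c : R -> C} (HS : sesqui B K c).
Context (Hc : forall x, -1 < x < 1 -> c x = RtoC 0).

(** Either the determinant is nonzero at z = s and stays away from 0 nearby, or it has a simple zero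
    there. A bound linear in t covers both and is what the singular uniqueness lemma consumes. *)
Lemma det_lower_bound s y : 0 < s -> -1 < y < 1 - s ->
  bsq (B := B) (y + s) <> bsq (B := B) y \/ dbsq (B := B) (y + s) <> 0 ->
  exists kap d, 0 < kap /\ 0 < d /\ forall t, 0 <= t < d ->
    kap * t <= Rabs (bsq (B := B) (y + (s + t)) - bsq (B := B) y).
Proof.
  intros Hs Hy H.
  assert (HD : is_derive (bsq (B := B)) (y + s) (dbsq (B := B) (y + s))) by (apply (is_derive_bsq HS); lra).
  destruct (Req_dec (bsq (B := B) (y + s)) (bsq (B := B) y)) as [E|E].
  - destruct H as [H|H]; [contradiction|].
    destruct (derive_lower_bound _ _ _ HD H) as [d [Hd Hb]].
    set (l := dbsq (y + s)) in *.
    assert (Hl : 0 < Rabs l) by now apply Rabs_pos_lt.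
    exists (Rabs l / 2), d; split; [lra|split; [exact Hd|]].
    intros t Ht. specialize (Hb t Ht). rewrite E, Rplus_assoc in Hb.
    apply (Rmult_le_reg_l (Rabs l)); [exact Hl|]. rewrite <- Rabs_mult.
    eapply Rle_trans; [|apply Rle_abs]. eapply Rle_trans; [|exact Hb].
    assert (Rabs l * Rabs l = l * l) by (rewrite <- Rabs_mult; apply Rabs_pos_eq, Rle_0_sqr).
    right. rewrite <- H0. field.
  - set (dl := Rabs (bsq (B := B) (y + s) - bsq (B := B) y)).
    assert (Hdl : 0 < dl) by (apply Rabs_pos_lt; lra).
    assert (HC : continuous (bsq (B := B)) (y + s)).
    { apply (ex_derive_continuous (V := R_NormedModule)); eexists; exact HD. }
    destruct (HC (fun v => Rabs (v - bsq (B := B) (y + s)) < dl / 2)) as [d Hd].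
    { assert (H0 : 0 < dl / 2) by lra. exists (mkposreal _ H0); intros v Hv; exact Hv. }
    (* Keeping t < 1 makes the constant lower bound dl / 2 also linear. *)
    exists (dl / 2), (Rmin d 1); split; [lra|].
    split; [apply Rmin_glb_lt; [apply cond_pos|lra]|].
    intros t Ht. pose proof (Rmin_l d 1); pose proof (Rmin_r d 1).
    assert (A := Hd (y + (s + t)) ltac:(change (Rabs (y + (s + t) - (y + s)) < d);
      replace (y + (s + t) - (y + s)) with t by ring; rewrite Rabs_pos_eq; lra)).
    cbv beta in A.
    assert (dl <= Rabs (bsq (B := B) (y + (s + t)) - bsq (B := B) y)
                 + Rabs (bsq (B := B) (y + (s + t)) - bsq (B := B) (y + s))).
    { unfold dl.
      replace (bsq (y + s) - bsq y) with ((bsq (B := B) (y + (s + t)) - bsq (B := B) y)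
        + - (bsq (B := B) (y + (s + t)) - bsq (B := B) (y + s))) by ring.
      eapply Rle_trans; [apply Rabs_triang|]. rewrite Rabs_Ropp; lra. }
    nra.
Qed.

(** Without such a row, |b|^2 has zero derivative on (s - 1, 1), hence vanishes there because b(1) =
    0; the equality of |b|^2 at u and u + s carries this to (-1, 1 - s). Then b vanishes at x and y
    whenever x - y = s, against the definition of the zone. *)
Lemma exists_good_row s : 0 < s < 2 -> second_order_zone (B 0%nat) s ->
  exists y, -1 < y < 1 - s /\
    (bsq (B := B) (y + s) <> bsq (B := B) y \/ dbsq (B := B) (y + s) <> 0).
Proof.
  intros Hs [x [y [Hx [Hy [E Hn]]]]]. apply NNPP; intros H.
  assert (H' : forall u, -1 < u < 1 - s -> bsq (B := B) (u + s) = bsq (B := B) u /\ dbsq (B := B) (u + s) = 0).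
  { intros u Hu; split; apply NNPP; intros H0; apply H; exists u; auto. }
  assert (H1 : forall u, s - 1 < u <= 1 -> bsq (B := B) u = 0).
  { apply (bsq_const_zero HS (s - 1)); [lra|].
    intros u Hu. replace u with (u - s + s) by ring. apply H'; lra. }
  destruct Hn as [Hn|Hn]; apply Hn.
  - apply (Ccontinuous_zero_endpoint (B 0%nat) (s - 1) 1); [lra|lra|apply (sesqui_Bcont HS); lra|].
    intros t Ht; apply bsq_zero, H1; lra.
  - apply (Ccontinuous_zero_endpoint (B 0%nat) (-1) (1 - s)); [lra|lra|apply (sesqui_Bcont HS); lra|].
    intros t Ht; apply bsq_zero. rewrite <- (proj1 (H' t Ht)). apply H1; lra.
Qed.

(** Vanishing on [0, s] makes every derivative of k' zero at s. On a good row Cramer's formula with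
    c = 0 gives kap t |k''| <= 4 M0 M1 |k'| at s + t, each of its two coefficients being at most 2
    M0 M1, and flatness forces k' = 0 beyond s. *)
Lemma extend_zero s : 0 < s < 2 -> second_order_zone (B 0%nat) s ->
  (forall t, 0 <= t <= s -> K 1%nat t = RtoC 0) ->
  exists e, 0 < e /\ forall t, 0 <= t <= e -> K 1%nat (s + t) = RtoC 0.
Proof.
  intros Hs Hz HK.
  assert (Hflat : forall n, K (S n) s = RtoC 0).
  { assert (Hin : forall n t, 0 < t < s -> K (S n) t = RtoC 0).
    { intros n; induction n as [|n IH]; intros t Ht; [apply HK; lra|].
      apply (Cderive_locally_zero (K (S n)) 0 s t); [exact Ht|exact IH|].
      apply (sesqui_K _ _ _ HS); lra. }
    intros n; apply (Ccontinuous_zero_endpoint (K (S n)) 0 s); [lra|lra| |apply Hin].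
    apply (sesqui_Kcont HS); lra. }
  destruct (exists_good_row s Hs Hz) as [y [Hy Hrow]].
  destruct (det_lower_bound s y (proj1 Hs) Hy Hrow) as [kap [d [Hkap [Hd Hdet]]]].
  destruct (Ccontinuous_bounded (B 0%nat) (-1) 1 ltac:(lra) (fun t => sesqui_Bcont HS 0%nat t)) as [M0 [HM0 H0]].
  destruct (Ccontinuous_bounded (B 1%nat) (-1) 1 ltac:(lra) (fun t => sesqui_Bcont HS 1%nat t)) as [M1 [HM1 H1]].
  set (T := Rmin (d / 2) ((1 - s - y) / 2)).
  assert (HT : 0 < T) by (apply Rmin_glb_lt; lra).
  assert (HT1 : T <= d / 2) by apply Rmin_l.
  assert (HT2 : T <= (1 - s - y) / 2) by apply Rmin_r.
  exists T; split; [exact HT|].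
  apply (flat_singular_zero (fun n => K (S n)) s T (4 * (M0 * M1) / kap)).
  - lra.
  - apply Rmult_le_pos; [nra|left; now apply Rinv_0_lt_compat].
  - intros n t Ht; apply (sesqui_K _ _ _ HS); lra.
  - exact Hflat.
  - intros t Ht.
    pose proof (sesqui_cramer HS y (s + t) ltac:(lra) ltac:(lra) ltac:(lra)) as E. cbv zeta in E.
    rewrite !Hc in E by lra. set (x := y + (s + t)) in *.
    assert (E2 : (RtoC (bsq (B := B) x - bsq (B := B) y) * K 2%nat (s + t) =
      Cconj (K 1%nat (s + t)) * (Cconj (B 0%nat x) * B 1%nat y + B 0%nat y * Cconj (B 1%nat x))
      + - (K 1%nat (s + t) * (Cconj (B 0%nat x) * B 1%nat x + B 0%nat y * Cconj (B 1%nat y))))%C).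
    { rewrite E, Copp_conj, Cplus_conj, !Cmult_conj.
      replace (Cconj (RtoC 0)) with (RtoC 0) by (apply C_ext; unfold Re, Im; simpl; ring). ring. }
    apply (f_equal Cmod) in E2. rewrite Cmod_mult, Cmod_R in E2.
    assert (Hx : -1 <= x <= 1) by (unfold x; lra).
    assert (Hg : forall u v u' v', Cmod u <= M0 -> Cmod v <= M1 -> Cmod u' <= M0 -> Cmod v' <= M1 ->
      Cmod (Cconj u * v + u' * Cconj v')%C <= 2 * (M0 * M1)).
    { intros u v u' v' A1 A2 A3 A4. eapply Rle_trans; [apply Cmod_triangle|].
      rewrite !Cmod_mult, !Cmod_conj.
      assert (Cmod u * Cmod v <= M0 * M1) by (apply Rmult_le_compat; auto using Cmod_ge_0).
      assert (Cmod u' * Cmod v' <= M0 * M1) by (apply Rmult_le_compat; auto using Cmod_ge_0).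
      lra. }
    assert (Hb : Rabs (bsq (B := B) x - bsq (B := B) y) * Cmod (K 2%nat (s + t)) <= 4 * (M0 * M1) * Cmod (K 1%nat (s + t))).
    { rewrite E2. eapply Rle_trans; [apply Cmod_triangle|].
      rewrite Cmod_opp, !Cmod_mult, !Cmod_conj.
      pose proof (Hg (B 0%nat x) (B 1%nat y) (B 0%nat y) (B 1%nat x) (H0 x Hx) (H1 y ltac:(lra)) (H0 y ltac:(lra)) (H1 x Hx)) as G1.
      pose proof (Hg (B 0%nat x) (B 1%nat x) (B 0%nat y) (B 1%nat y) (H0 x Hx) (H1 x Hx) (H0 y ltac:(lra)) (H1 y ltac:(lra))) as G2.
      pose proof (Cmod_ge_0 (K 1%nat (s + t))) as G3.
      apply (Rmult_le_compat_l _ _ _ G3) in G1. apply (Rmult_le_compat_l _ _ _ G3) in G2. lra. }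
    specialize (Hdet t ltac:(lra)). fold x in Hdet.
    apply (Rmult_le_reg_l kap); [exact Hkap|].
    replace (kap * (4 * (M0 * M1) / kap * Cmod (K 1%nat (s + t)))) with (4 * (M0 * M1) * Cmod (K 1%nat (s + t))) by (field; lra).
    eapply Rle_trans; [|exact Hb]. rewrite <- Rmult_assoc.
    apply Rmult_le_compat_r; [apply Cmod_ge_0|exact Hdet].
Qed.

(** Keep the point where b is nonzero and move the other one towards it. *)
Lemma zone_shrink s z : 0 <= s <= z -> second_order_zone (B 0%nat) z -> second_order_zone (B 0%nat) s.
Proof.
  intros Hs [x [y [Hx [Hy [E [Hn|Hn]]]]]].
  - exists x, (x - s); repeat split; try lra. now left.
  - exists (y + s), y; repeat split; try lra. now right.
Qed.

(** |z| = 2 would put x and y at opposite endpoints, where b vanishes. *)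
Lemma zone_lt_2 z : second_order_zone (B 0%nat) z -> -2 < z < 2.
Proof.
  intros [x [y [Hx [Hy [E Hn]]]]].
  assert (Hne : forall u v, (B 0%nat u <> RtoC 0 \/ B 0%nat v <> RtoC 0) -> ~ (u = 1 /\ v = -1) /\ ~ (u = -1 /\ v = 1)).
  { intros u v [H|H]; split; intros [-> ->]; apply H; apply HS. }
  destruct (Hne x y Hn) as [N1 N2].
  split; apply Rnot_le_lt; intros L; [apply N2|apply N1]; lra.
Qed.

(** Continuity method: the supremum m of the admissible s is itself admissible, and if m < z then m
    is still in the zone and [extend_zero] goes past it. *)
Lemma derivative_zero_on_zone tau : 0 < tau < 2 ->
  (forall t, 0 <= t <= tau -> K 1%nat t = RtoC 0) ->
  forall z, 0 <= z -> second_order_zone (B 0%nat) z -> forall t, 0 <= t <= z -> K 1%nat t = RtoC 0.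
Proof.
  intros Htau HK z Hz Hzone.
  pose proof (zone_lt_2 z Hzone) as Hz2.
  destruct (Rle_dec z tau) as [Hle|Hgt]; [intros t Ht; apply HK; lra|].
  set (P := fun s => 0 <= s <= z /\ forall t, 0 <= t <= s -> K 1%nat t = RtoC 0).
  destruct (completeness P) as [m [Hub Hlub]].
  { exists z; intros s [Hs _]; lra. }
  { exists 0; split; [lra|]. intros t Ht; apply HK; lra. }
  assert (Hm1 : tau <= m) by (apply Hub; split; [lra|exact HK]).
  assert (Hm2 : m <= z) by (apply Hlub; intros s [Hs _]; lra).
  assert (Hlt : forall t, 0 <= t < m -> K 1%nat t = RtoC 0).
  { intros t Ht. apply NNPP; intros Hn.
    assert (m <= t); [|lra]. apply Hlub. intros s [Hs HsK].
    apply Rnot_lt_le; intros L. apply Hn, HsK; lra. }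
  assert (Hm : forall t, 0 <= t <= m -> K 1%nat t = RtoC 0).
  { intros t Ht. destruct (Req_dec t m) as [->|Hne]; [|apply Hlt; lra].
    apply (Ccontinuous_zero_endpoint (K 1%nat) 0 m); [lra|lra|apply (sesqui_Kcont HS); lra|].
    intros u Hu; apply Hlt; lra. }
  destruct (Req_dec m z) as [<-|Hne]; [exact Hm|exfalso].
  destruct (extend_zero m ltac:(lra) (zone_shrink m z ltac:(lra) Hzone) Hm) as [e [He Hext]].
  assert (Rmin (m + e) z <= m).
  { apply Hub. pose proof (Rmin_l (m + e) z); pose proof (Rmin_r (m + e) z).
    split; [split; [apply Rmin_glb; lra|lra]|].
    intros t Ht. destruct (Rle_dec t m) as [L|L]; [apply Hm; lra|].
    replace t with (m + (t - m)) by ring. apply Hext; lra. }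
  assert (m < Rmin (m + e) z) by (apply Rmin_glb_lt; lra). lra.
Qed.

Lemma sesqui_K00_real : Cconj (K 0%nat 0) = K 0%nat 0.
Proof.
  rewrite <- (sesqui_sym _ _ _ HS 0) by lra. now rewrite Ropp_0.
Qed.

Lemma const_on_interval (F F' : R -> C) z : 0 <= z < 2 ->
  (forall t, -2 < t < 2 -> is_Cderive F t (F' t)) -> (forall t, 0 <= t <= z -> F' t = RtoC 0) -> F z = F 0.
Proof.
  intros Hz HF H0.
  pose proof (Cderive_bound_pow F F' 0 z 0 0) as H. rewrite <- (Rplus_0_l z) at 1.
  assert (A : Cmod (Cminus (F (0 + z)) (F 0)) <= 2 * (0 * z ^ 1 / INR 1)).
  { apply H; [intros t Ht; apply HF; lra| |lra].
    intros t Ht; rewrite Rplus_0_l, H0, Cmod_0 by lra; lra. }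
  assert (E : Cminus (F (0 + z)) (F 0) = RtoC 0).
  { apply Cmod_eq_0, Rle_antisym; [|apply Cmod_ge_0]. simpl in A; lra. }
  replace (F (0 + z)) with (Cplus (Cminus (F (0 + z)) (F 0)) (F 0)) by ring.
  rewrite E; ring.
Qed.

Lemma zone_sym z : second_order_zone (B 0%nat) z -> second_order_zone (B 0%nat) (- z).
Proof.
  intros [x [y [Hx [Hy [E Hn]]]]]. exists y, x; repeat split; try lra. tauto.
Qed.

Lemma kernel_const_on_zone : K 1%nat 0 = RtoC 0 ->
  forall z, second_order_zone (B 0%nat) z -> K 0%nat z = K 0%nat 0.
Proof.
  intros HK0.
  destruct (start_zero HS) as [tau [Htau Ht]]; [|exact HK0|].
  { intros y Hy. exists 0, 1. split; [lra|split; [lra|]].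
    intros x z _ Hx _. rewrite Hc by exact Hx. rewrite Cmult_0_l, Cmod_0. lra. }
  assert (Hpos : forall z, 0 <= z -> second_order_zone (B 0%nat) z -> K 0%nat z = K 0%nat 0).
  { intros z Hz Hzone. pose proof (zone_lt_2 z Hzone).
    apply (const_on_interval (K 0%nat) (K 1%nat)); [lra|apply (sesqui_K _ _ _ HS)|].
    exact (derivative_zero_on_zone tau Htau Ht z Hz Hzone). }
  intros z Hzone. destruct (Rle_dec 0 z) as [L|L]; [auto|].
  pose proof (zone_lt_2 z Hzone).
  rewrite <- (Ropp_involutive z), (sesqui_sym _ _ _ HS) by lra.
  rewrite Hpos; [apply sesqui_K00_real|lra|now apply zone_sym].
Qed.

End Propagation.

(** * Gauge transformation and exponential sums *)

(* twist a D n j is e^{-az} times the n-th derivative of e^{az} D_j. *)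
Fixpoint twist (a : C) (D : nat -> R -> C) (n : nat) : nat -> R -> C :=
  match n with
  | O => D
  | S n => fun j z => Cplus (twist a D n (S j) z) (Cmult a (twist a D n j z))
  end.

Definition gauge (a : C) (D : nat -> R -> C) (n : nat) (z : R) : C :=
  Cmult (Cexp (Cmult a (RtoC z))) (twist a D n 0%nat z).

Lemma derivs_gauge (a : C) (D : nat -> R -> C) : derivs D -> derivs (gauge a D).
Proof.
  intros HD.
  assert (H : forall n j z, -2 < z < 2 -> is_Cderive (twist a D n j) z (twist a D n (S j) z)).
  { intros n; induction n as [|n IH]; intros j z Hz; [apply HD, Hz|].
    exact (Cderive_plus _ _ _ _ _ (IH (S j) z Hz) (Cderive_scal a _ _ _ (IH j z Hz))). }
  intros n z Hz. eapply Cderive_eq; [exact (Cderive_mult _ _ _ _ _ (Cderive_Cexp a z) (H n 0%nat z Hz))|].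
  unfold gauge; simpl; ring.
Qed.

(** The twisted terms at (x, x - y) and (y, y - x) acquire the same factor e^{a(x + y)}, so the
    relation survives. The extra terms in the new potential compensate what the twist adds to the
    coefficient of k, and an imaginary a preserves the symmetry of the kernel. *)
Lemma sesqui_gauge (B K : nat -> R -> C) (c : R -> C) (a : C) : Cconj a = Copp a ->
  sesqui B K c ->
  sesqui (gauge (2 * a)%C B) (gauge (- a)%C K)
    (fun x => Cexp (2 * a * RtoC x) * (c x + a * B 1%nat x + a * a * B 0%nat x))%C.
Proof.
  intros Ha HS; split.
  - apply derivs_gauge, HS.
  - apply derivs_gauge, HS.
  - unfold gauge; simpl; rewrite (sesqui_left _ _ _ HS); ring.
  - unfold gauge; simpl; rewrite (sesqui_right _ _ _ HS); ring.
  - destruct (sesqui_nonzero _ _ _ HS) as [y [Hy Hn]]; exists y; split; [exact Hy|].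
    apply Cmult_neq_0; [apply Cexp_neq_0|exact Hn].
  - intros z Hz; unfold gauge; simpl.
    rewrite (sesqui_sym _ _ _ HS z Hz), Cmult_conj; f_equal.
    assert (E : forall w, Cconj (Cexp w) = Cexp (Cconj w)).
    { intros [u v]; unfold Cexp, Cconj, Re, Im; simpl. rewrite cos_neg, sin_neg; f_equal; ring. }
    rewrite E, Cmult_conj, Copp_conj, Ha; f_equal.
    rewrite RtoC_opp. replace (Cconj (RtoC z)) with (RtoC z); [ring|].
    apply C_ext; unfold Re, Im; simpl; ring.
  - assert (E : forall x y, kterm (gauge (2 * a)%C B) (gauge (- a)%C K)
      (fun x => Cexp (2 * a * RtoC x) * (c x + a * B 1%nat x + a * a * B 0%nat x))%C x (x - y)
      = (Cexp (a * (RtoC x + RtoC y)) * kterm B K c x (x - y)%R)%C).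
    { intros x y; unfold kterm, gauge; cbn [twist].
      replace (Cexp (a * (RtoC x + RtoC y))) with (Cexp (2 * a * RtoC x) * Cexp (- a * RtoC (x - y)))%C
        by (rewrite <- Cexp_plus, RtoC_minus; f_equal; ring).
      ring. }
    intros x y Hx Hy. rewrite !E.
    replace (RtoC y + RtoC x)%C with (RtoC x + RtoC y)%C by ring.
    rewrite <- Cmult_plus_distr_l, (sesqui_rel _ _ _ HS x y Hx Hy); ring.
Qed.

(** * Finite sums of exponentials and two facts on complex numbers *)

Definition expcomb (f : R -> C) : Prop :=
  exists n a alpha, forall z, f z = exp_combination n a alpha z.

Lemma expcomb_ext (f g : R -> C) : (forall z, g z = f z) -> expcomb f -> expcomb g.
Proof. intros E [n [a [al H]]]; exists n, a, al; intros z; rewrite E; apply H. Qed.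

Lemma expcomb_exp (w : C) : expcomb (fun z => Cexp (Cmult w (RtoC z))).
Proof.
  exists 0%nat, (fun _ => RtoC 1), (fun _ => w); intros z.
  unfold exp_combination; rewrite sum_O; ring.
Qed.

(** Restores the carrier [C], hidden behind a Coquelicot structure after [sum_n_ext], so that [ring]
    recognises it. *)
Ltac Cring := match goal with |- ?l = ?r => change (@eq C l r) end; ring.

Lemma sum_n_C_scal (w : C) (u : nat -> C) (n : nat) :
  sum_n (fun j => Cmult w (u j)) n = Cmult w (sum_n u n).
Proof.
  induction n as [|n IH]; [now rewrite !sum_O|].
  rewrite !sum_Sn, IH. unfold plus; simpl. ring.
Qed.

Lemma expcomb_scal (w : C) (f : R -> C) : expcomb f -> expcomb (fun z => Cmult w (f z)).
Proof.
  intros [n [a [al H]]]; exists n, (fun j => Cmult w (a j)), al; intros z.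
  rewrite H; unfold exp_combination; rewrite <- sum_n_C_scal.
  apply sum_n_ext; intros j; Cring.
Qed.

Lemma expcomb_mult_exp (w : C) (f : R -> C) : expcomb f ->
  expcomb (fun z => Cmult (Cexp (Cmult w (RtoC z))) (f z)).
Proof.
  intros [n [a [al H]]]; exists n, a, (fun j => Cplus w (al j)); intros z.
  rewrite H; unfold exp_combination; rewrite <- sum_n_C_scal.
  apply sum_n_ext; intros j.
  replace ((w + al j) * RtoC z)%C with (w * RtoC z + al j * RtoC z)%C by ring.
  rewrite Cexp_plus; Cring.
Qed.

Lemma expcomb_plus (f g : R -> C) : expcomb f -> expcomb g -> expcomb (fun z => Cplus (f z) (g z)).
Proof.
  intros [n [a [al Hf]]] [m [b [be Hg]]].
  (* Concatenation: indices 0..n carry f and n + 1..n + 1 + m carry g, so the last index is n + S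
     m. *)
  exists (n + S m)%nat, (fun j => if Nat.leb j n then a j else b (j - S n)%nat),
    (fun j => if Nat.leb j n then al j else be (j - S n)%nat).
  intros z; rewrite Hf, Hg; unfold exp_combination.
  set (h := fun j => ((if Nat.leb j n then a j else b (j - S n)%nat)
    * Cexp ((if Nat.leb j n then al j else be (j - S n)%nat) * RtoC z))%C).
  assert (E : forall p, sum_n h (n + S p) = Cplus (sum_n (fun j => (a j * Cexp (al j * RtoC z))%C) n)
    (sum_n (fun j => (b j * Cexp (be j * RtoC z))%C) p)).
  { assert (E0 : sum_n h n = sum_n (fun j => (a j * Cexp (al j * RtoC z))%C) n).
    { apply sum_n_ext_loc; intros j Hj; unfold h. now rewrite (proj2 (Nat.leb_le j n) Hj). }
    assert (Eh : forall p, h (S (n + p)) = (b p * Cexp (be p * RtoC z))%C).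
    { intros p; unfold h. rewrite (proj2 (Nat.leb_gt (S (n + p)) n)) by lia.
      replace (S (n + p) - S n)%nat with p by lia. reflexivity. }
    intros p; induction p as [|p IH].
    - rewrite Nat.add_1_r, sum_Sn, E0, sum_O. rewrite <- (Nat.add_0_r n) at 2. rewrite Eh. reflexivity.
    - rewrite Nat.add_succ_r, sum_Sn, IH, sum_Sn. rewrite Eh. unfold plus; simpl; ring. }
  symmetry; apply E.
Qed.

Lemma expcomb_zero : expcomb (fun _ => RtoC 0).
Proof.
  apply expcomb_ext with (f := fun z => Cmult (RtoC 0) (Cexp (Cmult (RtoC 0) (RtoC z)))).
  - intros z; ring.
  - apply expcomb_scal, expcomb_exp.
Qed.

(* A finite geometric sum in X = e^{wz}, shifted by X^j when j < 0. *)
Lemma expcomb_geometric (w : C) (j : Z) : exists g, expcomb g /\ forall z,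
  (RtoC 1 - Cexp (w * RtoC (IZR j) * RtoC z) = (Cexp (w * RtoC z) - RtoC 1) * g z)%C.
Proof.
  assert (Hnat : forall n : nat, exists g, expcomb g /\ forall z,
    (RtoC 1 - Cexp (w * RtoC (INR n) * RtoC z) = (Cexp (w * RtoC z) - RtoC 1) * g z)%C).
  { induction n as [|n [g [Hg E]]].
    - exists (fun _ => RtoC 0); split; [apply expcomb_zero|]. intros z; simpl INR.
      replace (w * RtoC 0 * RtoC z)%C with (RtoC 0) by ring. rewrite Cexp_0; ring.
    - exists (fun z => (g z + - RtoC 1 * Cexp (w * RtoC (INR n) * RtoC z))%C); split.
      + apply expcomb_plus; [exact Hg|].
        apply (expcomb_scal (- RtoC 1)%C (fun z => Cexp (w * RtoC (INR n) * RtoC z))), expcomb_exp.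
      + intros z. rewrite S_INR, RtoC_plus.
        replace (w * (RtoC (INR n) + RtoC 1) * RtoC z)%C with (w * RtoC (INR n) * RtoC z + w * RtoC z)%C by ring.
        rewrite Cexp_plus. rewrite Cmult_plus_distr_l, <- E. ring. }
  destruct (Z_le_gt_dec 0 j) as [Hj|Hj].
  - destruct (Hnat (Z.to_nat j)) as [g [Hg E]]. exists g; split; [exact Hg|].
    intros z; rewrite <- E, INR_IZR_INZ, Z2Nat.id by exact Hj. reflexivity.
  - destruct (Hnat (Z.to_nat (- j))) as [g [Hg E]].
    exists (fun z => (- RtoC 1 * (Cexp (w * RtoC (IZR j) * RtoC z) * g z))%C); split.
    + apply (expcomb_scal (- RtoC 1)%C (fun z => Cexp (w * RtoC (IZR j) * RtoC z) * g z)%C).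
      apply expcomb_mult_exp, Hg.
    + intros z. specialize (E z). rewrite INR_IZR_INZ, Z2Nat.id, opp_IZR, RtoC_opp in E by lia.
      replace (w * - RtoC (IZR j) * RtoC z)%C with (- (w * RtoC (IZR j) * RtoC z))%C in E by ring.
      set (u := (w * RtoC (IZR j) * RtoC z)%C) in *.
      transitivity (- Cexp u * ((Cexp (w * RtoC z) - RtoC 1) * g z))%C; [|ring].
      rewrite <- E. transitivity (Cexp (- u) * Cexp u - Cexp u)%C; [rewrite Cexp_opp_l; ring|ring].
Qed.

Lemma Csqrt_exists (w : C) : exists r, (r * r = w)%C.
Proof.
  destruct w as [x y]. set (m := Cmod (x, y)).
  assert (Hm : m * m = x * x + y * y) by (unfold m; generalize (Cmod_sq (x, y)); unfold Re, Im; simpl; lra).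
  assert (Hm0 : 0 <= m) by apply Cmod_ge_0.
  assert (Hx : Rabs x <= m) by apply (re_le_Cmod (x, y)).
  apply Rabs_le_between in Hx.
  assert (S1 : sqrt ((m + x) / 2) * sqrt ((m + x) / 2) = (m + x) / 2) by (apply sqrt_sqrt; lra).
  assert (S2 : sqrt ((m - x) / 2) * sqrt ((m - x) / 2) = (m - x) / 2) by (apply sqrt_sqrt; lra).
  assert (S3 : sqrt ((m + x) / 2) * sqrt ((m - x) / 2) = Rabs y / 2).
  { rewrite <- sqrt_mult by lra.
    replace ((m + x) / 2 * ((m - x) / 2)) with ((Rabs y / 2) * (Rabs y / 2)).
    - apply sqrt_square. pose proof (Rabs_pos y); lra.
    - assert (Rabs y * Rabs y = y * y) by (rewrite <- Rabs_mult; apply Rabs_pos_eq, Rle_0_sqr).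
      replace (Rabs y / 2 * (Rabs y / 2)) with (Rabs y * Rabs y / 4) by field. rewrite H.
      replace ((m + x) / 2 * ((m - x) / 2)) with ((m * m - x * x) / 4) by field. rewrite Hm; field. }
  destruct (Rle_dec 0 y) as [Hy|Hy].
  - rewrite Rabs_pos_eq in S3 by lra.
    exists (sqrt ((m + x) / 2), sqrt ((m - x) / 2)). apply C_ext; unfold Re, Im; simpl; lra.
  - rewrite Rabs_left in S3 by lra.
    exists (sqrt ((m + x) / 2), - sqrt ((m - x) / 2)). apply C_ext; unfold Re, Im; simpl; lra.
Qed.

(** The modulus forces real part 0; then cos q = 1 means sin (q / 2) = 0, which yields multiples of
    2 pi rather than of pi. *)
Lemma Cexp_eq_1 (w : C) : Cexp w = RtoC 1 -> exists n : Z, w = (0, 2 * PI * IZR n).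
Proof.
  destruct w as [p q]; unfold Cexp, Re, Im; simpl; intros E. injection E as E1 E2.
  assert (Hs : sin q = 0).
  { apply Rmult_integral in E2; destruct E2 as [E2|E2]; [pose proof (exp_pos p); lra|exact E2]. }
  assert (Hsq : sin q * sin q + cos q * cos q = 1) by (generalize (sin2_cos2 q); unfold Rsqr; lra).
  assert (Hc : cos q = 1) by (pose proof (exp_pos p); rewrite Hs in Hsq; nra).
  assert (Hp : p = 0) by (apply exp_inv; rewrite exp_0; rewrite Hc in E1; lra).
  assert (Hh : sin (q / 2) = 0).
  { assert (cos q = 1 - 2 * sin (q / 2) * sin (q / 2)).
    { rewrite <- cos_2a_sin. f_equal; field. }
    nra. }
  destruct (sin_eq_0_0 _ Hh) as [n Hn]. exists n. rewrite Hp. f_equal. lra.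
Qed.

(** * Exponential profiles *)

Lemma Ccontinuous_Cexp (w : C) (x : R) : Ccontinuous (fun t => Cexp (Cmult w (RtoC t))) x.
Proof. exact (Cderive_cont _ _ _ (Cderive_Cexp w x)). Qed.

Lemma Ccontinuous_agree (f g : R -> C) (a b x : R) : a < b -> a <= x <= b -> Ccontinuous f x -> Ccontinuous g x ->
  (forall t, a < t < b -> f t = g t) -> f x = g x.
Proof.
  intros Hab Hx Hf Hg E.
  assert (H : (f x + - g x)%C = RtoC 0).
  { apply (Ccontinuous_zero_endpoint (fun t => Cplus (f t) (Copp (g t))) a b x Hab Hx).
    - exact (Ccontinuous_plus _ _ _ Hf (Ccontinuous_opp _ _ Hg)).
    - intros t Ht; rewrite (E t Ht); ring. }
  replace (f x) with (f x + - g x + g x)%C by ring. rewrite H; ring.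
Qed.

Lemma C_div_eq (w u v : C) : w <> RtoC 0 -> (w * u = w * v)%C -> u = v.
Proof.
  intros Hw E. replace u with (/ w * (w * u))%C by (field; exact Hw). rewrite E; field; exact Hw.
Qed.

Lemma C_mul_zero (w u : C) : w <> RtoC 0 -> (w * u = RtoC 0)%C -> u = RtoC 0.
Proof. intros Hw E; apply (C_div_eq w); [exact Hw|]. rewrite E; ring. Qed.

(** The derivative of the relation minus be times the relation leaves (al - be) u e^{al y} = 0. *)
Lemma exponentials_independent (al be u v : C) (a b : R) : a < b -> al <> be ->
  (forall y, a < y < b -> (u * Cexp (al * RtoC y) + v * Cexp (be * RtoC y) = RtoC 0)%C) ->
  u = RtoC 0 /\ v = RtoC 0.
Proof.
  intros Hab Hne H.
  set (y := (a + b) / 2). assert (Hy : a < y < b) by (unfold y; lra).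
  pose proof (Cderive_locally_zero _ a b y _ Hy H
    (Cderive_plus _ _ _ _ _ (Cderive_scal u _ _ _ (Cderive_Cexp al y)) (Cderive_scal v _ _ _ (Cderive_Cexp be y)))) as H1.
  pose proof (H y Hy) as H0.
  assert (Hd : Cminus al be <> RtoC 0).
  { intros E; apply Hne. replace al with (al - be + be)%C by ring. rewrite E; ring. }
  assert (Eu : u = RtoC 0).
  { apply (C_mul_zero (Cexp (al * RtoC y))); [apply Cexp_neq_0|].
    apply (C_mul_zero _ _ Hd).
    transitivity ((u * (al * Cexp (al * RtoC y)) + v * (be * Cexp (be * RtoC y)))
      - be * (u * Cexp (al * RtoC y) + v * Cexp (be * RtoC y)))%C; [ring|]. rewrite H0, H1; ring. }
  split; [exact Eu|]. apply (C_mul_zero (Cexp (be * RtoC y))); [apply Cexp_neq_0|].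
  rewrite Eu in H0. rewrite <- H0; ring.
Qed.

Section Exponential.
Context {B K : nat -> R -> C} {c : R -> C} (HS : sesqui B K c) (lam : C).
Context (HK1 : K 1%nat 0 = RtoC 0).
Context (Hlam : (K 2%nat 0 + lam * K 0%nat 0 = RtoC 0)%C).
Context (Hc : forall x, -1 < x < 1 -> c x = Cmult lam (B 0%nat x)).

(* The second z-derivative at z = 0 of the relation along x = y + z. *)
Lemma profile_ode : K 2%nat 0 <> RtoC 0 ->
  exists p q, forall y, -1 < y < 1 -> B 2%nat y = (p * B 1%nat y + q * B 0%nat y)%C.
Proof.
  intros HK2.
  exists (- (RtoC 2 * K 3%nat 0 / K 2%nat 0))%C, (- ((K 4%nat 0 + lam * K 2%nat 0) / K 2%nat 0))%C.
  intros y Hy.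
  (* The derivatives of k'' + lam k, in which c = lam b merges the first and last terms of [kterm].
     At 0 both [P 0] and k' vanish, which removes b''' and leaves 2 k''(0) b'' + 4 k'''(0) b' + 2
     (k''''(0) + lam k''(0)) b = 0. *)
  set (P := fun n t => (K (S (S n)) t + lam * K n t)%C).
  assert (HB := sesqui_B _ _ _ HS). assert (HK := sesqui_K _ _ _ HS).
  assert (HP : derivs P).
  { intros n t Ht; exact (Cderive_plus _ _ _ _ _ (HK (S (S n)) t Ht) (Cderive_scal lam _ _ _ (HK n t Ht))). }
  assert (HBs : forall n t, -1 < t < 1 -> is_Cderive (fun t => B n (y + t)%R) t (B (S n) (y + t)%R)).
  { intros n t Ht; apply Cderive_shift, HB; lra. }
  assert (HPn : forall n t, -1 < t < 1 -> is_Cderive (fun t => P n (- t)%R) t (Copp (P (S n) (- t)%R))).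
  { intros n t Ht; apply Cderive_neg, HP; lra. }
  assert (HKn : forall n t, -1 < t < 1 -> is_Cderive (fun t => K n (- t)%R) t (Copp (K (S n) (- t)%R))).
  { intros n t Ht; apply Cderive_neg, HK; lra. }
  assert (HP' : forall n t, -1 < t < 1 -> is_Cderive (P n) t (P (S n) t)) by (intros; apply HP; lra).
  assert (HK' : forall n t, -1 < t < 1 -> is_Cderive (K n) t (K (S n) t)) by (intros; apply HK; lra).
  set (e := Rmin (1 - y) (1 + y)).
  assert (He : 0 < e) by (apply Rmin_glb_lt; lra).
  assert (He1 : e <= 1 - y) by apply Rmin_l. assert (He2 : e <= 1 + y) by apply Rmin_r.
  clearbody e.
  set (F := fun t => (B 0%nat (y + t)%R * P 0%nat t + B 1%nat (y + t)%R * K 1%nat t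
     + (B 0%nat y * P 0%nat (- t)%R + B 1%nat y * K 1%nat (- t)%R))%C).
  set (F1 := fun t => (B 1%nat (y + t)%R * P 0%nat t + B 0%nat (y + t)%R * P 1%nat t
     + (B 2%nat (y + t)%R * K 1%nat t + B 1%nat (y + t)%R * K 2%nat t)
     + (B 0%nat y * - P 1%nat (- t)%R + B 1%nat y * - K 2%nat (- t)%R))%C).
  assert (HF : forall t, -1 < t < 1 -> is_Cderive F t (F1 t)).
  { intros t Ht.
    exact (Cderive_plus _ _ _ _ _ (Cderive_plus _ _ _ _ _
      (Cderive_mult _ _ _ _ _ (HBs 0%nat t Ht) (HP' 0%nat t Ht)) (Cderive_mult _ _ _ _ _ (HBs 1%nat t Ht) (HK' 1%nat t Ht)))
      (Cderive_plus _ _ _ _ _ (Cderive_scal (B 0%nat y) _ _ _ (HPn 0%nat t Ht)) (Cderive_scal (B 1%nat y) _ _ _ (HKn 1%nat t Ht)))). }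
  assert (H0 : -1 < 0 < 1) by lra.
  pose proof (Cderive_plus _ _ _ _ _ (Cderive_plus _ _ _ _ _ (Cderive_plus _ _ _ _ _
      (Cderive_mult _ _ _ _ _ (HBs 1%nat 0 H0) (HP' 0%nat 0 H0)) (Cderive_mult _ _ _ _ _ (HBs 0%nat 0 H0) (HP' 1%nat 0 H0)))
      (Cderive_plus _ _ _ _ _ (Cderive_mult _ _ _ _ _ (HBs 2%nat 0 H0) (HK' 1%nat 0 H0))
                          (Cderive_mult _ _ _ _ _ (HBs 1%nat 0 H0) (HK' 2%nat 0 H0))))
      (Cderive_plus _ _ _ _ _ (Cderive_scal (B 0%nat y) _ _ _ (Cderive_opp _ _ _ (HPn 1%nat 0 H0)))
                          (Cderive_scal (B 1%nat y) _ _ _ (Cderive_opp _ _ _ (HKn 2%nat 0 H0))))) as HF2.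
  assert (Z0 : forall t, - e < t < e -> F t = RtoC 0).
  { intros t Ht. pose proof (sesqui_rel _ _ _ HS (y + t)%R y ltac:(lra) ltac:(lra)) as H.
    replace (y + t - y) with t in H by ring. replace (y - (y + t)%R) with (- t)%R in H by ring.
    unfold kterm in H. rewrite !Hc in H by lra. rewrite <- H. unfold F, P; ring. }
  assert (Z1 : forall t, - e < t < e -> F1 t = RtoC 0).
  { intros t Ht. apply (Cderive_locally_zero F (- e) e t); [exact Ht|exact Z0|apply HF; lra]. }
  pose proof (Cderive_locally_zero F1 (- e) e 0 _ ltac:(lra) Z1 HF2) as Z2.
  cbv beta in Z2. rewrite Ropp_0, Rplus_0_r in Z2.
  assert (EP : P 0%nat 0 = RtoC 0) by exact Hlam.
  assert (EP1 : P 1%nat 0 = K 3%nat 0) by (unfold P; rewrite HK1; ring).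
  rewrite EP, EP1, HK1 in Z2. unfold P in Z2.
  apply (C_div_eq (RtoC 2 * K 2%nat 0)%C).
  { apply Cmult_neq_0; [intros E; injection E; lra|exact HK2]. }
  match type of Z2 with ?l = _ => set (z2 := l) in Z2 end.
  transitivity (z2 - RtoC 4 * K 3%nat 0 * B 1%nat y - RtoC 2 * (K 4%nat 0 + lam * K 2%nat 0) * B 0%nat y)%C.
  - unfold z2. replace (RtoC 4) with (RtoC 2 * RtoC 2)%C by (rewrite <- RtoC_mult; f_equal; ring). ring.
  - rewrite Z2. replace (RtoC 4) with (RtoC 2 * RtoC 2)%C by (rewrite <- RtoC_mult; f_equal; ring).
    field. exact HK2.
Qed.

(** The characteristic roots are al and be. A double root would give b = (A1 x + A0) e^{al x}, which
    cannot vanish at both -1 and 1 unless b = 0. For distinct roots, b(1) = 0 and b(-1) = 0 read A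
    e^{al - be} = -A' and A = -A' e^{al - be}, whence e^{2(al - be)} = 1. *)
Lemma profile_exponential : K 2%nat 0 <> RtoC 0 ->
  exists al be A A', al <> be /\ A <> RtoC 0 /\ A' <> RtoC 0 /\
    Cexp (RtoC 2 * (al - be)) = RtoC 1 /\
    forall x, -1 < x < 1 -> B 0%nat x = (A * Cexp (al * RtoC x) + A' * Cexp (be * RtoC x))%C.
Proof.
  intros HK2. destruct (profile_ode HK2) as [p [q Hode]].
  destruct (Csqrt_exists (p * p / RtoC 4 + q)%C) as [r Hr].
  assert (N2 : RtoC 2 <> RtoC 0) by (intros E; injection E; lra).
  assert (N4 : RtoC 4 = (RtoC 2 * RtoC 2)%C) by (rewrite <- RtoC_mult; f_equal; ring).
  set (al := (p / RtoC 2 + r)%C). set (be := (p / RtoC 2 - r)%C).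
  assert (E1 : (al + be = p)%C) by (unfold al, be; field; exact N2).
  assert (E2 : (al * be = - q)%C).
  { transitivity (p * p / RtoC 4 - r * r)%C; [unfold al, be; rewrite N4; field; exact N2|].
    rewrite Hr; ring. }
  clearbody al be.
  assert (HB := sesqui_B _ _ _ HS).
  (* Factorisation of the second-order operator: b' - be b satisfies a first-order equation with
     rate al. Stated for arbitrary roots so that it can be used with al and be exchanged. *)
  assert (Hfac : forall al be, (al + be = p)%C -> (al * be = - q)%C ->
    exists A, forall x, -1 < x < 1 -> (B 1%nat x - be * B 0%nat x = A * Cexp (al * RtoC x))%C).
  { clear al be E1 E2. intros al be E1 E2.
    apply (exponential_solution (fun x => B 1%nat x - be * B 0%nat x)%C (-1) 1 al); [lra|].
    intros x Hx. eapply Cderive_eq.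
    - exact (Cderive_plus _ _ _ _ _ (HB 1%nat x ltac:(lra)) (Cderive_opp _ _ _ (Cderive_scal be _ _ _ (HB 0%nat x ltac:(lra))))).
    - rewrite (Hode x Hx). rewrite <- E1. replace q with (- (al * be))%C by (rewrite E2; ring). ring. }
  destruct (Hfac al be E1 E2) as [A1 HA1].
  destruct (sesqui_nonzero _ _ _ HS) as [y0 [Hy0 Hny0]].
  assert (EL := sesqui_left _ _ _ HS). assert (ER := sesqui_right _ _ _ HS).
  destruct (classic (al = be)) as [Heq|Hne].
  { exfalso. subst be.
    destruct (exponential_solution (fun x => Cexp (- al * RtoC x) * B 0%nat x - A1 * RtoC x)%C (-1) 1 (RtoC 0))
      as [A0 HA0]; [lra| |].
    { intros x Hx. eapply Cderive_eq.
      - exact (Cderive_plus _ _ _ _ _ (Cderive_mult _ _ _ _ _ (Cderive_Cexp (- al)%C x) (HB 0%nat x ltac:(lra)))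
          (Cderive_opp _ _ _ (Cderive_scal A1 _ _ _ (Cderive_RtoC (fun t => t) x 1 (is_derive_id (K := R_AbsRing) x))))).
      - cbv beta. transitivity (Cexp (- al * RtoC x) * (B 1%nat x - al * B 0%nat x) - A1)%C; [ring|].
        rewrite (HA1 x Hx). replace (- al * RtoC x)%C with (- (al * RtoC x))%C by ring.
        transitivity (A1 * (Cexp (- (al * RtoC x)) * Cexp (al * RtoC x)) - A1)%C; [ring|].
        rewrite Cexp_opp_l; ring. }
    assert (HA0' : forall x, -1 < x < 1 -> (Cexp (- al * RtoC x) * B 0%nat x = A1 * RtoC x + A0)%C).
    { intros x Hx. specialize (HA0 x Hx).
      replace (RtoC 0 * RtoC x)%C with (RtoC 0) in HA0 by ring. rewrite Cexp_0 in HA0.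
      transitivity (Cexp (- al * RtoC x) * B 0%nat x - A1 * RtoC x + A1 * RtoC x)%C; [ring|].
      rewrite HA0; ring. }
    assert (Hend : forall x, -1 <= x <= 1 -> (Cexp (- al * RtoC x) * B 0%nat x = A1 * RtoC x + A0)%C).
    { intros x Hx. apply (Ccontinuous_agree (fun x => Cexp (- al * RtoC x) * B 0%nat x)%C (fun x => A1 * RtoC x + A0)%C (-1) 1 x);
        [lra|exact Hx| | |exact HA0'].
      - exact (Ccontinuous_mult _ _ _ (Ccontinuous_Cexp (- al)%C x) (sesqui_Bcont HS 0%nat x Hx)).
      - exact (Ccontinuous_plus _ _ _ (Ccontinuous_mult _ _ _ (Ccontinuous_const A1 x) (Ccontinuous_peval pvar x)) (Ccontinuous_const A0 x)). }
    pose proof (Hend (-1) ltac:(lra)) as X1. pose proof (Hend 1 ltac:(lra)) as X2.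
    rewrite EL in X1. rewrite ER in X2.
    replace (RtoC (-1)) with (- RtoC 1)%C in X1 by (rewrite <- RtoC_opp; reflexivity).
    assert (A00 : A0 = RtoC 0).
    { apply (C_mul_zero (RtoC 2) _ N2).
      transitivity ((A1 * - RtoC 1 + A0) + (A1 * RtoC 1 + A0))%C; [ring|]. rewrite <- X1, <- X2; ring. }
    assert (A10 : A1 = RtoC 0).
    { transitivity ((A1 * RtoC 1 + A0) - A0)%C; [ring|]. rewrite <- X2, A00; ring. }
    apply Hny0. apply (C_mul_zero (Cexp (- al * RtoC y0))); [apply Cexp_neq_0|].
    rewrite (HA0' y0 Hy0), A00, A10; ring. }
  destruct (Hfac be al) as [A2 HA2]; [rewrite <- E1; ring|rewrite <- E2; ring|].
  assert (Hd : (al - be)%C <> RtoC 0).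
  { intros E; apply Hne. replace al with (al - be + be)%C by ring. rewrite E; ring. }
  set (A := (A1 / (al - be))%C). set (A' := (- (A2 / (al - be)))%C).
  assert (HBx : forall x, -1 < x < 1 -> B 0%nat x = (A * Cexp (al * RtoC x) + A' * Cexp (be * RtoC x))%C).
  { intros x Hx. apply (C_div_eq _ _ _ Hd).
    transitivity ((B 1%nat x - be * B 0%nat x) - (B 1%nat x - al * B 0%nat x))%C; [ring|].
    rewrite (HA1 x Hx), (HA2 x Hx). unfold A, A'; field. exact Hd. }
  clearbody A A'.
  assert (Hend : forall x, -1 <= x <= 1 -> B 0%nat x = (A * Cexp (al * RtoC x) + A' * Cexp (be * RtoC x))%C).
  { intros x Hx. apply (Ccontinuous_agree (B 0%nat) (fun x => A * Cexp (al * RtoC x) + A' * Cexp (be * RtoC x))%C (-1) 1 x);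
      [lra|exact Hx|apply (sesqui_Bcont HS), Hx| |exact HBx].
    exact (Ccontinuous_plus _ _ _ (Ccontinuous_mult _ _ _ (Ccontinuous_const A x) (Ccontinuous_Cexp al x))
      (Ccontinuous_mult _ _ _ (Ccontinuous_const A' x) (Ccontinuous_Cexp be x))). }
  pose proof (Hend (-1) ltac:(lra)) as X1. pose proof (Hend 1 ltac:(lra)) as X2.
  rewrite EL in X1. rewrite ER in X2.
  replace (RtoC (-1)) with (- RtoC 1)%C in X1 by (rewrite <- RtoC_opp; reflexivity).
  replace (al * - RtoC 1)%C with (- al)%C in X1 by ring. replace (be * - RtoC 1)%C with (- be)%C in X1 by ring.
  replace (al * RtoC 1)%C with al in X2 by ring. replace (be * RtoC 1)%C with be in X2 by ring.
  assert (HA : A <> RtoC 0).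
  { intros Z. apply Hny0. rewrite (HBx y0 Hy0), Z.
    assert (A' = RtoC 0).
    { apply (C_mul_zero (Cexp be)); [apply Cexp_neq_0|]. rewrite X2, Z; ring. }
    rewrite H; ring. }
  assert (HA' : A' <> RtoC 0).
  { intros Z. apply HA. apply (C_mul_zero (Cexp al)); [apply Cexp_neq_0|]. rewrite X2, Z; ring. }
  exists al, be, A, A'. repeat split; try assumption.
  assert (Y1 : (A * Cexp (al - be) = - A')%C).
  { unfold Cminus; rewrite Cexp_plus.
    transitivity ((A * Cexp al + A' * Cexp be) * Cexp (- be) - A' * (Cexp (- be) * Cexp be))%C; [ring|].
    rewrite <- X2, Cexp_opp_l; ring. }
  assert (Y2 : (A = - A' * Cexp (al - be))%C).
  { unfold Cminus; rewrite Cexp_plus.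
    transitivity (A * (Cexp (- al) * Cexp al))%C; [rewrite Cexp_opp_l; ring|].
    transitivity ((A * Cexp (- al) + A' * Cexp (- be)) * Cexp al - A' * (Cexp al * Cexp (- be)))%C; [ring|].
    rewrite <- X1; ring. }
  apply (C_div_eq A _ _ HA).
  replace (RtoC 2 * (al - be))%C with ((al - be) + (al - be))%C by ring. rewrite Cexp_plus.
  transitivity (A * Cexp (al - be) * Cexp (al - be))%C; [ring|]. rewrite Y1, <- Y2; ring.
Qed.

(** The difference D from the claimed solution has zero Cauchy data at 0; D' + mu D solves a
    first-order equation, and then so does D. *)
Lemma cosh_solution (W W1 W2 : R -> C) (mu : C) :
  (forall z, -2 < z < 2 -> is_Cderive W z (W1 z)) -> (forall z, -2 < z < 2 -> is_Cderive W1 z (W2 z)) ->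
  (forall z, -2 < z < 2 -> W2 z = (mu * mu * W z)%C) -> W1 0 = RtoC 0 ->
  forall z, -2 < z < 2 -> W z = (W 0 * ((Cexp (mu * RtoC z) + Cexp (- mu * RtoC z)) / RtoC 2))%C.
Proof.
  intros H1 H2 Hode H0.
  assert (N2 : RtoC 2 <> RtoC 0) by (intros E; injection E; lra).
  set (h := (W 0 / RtoC 2)%C).
  set (D := fun z => (W z - h * (Cexp (mu * RtoC z) + Cexp (- mu * RtoC z)))%C).
  set (D1 := fun z => (W1 z - h * (mu * Cexp (mu * RtoC z) + - mu * Cexp (- mu * RtoC z)))%C).
  assert (HD : forall z, -2 < z < 2 -> is_Cderive D z (D1 z)).
  { intros z Hz. exact (Cderive_plus _ _ _ _ _ (H1 z Hz) (Cderive_opp _ _ _ (Cderive_scal h _ _ _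
      (Cderive_plus _ _ _ _ _ (Cderive_Cexp mu z) (Cderive_Cexp (- mu)%C z))))). }
  assert (HD1 : forall z, -2 < z < 2 -> is_Cderive D1 z (mu * mu * D z)%C).
  { intros z Hz. eapply Cderive_eq; [exact (Cderive_plus _ _ _ _ _ (H2 z Hz) (Cderive_opp _ _ _ (Cderive_scal h _ _ _
      (Cderive_plus _ _ _ _ _ (Cderive_scal mu _ _ _ (Cderive_Cexp mu z)) (Cderive_scal (- mu)%C _ _ _ (Cderive_Cexp (- mu)%C z))))))|].
    rewrite (Hode z Hz). unfold D; ring. }
  assert (Z0 : forall w : C, (w * RtoC 0 = RtoC 0)%C) by (intros; ring).
  assert (D00 : D 0 = RtoC 0).
  { unfold D; rewrite !Z0, Cexp_0. unfold h; field; exact N2. }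
  assert (D10 : D1 0 = RtoC 0).
  { unfold D1; rewrite !Z0, Cexp_0, H0; ring. }
  assert (S0 : forall z, -2 < z < 2 -> (D1 z + mu * D z = RtoC 0)%C).
  { apply (exponential_solution_zero (fun z => D1 z + mu * D z)%C (-2) 2 0 mu); [lra| |rewrite D10, D00; ring].
    intros z Hz. eapply Cderive_eq; [exact (Cderive_plus _ _ _ _ _ (HD1 z Hz) (Cderive_scal mu _ _ _ (HD z Hz)))|]. ring. }
  assert (S1 : forall z, -2 < z < 2 -> D z = RtoC 0).
  { apply (exponential_solution_zero D (-2) 2 0 (- mu)%C); [lra| |exact D00].
    intros z Hz. eapply Cderive_eq; [exact (HD z Hz)|].
    transitivity (D1 z + mu * D z - mu * D z)%C; [ring|]. rewrite (S0 z Hz); ring. }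
  intros z Hz. transitivity (D z + h * (Cexp (mu * RtoC z) + Cexp (- mu * RtoC z)))%C; [unfold D; ring|].
  rewrite (S1 z Hz). unfold h; field; exact N2.
Qed.

(** With h = al / 2, W(z) = e^{-hz} k(-z) + e^{hz} k(z) absorbs the first-order terms: W'' = (h^2 -
    lam) W. W is even, so W'(0) = 0 and W is a multiple of cosh(mu z) with mu^2 = h^2 - lam. *)
Lemma kernel_cosh (al : C) :
  (forall z, -2 < z < 2 ->
    K 2%nat (- z)%R + al * K 1%nat (- z)%R + lam * K 0%nat (- z)%R
    + Cexp (al * RtoC z) * (K 2%nat z + al * K 1%nat z + lam * K 0%nat z) = RtoC 0)%C ->
  exists mu, forall z, -2 < z < 2 ->
    (K 0%nat (- z)%R + Cexp (al * RtoC z) * K 0%nat z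
     = K 0%nat 0 * Cexp (al / RtoC 2 * RtoC z) * (Cexp (mu * RtoC z) + Cexp (- mu * RtoC z)))%C.
Proof.
  intros H.
  assert (N2 : RtoC 2 <> RtoC 0) by (intros E; injection E; lra).
  set (h := (al / RtoC 2)%C). assert (Eal : al = (RtoC 2 * h)%C) by (unfold h; field; exact N2).
  clearbody h. subst al.
  destruct (Csqrt_exists (h * h - lam)%C) as [mu Hmu]. exists mu.
  assert (HK := sesqui_K _ _ _ HS).
  assert (HKn : forall n t, -2 < t < 2 -> is_Cderive (fun t => K n (- t)%R) t (Copp (K (S n) (- t)%R))).
  { intros n t Ht; apply Cderive_neg, HK; lra. }
  set (W := fun z => (Cexp (- h * RtoC z) * K 0%nat (- z)%R + Cexp (h * RtoC z) * K 0%nat z)%C).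
  set (W1 := fun z => (Cexp (- h * RtoC z) * (- h * K 0%nat (- z)%R - K 1%nat (- z)%R)
     + Cexp (h * RtoC z) * (h * K 0%nat z + K 1%nat z))%C).
  set (W2 := fun z => (Cexp (- h * RtoC z) * (h * h * K 0%nat (- z)%R + RtoC 2 * h * K 1%nat (- z)%R + K 2%nat (- z)%R)
     + Cexp (h * RtoC z) * (h * h * K 0%nat z + RtoC 2 * h * K 1%nat z + K 2%nat z))%C).
  assert (Hsplit : forall z, (Cexp (RtoC 2 * h * RtoC z) = Cexp (h * RtoC z) * Cexp (h * RtoC z))%C).
  { intros z; rewrite <- Cexp_plus; f_equal; ring. }
  assert (Hinv : forall z, (Cexp (- h * RtoC z) * Cexp (h * RtoC z) = RtoC 1)%C).
  { intros z. replace (- h * RtoC z)%C with (- (h * RtoC z))%C by ring. apply Cexp_opp_l. }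
  assert (HW := cosh_solution W W1 W2 mu).
  assert (HW' : forall z, -2 < z < 2 -> W z = (W 0 * ((Cexp (mu * RtoC z) + Cexp (- mu * RtoC z)) / RtoC 2))%C).
  { apply HW.
    - intros z Hz. eapply Cderive_eq.
      + exact (Cderive_plus _ _ _ _ _ (Cderive_mult _ _ _ _ _ (Cderive_Cexp (- h)%C z) (HKn 0%nat z Hz))
          (Cderive_mult _ _ _ _ _ (Cderive_Cexp h z) (HK 0%nat z Hz))).
      + unfold W1; ring.
    - intros z Hz. eapply Cderive_eq.
      + exact (Cderive_plus _ _ _ _ _
          (Cderive_mult _ _ _ _ _ (Cderive_Cexp (- h)%C z) (Cderive_plus _ _ _ _ _ (Cderive_scal (- h)%C _ _ _ (HKn 0%nat z Hz)) (Cderive_opp _ _ _ (HKn 1%nat z Hz))))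
          (Cderive_mult _ _ _ _ _ (Cderive_Cexp h z) (Cderive_plus _ _ _ _ _ (Cderive_scal h _ _ _ (HK 0%nat z Hz)) (HK 1%nat z Hz)))).
      + unfold W2; ring.
    - intros z Hz. rewrite Hmu. specialize (H z Hz). rewrite Hsplit in H.
      set (e1 := Cexp (- h * RtoC z)) in *.
      match type of H with ?l = _ => set (hh := l) in H end.
      transitivity ((h * h - lam) * W z + e1 * hh
        + (RtoC 1 - e1 * Cexp (h * RtoC z)) * (Cexp (h * RtoC z) * (K 2%nat z + RtoC 2 * h * K 1%nat z + lam * K 0%nat z)))%C.
      + unfold W2, W, hh. fold e1. ring.
      + rewrite H. unfold e1 at 2; rewrite Hinv. ring.
    - unfold W1. rewrite Ropp_0, HK1. replace (- h * RtoC 0)%C with (RtoC 0) by ring.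
      replace (h * RtoC 0)%C with (RtoC 0) by ring. ring. }
  assert (EW0 : W 0 = (RtoC 2 * K 0%nat 0)%C).
  { unfold W. rewrite Ropp_0. replace (- h * RtoC 0)%C with (RtoC 0) by ring.
    replace (h * RtoC 0)%C with (RtoC 0) by ring. rewrite Cexp_0; ring. }
  intros z Hz. specialize (HW' z Hz). rewrite EW0 in HW'.
  replace (RtoC 2 * h / RtoC 2)%C with h by (field; exact N2).
  transitivity (Cexp (h * RtoC z) * W z)%C.
  - unfold W. rewrite Hsplit.
    transitivity (Cexp (- h * RtoC z) * Cexp (h * RtoC z) * K 0%nat (- z)%R + Cexp (h * RtoC z) * Cexp (h * RtoC z) * K 0%nat z)%C; [rewrite Hinv; ring|ring].
  - rewrite HW'. field.
Qed.

(** For fixed z the relation on x = y + z is A E(al, z) e^{al y} + A' E(be, z) e^{be y} = 0 for all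
    y with y and y + z in (-1, 1), an interval that is nonempty because |z| < 2. *)
Lemma kernel_separated (al be A A' : C) : al <> be -> A <> RtoC 0 -> A' <> RtoC 0 ->
  (forall x, -1 < x < 1 -> B 0%nat x = (A * Cexp (al * RtoC x) + A' * Cexp (be * RtoC x))%C) ->
  let E w z := (K 2%nat (- z)%R + w * K 1%nat (- z)%R + lam * K 0%nat (- z)%R
    + Cexp (w * RtoC z) * (K 2%nat z + w * K 1%nat z + lam * K 0%nat z))%C in
  forall z, -2 < z < 2 -> E al z = RtoC 0 /\ E be z = RtoC 0.
Proof.
  intros Hne HA HA' HB E z Hz.
  assert (HB1 : forall x, -1 < x < 1 -> B 1%nat x = (A * (al * Cexp (al * RtoC x)) + A' * (be * Cexp (be * RtoC x)))%C).
  { intros x Hx. apply (Cderive_unique (B 0%nat) x); [apply (sesqui_B _ _ _ HS); lra|].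
    apply Cderive_ext_loc with (f := fun x => (A * Cexp (al * RtoC x) + A' * Cexp (be * RtoC x))%C).
    - generalize (locally_open_interval (-1) 1 x Hx); apply filter_imp. intros t Ht; symmetry; auto.
    - exact (Cderive_plus _ _ _ _ _ (Cderive_scal A _ _ _ (Cderive_Cexp al x)) (Cderive_scal A' _ _ _ (Cderive_Cexp be x))). }
  assert (Hab : Rmax (-1) (-1 - z) < Rmin 1 (1 - z)).
  { apply Rmax_lub_lt; apply Rmin_glb_lt; lra. }
  destruct (exponentials_independent al be (A * E al z) (A' * E be z) _ _ Hab Hne) as [H1 H2].
  - intros y [Hy1 Hy2].
    pose proof (Rmax_l (-1) (-1 - z)); pose proof (Rmax_r (-1) (-1 - z)).
    pose proof (Rmin_l 1 (1 - z)); pose proof (Rmin_r 1 (1 - z)).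
    pose proof (sesqui_rel _ _ _ HS (y + z) y ltac:(lra) ltac:(lra)) as R.
    replace (y + z - y) with z in R by ring. replace (y - (y + z)) with (- z)%R in R by ring.
    unfold kterm in R. rewrite !Hc, !HB1, !HB in R by lra.
    rewrite <- R. rewrite RtoC_plus.
    replace (al * (RtoC y + RtoC z))%C with (al * RtoC y + al * RtoC z)%C by ring.
    replace (be * (RtoC y + RtoC z))%C with (be * RtoC y + be * RtoC z)%C by ring.
    rewrite !Cexp_plus. unfold E; ring.
  - split; [exact (C_mul_zero _ _ HA H1)|exact (C_mul_zero _ _ HA' H2)].
Qed.

End Exponential.

(** * Solving for the kernel *)

Lemma Ccontinuous_ext (f g : R -> C) (x : R) : (forall t, f t = g t) -> Ccontinuous f x -> Ccontinuous g x.
Proof.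
  intros E [H1 H2]; split.
  - apply (continuous_ext (fun t => Re (f t))); [intros t; now rewrite E|exact H1].
  - apply (continuous_ext (fun t => Im (f t))); [intros t; now rewrite E|exact H2].
Qed.

Lemma expcomb_cont (f : R -> C) (x : R) : expcomb f -> Ccontinuous f x.
Proof.
  intros [n [a [al H]]].
  apply Ccontinuous_ext with (f := exp_combination n a al); [intros t; symmetry; apply H|].
  clear H. induction n as [|n IH].
  - apply Ccontinuous_ext with (f := fun t => Cmult (a 0%nat) (Cexp (Cmult (al 0%nat) (RtoC t)))).
    + intros t; unfold exp_combination; now rewrite sum_O.
    + exact (Ccontinuous_mult _ _ _ (Ccontinuous_const _ _) (Ccontinuous_Cexp _ _)).
  - apply Ccontinuous_ext with (f := fun t => Cplus (exp_combination n a al t)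
      (Cmult (a (S n)) (Cexp (Cmult (al (S n)) (RtoC t))))).
    + intros t; unfold exp_combination; now rewrite sum_Sn.
    + exact (Ccontinuous_plus _ _ _ IH (Ccontinuous_mult _ _ _ (Ccontinuous_const _ _) (Ccontinuous_Cexp _ _))).
Qed.

(** For reciprocal pairs x + x' + y + y' = (x + y)(1 + x' y'), the product formula for cosh u + cosh
    v. *)
Lemma cosh_sum_zero (x x' y y' : C) : (x * x' = RtoC 1)%C -> (y * y' = RtoC 1)%C ->
  (x + x' + (y + y') = RtoC 0)%C -> (y * x' = - RtoC 1)%C \/ (y' * x' = - RtoC 1)%C.
Proof.
  intros Hx Hy H.
  assert (P : ((x + y) * (RtoC 1 + x' * y') = RtoC 0)%C).
  { transitivity (x + x' + (y + y') + (x * x' - RtoC 1) * y' + (y * y' - RtoC 1) * x')%C; [ring|].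
    rewrite H, Hx, Hy; ring. }
  destruct (classic (x + y = RtoC 0)%C) as [E|E].
  - left. transitivity ((x + y) * x' - x * x')%C; [ring|]. rewrite E, Hx; ring.
  - right. apply C_mul_zero in P; [|exact E].
    transitivity (RtoC 1 + x' * y' - RtoC 1)%C; [ring|]. rewrite P; ring.
Qed.

Lemma Cexp_opp_mul (w : C) (z : R) : (Cexp (w * RtoC z) * Cexp (- w * RtoC z) = RtoC 1)%C.
Proof.
  replace (- w * RtoC z)%C with (- (w * RtoC z))%C by ring. rewrite Cmult_comm. apply Cexp_opp_l.
Qed.

(* At z1 = 2/n the denominator vanishes, so the numerator must too; this ties nu
   to mu so that the quotient is a pair of finite geometric sums. *)
Lemma quotient_expcomb (k0 al be mu nu : C) (G : R -> C) :
  k0 <> RtoC 0 -> al <> be -> Cexp (RtoC 2 * (al - be)) = RtoC 1 ->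
  (forall z, Ccontinuous G z) ->
  (forall z, -2 < z < 2 ->
    ((Cexp (al * RtoC z) - Cexp (be * RtoC z)) * G z
     = k0 * Cexp (al / RtoC 2 * RtoC z) * (Cexp (mu * RtoC z) + Cexp (- mu * RtoC z))
     - k0 * Cexp (be / RtoC 2 * RtoC z) * (Cexp (nu * RtoC z) + Cexp (- nu * RtoC z)))%C) ->
  exists g, expcomb g /\ forall z, -2 <= z <= 2 -> G z = g z.
Proof.
  intros Hk0 Hne Hper HG Hrel.
  assert (N2 : RtoC 2 <> RtoC 0) by (intros E; injection E; lra).
  (* Coordinates in which the denominator is e^{2hz} (e^{2 de z} - 1), with be = 2 h and al = 2 h +
     2 de. *)
  set (h := (be / RtoC 2)%C). set (de := ((al - be) / RtoC 2)%C).
  assert (Ebe : be = (RtoC 2 * h)%C) by (unfold h; field; exact N2).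
  assert (Eal : al = (RtoC 2 * h + RtoC 2 * de)%C) by (unfold h, de; field; exact N2).
  assert (Ealh : (al / RtoC 2 = h + de)%C) by (unfold h, de; field; exact N2).
  assert (Hde : de <> RtoC 0).
  { intros Z; apply Hne. rewrite Eal, Ebe, Z; ring. }
  rewrite Ealh in Hrel. fold h in Hrel. clearbody h de. subst al be. clear Hne Ealh.
  assert (Hdbl : forall w z, (Cexp (RtoC 2 * w * RtoC z) = Cexp (w * RtoC z) * Cexp (w * RtoC z))%C).
  { intros w z; rewrite <- Cexp_plus; f_equal; ring. }
  assert (Hadd : forall v w z, (Cexp ((v + w) * RtoC z) = Cexp (v * RtoC z) * Cexp (w * RtoC z))%C).
  { intros v w z; rewrite <- Cexp_plus; f_equal; ring. }
  (* The closed interval matters: the zero z1 = 2 / n of the denominator lies on its boundary when n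
     is 1 or -1. This is why continuity of [G] at the endpoints is assumed. *)
  assert (Hclosed : forall z, -2 <= z <= 2 ->
    (k0 * Cexp (h * RtoC z) * (Cexp (de * RtoC z) * (Cexp (mu * RtoC z) + Cexp (- mu * RtoC z))
       - (Cexp (nu * RtoC z) + Cexp (- nu * RtoC z)))
     = Cexp (h * RtoC z) * Cexp (h * RtoC z) * (Cexp (de * RtoC z) * Cexp (de * RtoC z) - RtoC 1) * G z)%C).
  { intros z Hz.
    apply (Ccontinuous_agree (fun z => k0 * Cexp (h * RtoC z) * (Cexp (de * RtoC z) * (Cexp (mu * RtoC z) + Cexp (- mu * RtoC z))
       + - (Cexp (nu * RtoC z) + Cexp (- nu * RtoC z))))%C
      (fun z => Cexp (h * RtoC z) * Cexp (h * RtoC z) * (Cexp (de * RtoC z) * Cexp (de * RtoC z) + - RtoC 1) * G z)%C (-2) 2 z);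
      [lra|exact Hz| | |].
    - pose proof (fun w => Ccontinuous_Cexp w z). ccont; auto.
    - pose proof (fun w => Ccontinuous_Cexp w z). ccont; auto.
    - intros t Ht. specialize (Hrel t Ht). rewrite !Hadd, !Hdbl in Hrel.
      match type of Hrel with ?l = ?r => transitivity r; [ring|rewrite <- Hrel; ring] end. }
  (* The period condition is e^{4 de} = 1, so 4 de = 2 pi i n with n nonzero, and de z1 = i pi at z1
     = 2 / n. *)
  destruct (Cexp_eq_1 _ Hper) as [n Hn].
  assert (E4 : (RtoC 4 * de)%C = (0, 2 * PI * IZR n)).
  { rewrite <- Hn. replace (RtoC 4) with (RtoC 2 * RtoC 2)%C by (rewrite <- RtoC_mult; f_equal; ring). ring. }
  assert (Hn0 : IZR n <> 0).
  { intros Z. apply Hde. apply (C_mul_zero (RtoC 4)); [intros E; injection E; lra|].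
    rewrite E4, Z, Rmult_0_r; reflexivity. }
  set (z1 := 2 / IZR n).
  assert (Hz1 : -2 <= z1 <= 2).
  { assert (Hn1 : 1 <= Rabs (IZR n)).
    { assert (n <> 0%Z) by (intros ->; apply Hn0; reflexivity).
      rewrite <- abs_IZR. apply IZR_le; lia. }
    apply Rabs_le_between. unfold z1. rewrite Rabs_div, (Rabs_pos_eq 2) by lra.
    apply Rle_div_l; lra. }
  assert (Hz10 : RtoC z1 <> RtoC 0).
  { intros E; injection E. unfold z1; intros E'. apply Rmult_integral in E'.
    destruct E' as [E'|E']; [lra|]. apply (Rinv_neq_0_compat _ Hn0 E'). }
  assert (Edz : (de * RtoC z1)%C = (0, PI)).
  { apply (C_div_eq (RtoC 4)); [intros E; injection E; lra|].
    transitivity (Cmult (0, 2 * PI * IZR n) (RtoC z1)); [rewrite <- E4; ring|].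
    apply C_ext; unfold z1, Re, Im; simpl; field; exact Hn0. }
  assert (Ed1 : Cexp (de * RtoC z1) = (- RtoC 1)%C).
  { rewrite Edz. unfold Cexp, Re, Im; simpl. rewrite exp_0, cos_PI, sin_PI.
    apply C_ext; unfold Re, Im; simpl; ring. }
  (* Only the even function cosh(nu z) occurs, so the sign of nu may be chosen to land in the first
     case of [cosh_sum_zero]. *)
  assert (Hnu : exists nu', (forall z, (Cexp (nu * RtoC z) + Cexp (- nu * RtoC z) = Cexp (nu' * RtoC z) + Cexp (- nu' * RtoC z))%C)
     /\ Cexp ((nu' - mu) * RtoC z1) = (- RtoC 1)%C).
  { pose proof (Hclosed z1 Hz1) as H. rewrite Ed1 in H.
    replace (- RtoC 1 * - RtoC 1 - RtoC 1)%C with (RtoC 0) in H by ring.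
    assert (H' : (k0 * Cexp (h * RtoC z1) * (Cexp (mu * RtoC z1) + Cexp (- mu * RtoC z1)
       + (Cexp (nu * RtoC z1) + Cexp (- nu * RtoC z1))) = RtoC 0)%C).
    { match type of H with ?l = ?r => transitivity (- l)%C; [ring|rewrite H; ring] end. }
    apply C_mul_zero in H'; [|apply Cmult_neq_0; [exact Hk0|apply Cexp_neq_0]].
    destruct (cosh_sum_zero _ _ _ _ (Cexp_opp_mul mu z1) (Cexp_opp_mul nu z1) H') as [E|E].
    - exists nu; split; [reflexivity|]. unfold Cminus; rewrite Hadd; exact E.
    - exists (- nu)%C; split.
      + intros z. replace (- - nu)%C with nu by ring. ring.
      + unfold Cminus; rewrite Hadd; exact E. }
  destruct Hnu as [nu' [Hsym Hnu]].
  assert (Hone : Cexp ((nu' - mu - de) * RtoC z1) = RtoC 1).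
  { apply (C_div_eq (Cexp (de * RtoC z1))); [apply Cexp_neq_0|]. rewrite <- Hadd.
    replace (de + (nu' - mu - de))%C with (nu' - mu)%C by ring. rewrite Hnu, Ed1; ring. }
  destruct (Cexp_eq_1 _ Hone) as [j Hj].
  assert (Enu : nu' = (mu + de + RtoC 2 * de * RtoC (IZR j))%C).
  { assert (Ed : (nu' - mu - de = RtoC 2 * de * RtoC (IZR j))%C).
    { apply (C_div_eq (RtoC z1) _ _ Hz10).
      transitivity ((nu' - mu - de) * RtoC z1)%C; [ring|]. rewrite Hj.
      transitivity (RtoC 2 * RtoC (IZR j) * (de * RtoC z1))%C; [rewrite Edz|ring].
      apply C_ext; unfold Re, Im; simpl; ring. }
    rewrite <- Ed; ring. }
  (* With X = e^{2 de z}, the choice of nu' turns the numerator into k0 e^{(h + de) z} times e^{mu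
     z} (1 - X^j) + e^{-mu z} (1 - X^{-(j+1)}); both brackets are divisible by X - 1. *)
  destruct (expcomb_geometric (RtoC 2 * de) j) as [g1 [Hg1 E1]].
  destruct (expcomb_geometric (RtoC 2 * de) (- (j + 1))) as [g2 [Hg2 E2]].
  set (g := fun z => (k0 * (Cexp ((de - h) * RtoC z) * (Cexp (mu * RtoC z) * g1 z + Cexp (- mu * RtoC z) * g2 z)))%C).
  assert (Hg : expcomb g).
  { apply (expcomb_scal k0 (fun z => Cexp ((de - h) * RtoC z) * (Cexp (mu * RtoC z) * g1 z + Cexp (- mu * RtoC z) * g2 z))%C).
    apply (expcomb_mult_exp (de - h)%C (fun z => Cexp (mu * RtoC z) * g1 z + Cexp (- mu * RtoC z) * g2 z)%C).
    apply expcomb_plus; apply expcomb_mult_exp; assumption. }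
  exists g; split; [exact Hg|].
  assert (Hprod : forall z, -2 <= z <= 2 ->
    ((Cexp (RtoC 2 * de * RtoC z) + - RtoC 1 * Cexp (RtoC 0 * RtoC z)) * (G z - g z) = RtoC 0)%C).
  { intros z Hz. specialize (Hclosed z Hz). rewrite Hsym in Hclosed.
    assert (EJ : Cexp (nu' * RtoC z) = (Cexp (mu * RtoC z) * Cexp (de * RtoC z) * Cexp (RtoC 2 * de * RtoC (IZR j) * RtoC z))%C).
    { rewrite Enu, !Hadd; reflexivity. }
    assert (EJ' : Cexp (- nu' * RtoC z) = (Cexp (- mu * RtoC z) * Cexp (de * RtoC z)
        * Cexp (RtoC 2 * de * RtoC (IZR (- (j + 1))) * RtoC z))%C).
    { rewrite <- !Hadd, Enu. do 2 f_equal. rewrite opp_IZR, plus_IZR, RtoC_opp, RtoC_plus. ring. }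
    rewrite EJ, EJ' in Hclosed. specialize (E1 z). specialize (E2 z).
    replace (RtoC 0 * RtoC z)%C with (RtoC 0) by ring. rewrite Cexp_0.
    rewrite Hdbl in E1, E2 |- *.
    unfold g; unfold Cminus at 2; rewrite Hadd.
    set (J := Cexp (RtoC 2 * de * RtoC (IZR j) * RtoC z)) in *.
    set (J' := Cexp (RtoC 2 * de * RtoC (IZR (- (j + 1))) * RtoC z)) in *.
    pose proof (Cexp_opp_mul h z) as Hb.
    set (b := Cexp (h * RtoC z)) in *. set (b' := Cexp (- h * RtoC z)) in *.
    set (d := Cexp (de * RtoC z)) in *.
    set (m := Cexp (mu * RtoC z)) in *. set (m' := Cexp (- mu * RtoC z)) in *.
    apply (C_div_eq b); [apply Cexp_neq_0|]. apply (C_div_eq b); [apply Cexp_neq_0|].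
    transitivity (b * b * (d * d - RtoC 1) * G z
      - k0 * b * d * (b * b') * (m * ((d * d - RtoC 1) * g1 z) + m' * ((d * d - RtoC 1) * g2 z)))%C; [ring|].
    rewrite <- Hclosed, <- E1, <- E2, Hb. ring. }
  (* If G and g differed at z they would differ on a neighbourhood, so X - 1 would vanish on an
     interval, which independence of e^{2 de t} and 1 forbids. Hence the zeros of the denominator
     need no separate treatment. *)
  assert (Hopen : forall z, -2 < z < 2 -> G z = g z).
  { intros z Hz. apply NNPP; intros Hn'.
    assert (Hd : Ccontinuous (fun t => Cplus (G t) (Copp (g t))) z).
    { exact (Ccontinuous_plus _ _ _ (HG z) (Ccontinuous_opp _ _ (expcomb_cont g z Hg))). }
    assert (Hpos : 0 < Cmod (Cplus (G z) (Copp (g z)))).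
    { apply Cmod_gt_0. intros E. apply Hn'. transitivity ((G z + - g z) + g z)%C; [ring|]. rewrite E; ring. }
    destruct (Ccontinuous_ball _ z _ Hd Hpos) as [r [Hr Hball]].
    set (r' := Rmin r (Rmin (2 - z) (z + 2))).
    assert (R0 : 0 < r') by (repeat apply Rmin_glb_lt; lra).
    assert (R1 : r' <= r) by apply Rmin_l.
    assert (R2 : r' <= 2 - z) by (eapply Rle_trans; [apply Rmin_r|apply Rmin_l]).
    assert (R3 : r' <= z + 2) by (eapply Rle_trans; [apply Rmin_r|apply Rmin_r]).
    destruct (exponentials_independent (RtoC 2 * de) (RtoC 0) (RtoC 1) (- RtoC 1) (z - r') (z + r')) as [E _].
    - lra.
    - intros E; apply Hde. apply (C_mul_zero (RtoC 2)); assumption.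
    - intros t Ht.
      assert (Hnz : (G t - g t)%C <> RtoC 0).
      { intros E. specialize (Hball t ltac:(apply Rabs_lt_between; lra)).
        replace (G t + - g t - (G z + - g z))%C with ((G t - g t) - (G z + - g z))%C in Hball by ring.
        rewrite E in Hball. replace (RtoC 0 - (G z + - g z))%C with (- (G z + - g z))%C in Hball by ring.
        rewrite Cmod_opp in Hball; lra. }
      apply (C_mul_zero _ _ Hnz). etransitivity; [|apply (Hprod t); lra]. ring.
    - injection E; lra. }
  intros z Hz. apply (Ccontinuous_agree G g (-2) 2 z); [lra|exact Hz|apply HG|apply expcomb_cont, Hg|exact Hopen].
Qed.

(** Composition with the clamp to [-2, 2] turns relative continuity into continuity on the whole
    line. It supplies the endpoint values, over which the derivative sequence on the open interval
    has no control. *)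
Lemma continuous_extension (k : R -> C) : smooth_on (-2) 2 k ->
  exists G, (forall x, Ccontinuous G x) /\ forall z, -2 <= z <= 2 -> G z = k z.
Proof.
  intros [d [H1 H2]].
  set (clamp := fun t => Rmax (-2) (Rmin t 2)).
  assert (Hin : forall t, -2 <= clamp t <= 2).
  { intros t; unfold clamp; split; [apply Rmax_l|apply Rmax_lub; [lra|apply Rmin_r]]. }
  assert (Hlip : forall t x, Rabs (clamp t - clamp x) <= Rabs (t - x)).
  { intros t x; unfold clamp, Rmax, Rmin.
    repeat destruct Rle_dec; unfold Rabs; repeat destruct Rcase_abs; lra. }
  exists (fun t => d 0%nat (clamp t)); split.
  - intros x.
    assert (L : filterlim (d 0%nat) (within (fun y => -2 <= y <= 2) (locally (clamp x)))
       (@locally C_R_NormedModule (d 0%nat (clamp x)))).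
    { apply (filterdiff_continuous_aux (U := R_NormedModule) (V := C_R_NormedModule)).
      - eexists; apply (H2 0%nat (clamp x) (Hin x)).
      - intros P HP; apply filter_le_within; exact HP. }
    assert (Lc : filterlim clamp (locally x) (within (fun y => -2 <= y <= 2) (locally (clamp x)))).
    { intros P [e He]; exists e; intros t Ht. apply He; [|apply Hin].
      eapply Rle_lt_trans; [apply Hlip|exact Ht]. }
    assert (D : filterlim (fun t => d 0%nat (clamp t)) (locally x) (@locally C_R_NormedModule (d 0%nat (clamp x)))).
    { exact (filterlim_comp _ _ _ _ _ _ _ _ Lc L). }
    assert (Hfst : forall p : C_R_NormedModule, filterlim (fun p : C => Re p) (locally p) (locally (Re p))).
    { intros [u v]; apply (continuous_fst (U := R_UniformSpace) (V := R_UniformSpace) u v). }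
    assert (Hsnd : forall p : C_R_NormedModule, filterlim (fun p : C => Im p) (locally p) (locally (Im p))).
    { intros [u v]; apply (continuous_snd (U := R_UniformSpace) (V := R_UniformSpace) u v). }
    split.
    + exact (filterlim_comp _ _ _ _ _ _ _ _ D (Hfst _)).
    + exact (filterlim_comp _ _ _ _ _ _ _ _ D (Hsnd _)).
  - intros z Hz. replace (clamp z) with z; [apply H1, Hz|].
    unfold clamp. rewrite Rmin_left, Rmax_right; lra.
Qed.

(** * From the operator relation to triviality of the kernel *)

Lemma sesqui_of_relation (b c k : R -> C) (B Cf K : nat -> R -> C) :
  derivs B -> derivs Cf -> derivs K ->
  (forall x, -2 <= x <= 2 -> B 0%nat x = b x) ->
  (forall x, -2 <= x <= 2 -> Cf 0%nat x = c x) ->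
  (forall x, -2 <= x <= 2 -> K 0%nat x = k x) ->
  b (-1) = RtoC 0 -> b 1 = RtoC 0 ->
  (exists x, -1 <= x <= 1 /\ b x <> RtoC 0) ->
  (forall z, -2 <= z <= 2 -> k (- z) = Cconj (k z)) ->
  (forall u, smooth_on (-1) 1 u -> forall x, -1 <= x <= 1 ->
    conv_op (conj_kernel k) (diff_op b c u) x = Copp (diff_op b c (conv_op k u) x)) ->
  sesqui B K c.
Proof.
  intros HB HC HK Eb Ec Ek b1 b2 [x0 [Hx0 Hn0]] Hsym Hrel.
  assert (S0 : forall z, -2 < z < 2 -> K 0%nat (- z) = Cconj (K 0%nat z)).
  { intros z Hz; rewrite !Ek by lra; apply Hsym; lra. }
  assert (S1 : forall z, -2 < z < 2 -> K 1%nat (- z) = Cmult (Copp (RtoC 1)) (Cconj (K 1%nat z))).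
  { apply (derive_parity (K 0%nat)); [apply HK|]. intros z Hz; rewrite S0 by exact Hz; ring. }
  assert (S2 : forall z, -2 < z < 2 -> K 2%nat (- z) = Cmult (Copp (Copp (RtoC 1))) (Cconj (K 2%nat z))).
  { apply (derive_parity (K 1%nat)); [apply HK|exact S1]. }
  split; try assumption.
  - rewrite Eb by lra; exact b1.
  - rewrite Eb by lra; exact b2.
  - exists x0. rewrite Eb by lra. split; [|exact Hn0].
    split; apply Rnot_le_lt; intros L; apply Hn0.
    + replace x0 with (-1) by lra; exact b1.
    + replace x0 with 1 by lra; exact b2.
  - intros x y Hx Hy.
    rewrite <- (kernel_relation b c k B Cf K HB HC HK Eb Ec Ek b1 b2 Hrel x y Hx Hy).
    unfold kterm. replace (y - x) with (- (x - y)) by ring.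
    rewrite S0, S1, S2 by lra. ring.
Qed.

(** Otherwise b = A e^{wx}, and b(1) = 0 gives A = 0. *)
Lemma profile_first_order (B K : nat -> R -> C) (c : R -> C) (w : C) : sesqui B K c ->
  ~ (forall x, -1 < x < 1 -> B 1%nat x = (w * B 0%nat x)%C).
Proof.
  intros HS H.
  destruct (exponential_solution (B 0%nat) (-1) 1 w) as [A HA]; [lra| |].
  { intros x Hx; rewrite <- (H x Hx); apply (sesqui_B _ _ _ HS); lra. }
  destruct (sesqui_nonzero _ _ _ HS) as [y [Hy Hny]]. apply Hny. rewrite (HA y Hy).
  assert (E : B 0%nat 1 = (A * Cexp (w * RtoC 1))%C).
  { apply (Ccontinuous_agree (B 0%nat) (fun x => A * Cexp (w * RtoC x))%C (-1) 1 1); [lra|lra|apply (sesqui_Bcont HS); lra| |exact HA].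
    exact (Ccontinuous_mult _ _ _ (Ccontinuous_const A 1) (Ccontinuous_Cexp w 1)). }
  rewrite (sesqui_right _ _ _ HS) in E.
  assert (A = RtoC 0).
  { apply (C_mul_zero (Cexp (w * RtoC 1))); [apply Cexp_neq_0|]. rewrite E; ring. }
  rewrite H0; ring.
Qed.

(** If k(0) = 0, the diagonal relation is b k''(0) + b' k'(0) = 0, so k'(0) = 0 by
    [profile_first_order]. The potential is then small, k' vanishes on some [0, tau], and k vanishes
    near 0. *)
Lemma kernel_at_0_neq_0 (B Cf K : nat -> R -> C) (c : R -> C) : sesqui B K c -> derivs Cf ->
  (forall x, -1 < x < 1 -> Cf 0%nat x = c x) ->
  (forall e, 0 < e -> exists z, Rabs z < e /\ -2 < z < 2 /\ K 0%nat z <> RtoC 0) ->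
  K 0%nat 0 <> RtoC 0.
Proof.
  intros HS HC Ec Hnz E0.
  assert (E1 : K 1%nat 0 = RtoC 0).
  { apply NNPP; intros Hn. apply (profile_first_order B K c (- (K 2%nat 0 / K 1%nat 0))%C HS).
    intros x Hx. pose proof (sesqui_diag HS x Hx) as H. unfold kterm in H. rewrite E0 in H.
    apply (C_div_eq _ _ _ Hn).
    transitivity ((B 0%nat x * K 2%nat 0 + B 1%nat x * K 1%nat 0 + c x * RtoC 0) - B 0%nat x * K 2%nat 0)%C; [ring|].
    rewrite H. field. exact Hn. }
  destruct (start_zero HS) as [tau [Htau Ht]]; [|exact E1|].
  { intros y Hy.
    destruct (Ccontinuous_bounded (Cf 0%nat) (-1) 1) as [M [HM0 HM]]; [lra|intros; apply derivs_cont; [exact HC|lra]|].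
    exists M, 1; split; [exact HM0|split; [lra|]]. intros x z _ Hx _.
    rewrite E0, Cmod_mult. replace (K 0%nat z - RtoC 0)%C with (K 0%nat z) by ring.
    apply Rmult_le_compat_r; [apply Cmod_ge_0|]. rewrite <- Ec by exact Hx. apply HM; lra. }
  destruct (Hnz tau ltac:(lra)) as [z [Hz [Hz2 Hn]]]. apply Rabs_lt_between in Hz.
  assert (Hpos : forall s, 0 <= s <= tau -> K 0%nat s = RtoC 0).
  { intros s Hs. rewrite <- E0. apply (const_on_interval (K 0%nat) (K 1%nat)).
    - lra.
    - apply (sesqui_K _ _ _ HS).
    - intros t Ht'; apply Ht; lra. }
  apply Hn. destruct (Rle_dec 0 z); [apply Hpos; lra|].
  rewrite <- (Ropp_involutive z), (sesqui_sym _ _ _ HS), Hpos by lra.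
  apply C_ext; unfold Re, Im; simpl; ring.
Qed.

(** The alternatives differ in reach: constancy is known only on the zone, while the exponential
    formula for b is nonzero close enough to the endpoints to determine k on all of (-2, 2), and
    continuity adds -2 and 2. *)
Lemma kernel_trivial (B K : nat -> R -> C) (c : R -> C) (G : R -> C) : sesqui B K c ->
  K 0%nat 0 <> RtoC 0 -> K 1%nat 0 = RtoC 0 ->
  (forall x, Ccontinuous G x) -> (forall z, -2 < z < 2 -> G z = K 0%nat z) ->
  (forall z, second_order_zone (B 0%nat) z -> K 0%nat z = K 0%nat 0) \/
  (exists g, expcomb g /\ forall z, -2 <= z <= 2 -> G z = g z).
Proof.
  intros HS H0 H1 HG EG.
  set (lam := (- (K 2%nat 0 / K 0%nat 0))%C).
  assert (Hlam : (K 2%nat 0 + lam * K 0%nat 0 = RtoC 0)%C) by (unfold lam; field; exact H0).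
  assert (Hc : forall x, -1 < x < 1 -> c x = Cmult lam (B 0%nat x)).
  { intros x Hx. pose proof (sesqui_diag HS x Hx) as H. unfold kterm in H. rewrite H1 in H.
    apply (C_div_eq _ _ _ H0).
    transitivity ((B 0%nat x * K 2%nat 0 + B 1%nat x * RtoC 0 + c x * K 0%nat 0) - B 0%nat x * K 2%nat 0)%C; [ring|].
    rewrite H. unfold lam; field; exact H0. }
  destruct (classic (K 2%nat 0 = RtoC 0)) as [H2|H2].
  - left. apply (kernel_const_on_zone HS); [|exact H1].
    intros x Hx; rewrite (Hc x Hx). unfold lam; rewrite H2; field; exact H0.
  - right.
    destruct (profile_exponential HS lam H1 Hlam Hc H2) as [al [be [A [A' [Hne [HA [HA' [Hper HBx]]]]]]]].
    pose proof (kernel_separated HS lam Hc al be A A' Hne HA HA' HBx) as Hsep. cbv zeta in Hsep.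
    destruct (kernel_cosh HS lam H1 al (fun z Hz => proj1 (Hsep z Hz))) as [mu Hmu].
    destruct (kernel_cosh HS lam H1 be (fun z Hz => proj2 (Hsep z Hz))) as [nu Hnu].
    apply (quotient_expcomb (K 0%nat 0) al be mu nu G H0 Hne Hper HG).
    intros z Hz. rewrite <- Hmu, <- Hnu, EG by exact Hz. ring.
Qed.

(** Take y with b(y) <> 0 and |y| > |z| - 1. It serves as x or as y according to whether its sign
    agrees with that of z, so that the second point is shifted inward and stays in [-1, 1]. *)
Lemma zone_full (b : R -> C) : nonzero_near_endpoint b -> forall z, -2 < z < 2 -> second_order_zone b z.
Proof.
  intros H z Hz. pose proof (Rabs_lt_between z 2) as HR.
  assert (Ha : Rabs z < 2) by (apply HR; lra).
  destruct (H (2 - Rabs z)) as [y [[Hy1 Hy2] Hn]]; [lra|].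
  assert (Hz' : Rabs z - 1 < Rabs y) by lra. clear Hy1 HR.
  revert Hy2 Hz' Ha. unfold Rabs. destruct (Rcase_abs z); destruct (Rcase_abs y); intros.
  - exists y, (y - z); repeat split; try lra. now left.
  - exists (y + z), y; repeat split; try lra. now right.
  - exists (y + z), y; repeat split; try lra. now right.
  - exists y, (y - z); repeat split; try lra. now left.
Qed.

Theorem theorem4 (b c k : R -> C)
  (hb : smooth_on (-2) 2 b)
  (hc : smooth_on (-2) 2 c)
  (hk : smooth_on (-2) 2 k)
  (hb_left : b (-1) = RtoC 0)
  (hb_right : b 1 = RtoC 0)
  (hb_second_order : exists x : R, -1 <= x <= 1 /\ b x <> RtoC 0)
  (hk_sym : forall z : R, -2 <= z <= 2 -> k (- z) = Cconj (k z))
  (hk_analytic : analytic_at_0 k)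
  (hk_nonzero : forall eps : R, 0 < eps ->
     exists z : R, Rabs z < eps /\ k z <> RtoC 0)
  (hrel : forall u : R -> C, smooth_on (-1) 1 u ->
     forall x : R, -1 <= x <= 1 ->
       conv_op (conj_kernel k) (diff_op b c u) x
       = Copp (diff_op b c (conv_op k u) x)) :
  trivial_on (second_order_zone b) k /\
  (nonzero_near_endpoint b -> trivial_on (fun z => -2 <= z <= 2) k).
Proof.
  destruct (smooth_on_derivs b hb) as [B [HB Eb]].
  destruct (smooth_on_derivs c hc) as [Cf [HC Ec]].
  destruct (smooth_on_derivs k hk) as [K [HK Ek]].
  destruct (continuous_extension k hk) as [G [HG EG]].
  pose proof (sesqui_of_relation b c k B Cf K HB HC HK Eb Ec Ek hb_left hb_right
    hb_second_order hk_sym hrel) as HS.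
  assert (H0 : K 0%nat 0 <> RtoC 0).
  { apply (kernel_at_0_neq_0 B Cf K c HS HC); [intros; apply Ec; lra|].
    intros e He. destruct (hk_nonzero (Rmin e 2)) as [z [Hz Hn]]; [apply Rmin_glb_lt; lra|].
    pose proof (Rmin_l e 2); pose proof (Rmin_r e 2).
    assert (-2 < z < 2) by (apply Rabs_lt_between; lra).
    exists z; rewrite Ek by lra; repeat split; try lra. exact Hn. }
  (* Multiplication by e^{-az} makes the derivative at 0 equal to k'(0) - a k(0) = 0. *)
  set (a := (K 1%nat 0 / K 0%nat 0)%C).
  assert (Ha : Cconj a = Copp a).
  { pose proof (sesqui_sym _ _ _ HS 0 ltac:(lra)) as S0. pose proof (sesqui_sym1 HS 0 ltac:(lra)) as S1.
    rewrite Ropp_0 in S0, S1. unfold a. rewrite Cdiv_conj, <- S0 by exact H0.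
    replace (Cconj (K 1%nat 0)) with (- K 1%nat 0)%C by (rewrite S1 at 1; ring). field. exact H0. }
  pose proof (sesqui_gauge B K c a Ha HS) as HS'.
  set (G' := fun z => (Cexp (- a * RtoC z) * G z)%C).
  assert (HG' : forall x, Ccontinuous G' x) by (intros x; exact (Ccontinuous_mult _ _ _ (Ccontinuous_Cexp (- a)%C x) (HG x))).
  assert (E00 : gauge (- a)%C K 0%nat 0 = K 0%nat 0).
  { unfold gauge; cbn [twist]. replace (- a * RtoC 0)%C with (RtoC 0) by ring. rewrite Cexp_0; ring. }
  assert (Hback : forall z w, -2 <= z <= 2 -> G' z = w -> k z = (Cexp (a * RtoC z) * w)%C).
  { intros z w Hz <-. unfold G'. rewrite EG by exact Hz.
    rewrite Cmult_assoc, Cexp_opp_mul. ring. }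
  assert (Hzone : forall z, second_order_zone b z -> -2 <= z <= 2) by (intros z [x [y Hxy]]; lra).
  destruct (kernel_trivial _ _ _ G' HS') as [Hconst|[g [Hg EGg]]].
  - rewrite E00; exact H0.
  - unfold gauge; cbn [twist]. replace (- a * RtoC 0)%C with (RtoC 0) by ring.
    rewrite Cexp_0. unfold a; field; exact H0.
  - exact HG'.
  - intros z Hz. unfold G', gauge; cbn [twist]. rewrite EG, Ek by lra. reflexivity.
  - assert (Hk : forall z, second_order_zone b z -> G' z = K 0%nat 0).
    { intros z Hz. rewrite <- E00, <- (Hconst z).
      - unfold G', gauge; cbn [twist]. pose proof (Hzone z Hz). rewrite EG, Ek by lra. reflexivity.
      - destruct Hz as [x [y [Hx [Hy [E Hn]]]]]. exists x, y; repeat split; try lra.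
        unfold gauge; cbn [twist].
        destruct Hn as [Hn|Hn]; [left|right]; (apply Cmult_neq_0; [apply Cexp_neq_0|]); rewrite Eb by lra; exact Hn. }
    assert (Htriv : forall D : R -> Prop, (forall z, D z -> -2 <= z <= 2 /\ G' z = K 0%nat 0) -> trivial_on D k).
    { intros D HD. left. exists 0%nat, (fun _ => K 0%nat 0), (fun _ => a). intros z Hz.
      destruct (HD z Hz) as [Hz1 Hz2]. rewrite (Hback z _ Hz1 Hz2).
      unfold exp_combination; rewrite sum_O; ring. }
    split.
    + apply Htriv; intros z Hz; split; auto.
    (* Here the zone contains all of (-2, 2), and continuity of [G'] adds the two endpoints. *)
    + intros Hend. apply Htriv; intros z Hz; split; [exact Hz|].
      apply (Ccontinuous_agree G' (fun _ => K 0%nat 0) (-2) 2 z); [lra|exact Hz|apply HG'|apply Ccontinuous_const|].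
      intros t Ht; apply Hk, zone_full; assumption.
  - destruct (expcomb_mult_exp a g Hg) as [n [u [w E]]].
    assert (Htriv : forall D : R -> Prop, (forall z, D z -> -2 <= z <= 2) -> trivial_on D k).
    { intros D HD. left. exists n, u, w. intros z Hz. rewrite <- E. apply Hback; auto. }
    split; [apply Htriv, Hzone|intros _; apply Htriv; auto].
Qed.
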